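(* Let $d \ge 2$ and let $T$ be a Fourier multiplier operator on $\mathbb{T}^d$ with multiplier $m$ satisfying the standing assumptions listed in the context. Given any $0 < \gamma \le 2$, there exist $\theta : \mathbb{T}^d \to \mathbb{R}$ and $u : \mathbb{T}^d \to \mathbb{R}^d$ with $$u, \theta \in \bigcap_{0 < \epsilon < 1} \left( \dot{B}^{-\epsilon}_{\infty,\infty}(\mathbb{T}^d) \cap L^{2-\epsilon}(\mathbb{T}^d) \right) \setminus \{0\}$$ such that: (a) $u = T\theta$; (b) $\mathbb{P}_{\neq 0}(\theta u)$ is well-defined as a paraproduct in $\dot{H}^{-s}(\mathbb{T}^d)$ for all $s > d/2 + \max(\gamma - 1, 0)$; (c) $u$ and $\theta$ form a weak paraproduct solution of the stationary active scalar equation $$\nabla \cdot (\theta u) + \Lambda^\gamma \theta = 0, \qquad u = T\theta .$$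
   Context: Conventions: $\mathbb{T}^d = [0,1]^d$ with periodic boundary conditions; $\hat f(\xi) = \int_{\mathbb{T}^d} f(x) e^{-2\pi i \xi \cdot x}\,dx$ for $\xi \in \mathbb{Z}^d$ (extended to distributions by duality). Function spaces of vector-valued functions are understood componentwise. Standing assumptions on $T$: $T$ acts by $(Tf)^\wedge(\xi) = m(\xi)\hat f(\xi)$, $\xi \in \mathbb{Z}^d$, with $m : \mathbb{Z}^d \to \mathbb{C}^d$. It is a Calderon-Zygmund operator of convolution type: $m$ coincides on $\mathbb{Z}^d\setminus\{0\}$ with a function that is smooth on $\mathbb{R}^d \setminus \{0\}$ and homogeneous of degree $0$ (i.e. $m(\lambda\xi)=m(\xi)$ for $\lambda>0$). $T$ maps real-valued functions to $\mathbb{R}^d$-valued functions (so $m(-\xi) = \overline{m(\xi)}$) that are divergence free (so $\xi \cdot m(\xi) = 0$). The multiplier is not odd: there is $\xi \neq 0$ with $m(\xi) + m(-\xi) \neq 0$. If $d \ge 3$, it is moreover assumed that there is a set $\Omega = \{k_1,\dots,k_d\} \subset \mathbb{Z}^d$ which is a basis of $\mathbb{R}^d$, whose elements all have the same Euclidean norm, and such that $\{m(k_i) + m(-k_i) : 1 \le i \le d\}$ is a basis of $\mathbb{R}^d$ (for $d=2$ no such assumption is made). Fractional Laplacian: $(\Lambda^s f)^\wedge(\xi) = |2\pi\xi|^s \hat f(\xi)$ for $\xi\in\mathbb{Z}^d$ (restricted to $\xi \neq 0$ when $s<0$). Littlewood-Paley projectors: fix a smooth radially symmetric $\varphi:\mathbb{R}^d\to[0,1]$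 supported in $\{6/7 \le |\xi| \le 2\}$, equal to $1$ on $\{1 \le |\xi| \le 12/7\}$, with $\sum_{j\ge 0}\varphi(2^{-j}\xi) = 1$ for $|\xi|\ge 1$, and such that $\varphi_j(\cdot) = \varphi(2^{-j}\cdot)$ and $\varphi_{j'}$ have disjoint supports when $|j-j'|\ge 2$. Put $\mathbb{P}_{2^j} f(x) = \sum_{k\in\mathbb{Z}^d}\hat f(k)\varphi_j(k)e^{2\pi i k\cdot x}$ for $j\ge 0$, $\mathbb{P}_{=0}f = \int_{\mathbb{T}^d} f$, and $\mathbb{P}_{\neq 0} = \mathrm{Id}-\mathbb{P}_{=0}$. Spaces: for $s\in\mathbb{R}$, $\|f\|_{\dot H^s}^2 = \sum_{\xi\in\mathbb{Z}^d\setminus\{0\}}|\xi|^{2s}|\hat f(\xi)|^2$ and $\dot H^s(\mathbb{T}^d)$ is the set of $f$ with finite norm; for $\alpha\in\mathbb{R}$, $\dot B^\alpha_{\infty,\infty}(\mathbb{T}^d)$ is the set of distributions $f$ with $\sup_{j\ge 0}2^{j\alpha}\|\mathbb{P}_{2^j}f\|_{L^\infty(\mathbb{T}^d)}<\infty$. Paraproducts: for distributions $f,g$, $\mathbb{P}_{\neq 0}(fg)$ is well-defined as a paraproduct in $\dot H^{s}(\mathbb{T}^d)$ if $\sum_{j,j'\ge 0}\|\mathbb{P}_{\neq 0}(\mathbb{P}_{2^j}(f)\,\mathbb{P}_{2^{j'}}(g))\|_{\dot H^s}<\infty$, and then $\mathbb{P}_{\neq 0}(fg) := \sum_{j,j'\ge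 0}\mathbb{P}_{\neq 0}(\mathbb{P}_{2^j}(f)\,\mathbb{P}_{2^{j'}}(g))$, an absolutely summable series in $\dot H^s$. Weak paraproduct solution: if $\theta\in\dot H^{s}$ for some $s<0$ and $u = T\theta\in\dot H^{s}$, then $u$ and $\theta$ form a weak paraproduct solution of the stationary active scalar equation if there is $s'\in\mathbb{R}$ such that $\mathbb{P}_{\neq 0}(\theta u)$ is well-defined as a paraproduct in $\dot H^{s'}$ and $$\langle\theta,\Lambda^\gamma\phi\rangle_{\dot H^{s},\dot H^{-s}} - \langle\mathbb{P}_{\neq 0}(\theta u),\nabla\phi\rangle_{\dot H^{s'},\dot H^{-s'}} = 0$$ for all smooth $\phi$ on $\mathbb{T}^d$, where $\langle\cdot,\cdot\rangle_{\dot H^s,\dot H^{-s}}$ is the duality pairing. *)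

(* Defs.v *)
From HB Require Import structures.
From mathcomp Require Import all_boot all_order all_algebra.
From mathcomp Require Import complex.
From mathcomp Require Import all_classical all_reals all_analysis.

Set Implicit Arguments.
Unset Strict Implicit.
Unset Printing Implicit Defensive.

Import Order.TTheory GRing.Theory Num.Theory.
Import numFieldNormedType.Exports.

Local Open Scope classical_set_scope.
Local Open Scope complex_scope.
Local Open Scope ring_scope.

Local Notation normc := ComplexField.Normc.normc.

(* Conventions. Functions on the torus are Z^d-periodic functions on R^d,
   integrated over the unit cube. A distribution on the torus is represented by
   the family of its Fourier coefficients, of type 'rV[int]_d -> R[i]. *)

Section Vectors.
Variables (R : realType) (d : nat).

Definition intv (k : 'rV[int]_d) : 'rV[R]_d := map_mx intr k.

(* The canonical norm of 'rV[R]_d is the sup norm. *)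
Definition enorm (x : 'rV[R]_d) : R := Num.sqrt (\sum_i x 0 i ^+ 2).

Definition zperiodic (U : Type) (f : 'rV[R]_d -> U) : Prop :=
  forall (x : 'rV[R]_d) (k : 'rV[int]_d), f (x + intv k) = f x.

End Vectors.

Arguments intv R {d} k.

Section Smooth.
Variables (R : realType) (d : nat).

Fixpoint C_ (n : nat) (U : set 'rV[R]_d) (f : 'rV[R]_d -> R) : Prop :=
  (forall x, U x -> {for x, continuous f}) /\
  match n with
  | 0%N => True
  | n'.+1 => forall i : 'I_d,
      (forall x, U x -> derivable f x (delta_mx 0 i)) /\
      C_ n' U ('D_(delta_mx 0 i) f)
  end.

Definition smooth (U : set 'rV[R]_d) (f : 'rV[R]_d -> R) : Prop :=
  forall n, C_ n U f.

Definition csmooth (U : set 'rV[R]_d) (f : 'rV[R]_d -> R[i]) : Prop :=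
  smooth U (fun x => complex.Re (f x)) /\ smooth U (fun x => complex.Im (f x)).

Definition cpartial (i : 'I_d) (f : 'rV[R]_d -> R[i]) : 'rV[R]_d -> R[i] :=
  fun x => 'D_(delta_mx 0 i) (fun y => complex.Re (f y)) x
        +i* 'D_(delta_mx 0 i) (fun y => complex.Im (f y)) x.

End Smooth.

Section Cube.
Variable R : realType.

Definition tcons (n : nat) (p : measurableTypeR R * n.-tuple (measurableTypeR R))
  : n.+1.-tuple (measurableTypeR R) := [the n.+1.-tuple _ of p.1 :: p.2].

Lemma measurable_tcons n : measurable_fun setT (@tcons n).
Proof. exact: measurable_cons. Qed.

HB.instance Definition _ n :=
  isMeasurableFun.Build _ _ _ _ (@tcons n) (@measurable_tcons n).

(* Lebesgue measure on [0,1]^n, as the n-fold product of the uniform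
   probability on [0,1]. *)
Fixpoint cube (n : nat) : probability (n.-tuple (measurableTypeR R)) R :=
  match n with
  | 0%N => \d_([tuple])
  | n'.+1 => distribution (uniform_prob (@ltr01 R) \x cube n')%E (@tcons n')
  end.

End Cube.

Section Torus.
Variables (R : realType) (d : nat).
Implicit Types (f : 'rV[R]_d -> R) (g : 'rV[R]_d -> R[i]) (p : \bar R).

Definition torus_pt (t : d.-tuple (measurableTypeR R)) : 'rV[R]_d :=
  \row_i tnth t i.

Definition in_Lp p f : Prop := (f \o torus_pt) \in Lfun (cube R d) p.

Definition Linfty_norm g : \bar R :=
  Lnorm (cube R d) +oo%E (fun t => (normc (g (torus_pt t)))%:E).

Definition ae_zero (V : zmodType) (f : 'rV[R]_d -> V) : Prop :=
  {ae cube R d, forall t, f (torus_pt t) = 0}.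

Definition cintegral g : R[i] :=
  (\int[cube R d]_t complex.Re (g (torus_pt t)))
  +i* (\int[cube R d]_t complex.Im (g (torus_pt t))).

(* e^{2 pi i k.x} *)
Definition echar (k : 'rV[int]_d) (x : 'rV[R]_d) : R[i] :=
  let t := 2 * pi * \sum_i (k 0 i)%:~R * x 0 i in cos t +i* sin t.

Definition fourier g : 'rV[int]_d -> R[i] :=
  fun k => cintegral (fun x => g x * echar (- k) x).

Definition rfourier f : 'rV[int]_d -> R[i] := fourier (fun x => (f x)%:C).

End Torus.

Section Distributions.
Variables (R : realType) (d : nat).
Implicit Types (f g : 'rV[int]_d -> R[i]).

Definition mean_free f : 'rV[int]_d -> R[i] :=
  fun k => if k == 0 then 0 else f k.

Definition multiplier (m : 'rV[int]_d -> 'rV[R[i]]_d) f (i : 'I_d)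
  : 'rV[int]_d -> R[i] := fun k => m k 0 i * f k.

(* The value at k = 0 is 0, since 0 `^ s = 0 for s != 0. *)
Definition frac_laplacian (s : R) f : 'rV[int]_d -> R[i] :=
  fun k => ((2 * pi * enorm (intv R k)) `^ s)%:C * f k.

Definition Hnorm (s : R) f : \bar R :=
  ((\esum_(k in [set k : 'rV[int]_d | k != 0%R])
     (enorm (intv R k) `^ (2 * s) * normc (f k) ^+ 2)%R%:E) `^ 2^-1)%E.

Definition in_H (s : R) f : Prop := (Hnorm s f < +oo)%E.

(* Sum of an absolutely summable family. *)
Definition rsum (T : choiceType) (D : set T) (a : T -> R) : R :=
  fine (esum D (EFin \o a)^\+ - esum D (EFin \o a)^\-)%E.

Definition csum (T : choiceType) (D : set T) (a : T -> R[i]) : R[i] :=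
  rsum D (fun k => complex.Re (a k)) +i* rsum D (fun k => complex.Im (a k)).

(* The bilinear duality between dot-H^s and dot-H^(-s), which extends
   the integral of f * g. *)
Definition pairing f g : R[i] :=
  csum [set k : 'rV[int]_d | k != 0] (fun k => f k * g (- k)).

End Distributions.

Section LittlewoodPaley.
Variables (R : realType) (d : nat).

Definition dilate (phi : 'rV[R]_d -> R) (j : nat) : 'rV[R]_d -> R :=
  fun x => phi (2 ^- j *: x).

Definition supp (f : 'rV[R]_d -> R) : set 'rV[R]_d :=
  closure [set x : 'rV[R]_d | f x != 0].

Record LP_cutoff (phi : 'rV[R]_d -> R) : Prop := {
  LP_smooth : smooth setT phi ;
  LP_radial : forall x y, enorm x = enorm y -> phi x = phi y ;
  LP_range : forall x, 0 <= phi x <= 1 ;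
  LP_supp : supp phi `<=` [set x : 'rV[R]_d | 6 / 7 <= enorm x <= 2] ;
  LP_one : forall x, 1 <= enorm x <= 12 / 7 -> phi x = 1 ;
  LP_partition : forall x, 1 <= enorm x ->
    (\sum_(0 <= j <oo) (dilate phi j x)%:E = 1)%E ;
  LP_disjoint : forall j j' : nat, (j + 2 <= j')%N ->
    supp (dilate phi j) `&` supp (dilate phi j') = set0
}.

Variable phi : 'rV[R]_d -> R.
Implicit Types (f g : 'rV[int]_d -> R[i]).

(* A finite sum when phi has compact support. *)
Definition LP (j : nat) f : 'rV[R]_d -> R[i] := fun x =>
  \sum_(k \in [set: 'rV[int]_d])
    f k * (dilate phi j (intv R k))%:C * echar k x.

Definition in_besov (alpha : R) f : Prop :=
  (ereal_sup (range (fun j : nat =>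
     (2 `^ (j%:R * alpha))%:E * Linfty_norm (LP j f))) < +oo)%E.

Definition para_term f g (j j' : nat) : 'rV[int]_d -> R[i] :=
  mean_free (fourier (fun x => LP j f x * LP j' g x)).

Definition paraproduct_wd (s : R) f g : Prop :=
  (\esum_(p in [set: nat * nat]) Hnorm s (para_term f g p.1 p.2) < +oo)%E.

(* F is the sum of the paraproduct series in dot-H^s. The series is absolutely
   summable there, so the order of summation is immaterial. *)
Definition is_paraproduct (s : R) f g (F : 'rV[int]_d -> R[i]) : Prop :=
  [/\ paraproduct_wd s f g, in_H s F &
      (fun N : nat => Hnorm s (fun k =>
         F k - \sum_(j < N) \sum_(j' < N) para_term f g j j' k))
        @ \oo --> 0%E].

Definition weak_paraproduct_solution (m : 'rV[int]_d -> 'rV[R[i]]_d)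
    (gamma : R) (theta : 'rV[int]_d -> R[i])
    (u : 'I_d -> 'rV[int]_d -> R[i]) : Prop :=
  (exists2 s : R, s < 0 & in_H s theta /\ forall i, in_H s (u i)) /\
  (forall i, u i = multiplier m theta i) /\
  exists (s' : R) (F : 'I_d -> 'rV[int]_d -> R[i]),
    (forall i, is_paraproduct s' theta (u i) (F i)) /\
    forall psi : 'rV[R]_d -> R[i], csmooth setT psi -> zperiodic psi ->
      pairing theta (frac_laplacian gamma (fourier psi))
      - \sum_i pairing (F i) (fourier (cpartial i psi)) = 0.

End LittlewoodPaley.

Record standing_multiplier (R : realType) (d : nat)
    (m : 'rV[int]_d -> 'rV[R[i]]_d) : Prop := {
  mult_CZ : exists M : 'rV[R]_d -> 'rV[R[i]]_d,
    [/\ forall i, csmooth [set x : 'rV[R]_d | x != 0] (fun x => M x 0 i),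
        forall (lambda : R) (x : 'rV[R]_d),
          0 < lambda -> x != 0 -> M (lambda *: x) = M x &
        forall k : 'rV[int]_d, k != 0 -> m k = M (intv R k)] ;
  mult_real : forall (k : 'rV[int]_d) (i : 'I_d), m (- k) 0 i = (m k 0 i)^*%C ;
  mult_div_free : forall k : 'rV[int]_d, \sum_i (k 0 i)%:~R * m k 0 i = 0 ;
  mult_not_odd : exists2 k : 'rV[int]_d, k != 0 & m k + m (- k) != 0 ;
  (* m k + m (- k) has real entries by mult_real. *)
  mult_basis : (3 <= d)%N -> exists K : 'I_d -> 'rV[int]_d,
    [/\ basis_of fullv [seq intv R (K i) | i <- enum 'I_d],
        forall i j, enorm (intv R (K i)) = enorm (intv R (K j)) &
        basis_of fullv
          [seq map_mx (@complex.Re R) (m (K i) + m (- K i)) | i <- enum 'I_d]]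
}.

(* Main.v *)
(** The scalar [theta] is the limit of real trigonometric polynomials [t n]. At
   stage [n] one frequency [xi] is targeted, and the residual of the equation at
   [xi] is cancelled exactly by adding two packets of very high frequencies, with
   carriers [p] and [p + xi]: their interaction at [xi] has amplitude proportional
   to [B * conj A * (xi . (m p + m (- p)))], and every other new interaction, apart
   from the mean, has frequency [- xi] or above a threshold. As [m] is homogeneous
   of degree 0, [p] can be taken far away along a fixed direction for which the
   even part of [m] is not nearly orthogonal to [xi]. The envelope of the packets
   is a Riesz product normalized in [L^2]: it has a fixed mean square, so that the
   amplitudes are of the order of the square root of the residual, but its [L^p]
   norms with [p < 2] can be made as small as desired. Hence the series converges
   in every [L^p] with [p < 2] and its coefficients are summable against any
   negative power of the frequency, whereas the interactions at [xi] are controlled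
   by the residual, which gives absolute convergence of the paraproduct. *)

Require Import Defs.
From mathcomp Require Import all_boot all_order all_algebra.
From mathcomp Require Import complex ring lra zify.
From mathcomp Require Import all_classical all_reals all_analysis.
From mathcomp Require Import measurable_realfun.
Import Order.TTheory GRing.Theory Num.Theory.
Import numFieldNormedType.Exports.

Set Implicit Arguments.
Unset Strict Implicit.
Unset Printing Implicit Defensive.
Local Open Scope classical_set_scope.
Local Open Scope complex_scope.
Local Open Scope ring_scope.
Local Notation normc := ComplexField.Normc.normc.

(** * Integration on the torus *)

(** The limit is only known to lie in [L^p] with [p < 2], so the product of the scalar and the
    velocity is out of reach of Lebesgue spaces. The equation is therefore checked on Fourier
    coefficients: every nonzero frequency receives finitely many pairs of atoms, so it is solved
    exactly from some stage on. All norms are dominated by weighted [l^1] sums of coefficients or of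
    pairs. Lengthening the Riesz product makes the [l^1] norm of a packet large; since the threshold
    is chosen afterwards, a negative power of it absorbs this cost. What the threshold cannot absorb
    is the interaction at the target, of the size of the residual there. Those residuals are
    summable because the residual at a new target is the initial one plus the small drifts caused by
    earlier stages. The weight [- (sigma + 1)] used for residuals pays for the fractional Laplacian
    and for the divergence. The even part of the multiplier appears because a resonant pair is
    counted in both orders, with the velocity carried once near [- p] and once near [p]. *)

Section CubeMeasurability.
Variables (R : realType) (d : nat).

(** The sigma-algebra on tuples is generated by the coordinates, whereas the topology of ['rV[R]_d]
    comes from the sup norm. Half-open grid boxes of mesh [1 / n.+1] link the two: there are
    countably many of them, and each point of an open set lies in one that is contained in the
    set. *)
Lemma measurable_preimage_open (U : set 'rV[R]_d) :
  open U -> measurable (@torus_pt R d @^-1` U).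
Proof.
move=> oU.
pose box (p : 'rV[int]_d * nat) : set (d.-tuple (measurableTypeR R)) :=
  \bigcap_(i in [set: 'I_d]) ((@tnth _ _)^~ i @^-1`
    `[(p.1 0 i)%:~R / p.2.+1%:R, ((p.1 0 i)%:~R + 1) / p.2.+1%:R[%classic).
have mbox p : measurable (box p).
  apply: fin_bigcap_measurable => // i _.
  rewrite -[X in measurable X]setTI.
  exact: measurable_tnth.
have -> : @torus_pt R d @^-1` U =
    \bigcup_(p in [set p | box p `<=` @torus_pt R d @^-1` U]) box p.
  apply/seteqP; split=> [t Ut|t [p /= sp /sp]]//.
  have [e /= e0 be] : nbhs_ball (torus_pt t) U.
    by rewrite nbhs_ballE; apply: open_nbhs_nbhs; split.
  have [n ne] : exists n : nat, n.+1%:R^-1 < e.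
    have [n _ /(_ n (leqnn n))] := near_infty_natSinv_lt (PosNum e0).
    by exists n.
  pose p := (\row_i Num.floor (n.+1%:R * tnth t i), n) : 'rV[int]_d * nat.
  have n0 : (0 : R) < n.+1%:R by [].
  exists p => /=.
  - move=> s bs; apply: be; split=> // i j; rewrite !mxE /ball /=.
    have := bs j Logic.I; rewrite /= in_itv /= !mxE => /andP[h1 h2].
    have f1 := ge_floor (n.+1%:R * tnth t j).
    have f2 := floorD1_gt (n.+1%:R * tnth t j).
    move: h1 h2; rewrite ler_pdivrMr // ltr_pdivlMr // => h1 h2.
    apply: lt_trans ne.
    rewrite -(ltr_pM2l n0) divff ?gt_eqF//.
    have -> : n.+1%:R * `|tnth t j - tnth s j| = `|n.+1%:R * tnth t j - n.+1%:R * tnth s j|.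
      by rewrite -mulrBr normrM ger0_norm.
    rewrite ltr_norml; rewrite intrD in f2; move: f1 f2 h1 h2.
    rewrite (mulrC (tnth s j)) => *; apply/andP; split; lra.
  - move=> i _ /=; rewrite in_itv /= !mxE ler_pdivrMr // ltr_pdivlMr // mulrC ge_floor/=.
    by have := floorD1_gt (n.+1%:R * tnth t i); rewrite intrD mulrC.
rewrite bigcup_mkcond; apply: countable_bigcupT_measurable => [|p].
  exact: countableP.
by case: ifP.
Qed.

Lemma measurable_torus_pt (f : 'rV[R]_d -> R) :
  continuous f -> measurable_fun setT (f \o @torus_pt R d).
Proof.
move=> cf; apply: (measurability _ (measurable_realfun.RGenOInfty.measurableE R)).
move=> /= _ [_ [a ->]] <-; rewrite setTI comp_preimage.
apply: measurable_preimage_open; apply: open_comp => //.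
Qed.

End CubeMeasurability.

Section Slices.
Variable R : realType.
Local Notation tup d := (d.-tuple (measurableTypeR R)).

Definition upd d (i : 'I_d) (s : measurableTypeR R) (t : tup d) : tup d :=
  [tuple (if j == i then s else tnth t j) | j < d].

Lemma measurable_upd d (i : 'I_d) :
  measurable_fun setT (fun p : tup d * measurableTypeR R => upd i p.2 p.1).
Proof.
apply/measurable_fun_tnthP => j.
have [ji|ji] := eqVneq j i.
  rewrite (_ : _ \o _ = snd); first exact: measurable_snd.
  by apply/funext => p; rewrite /= tnth_mktuple ji eqxx.
rewrite (_ : _ \o _ = (@tnth _ _)^~ j \o fst).
  by apply: measurableT_comp; [exact: measurable_tnth|exact: measurable_fst].
by apply/funext => p; rewrite /= tnth_mktuple (negbTE ji).
Qed.

Lemma upd0 d (s x : measurableTypeR R) (t : tup d) :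
  upd ord0 s (tcons (x, t)) = tcons (s, t).
Proof.
apply: eq_from_tnth => j; rewrite tnth_mktuple.
by case: (unliftP ord0 j) => [k|] ->; rewrite ?eqxx ?tnth0 //= tnthS /= ?tnthS.
Qed.

Lemma updS d (i : 'I_d) (s x : measurableTypeR R) (t : tup d) :
  upd (lift ord0 i) s (tcons (x, t)) = tcons (x, upd i s t).
Proof.
apply: eq_from_tnth => j; rewrite tnth_mktuple.
case: (unliftP ord0 j) => [k|] ->; rewrite ?tnth0 //= !tnthS (inj_eq lift_inj).
by rewrite tnth_mktuple.
Qed.

Local Notation unif := (uniform_prob (@ltr01 R)).

Lemma ge0_integral_cubeS d (F : tup d.+1 -> \bar R) :
  measurable_fun setT F -> (forall t, 0 <= F t)%E ->
  (\int[cube R d.+1]_t F t =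
   \int[unif]_x \int[cube R d]_t F (tcons (x, t)))%E.
Proof.
move=> mF F0; rewrite [cube R d.+1]/=.
rewrite ge0_integral_distribution//= fubini_tonelli1//=.
by apply: measurableT_comp => //; exact: measurable_tcons.
Qed.

(** [cube] unfolds along its first coordinate only, while integration by parts needs all of them.
    Averaging over coordinate [i] preserves the integral because each factor is a probability;
    nonnegativity allows the exchanges of integrals without integrability. *)
Lemma ge0_integral_cube_slice d (i : 'I_d) (F : tup d -> \bar R) :
  measurable_fun setT F -> (forall t, 0 <= F t)%E ->
  (\int[cube R d]_t F t = \int[cube R d]_t \int[unif]_s F (upd i s t))%E.
Proof.
elim: d i F => [[]//|d IH] i F mF F0.
have mFu : measurable_fun setT
    (fun t => \int[unif]_s F (upd i s t))%E.
  apply: (@measurable_fun_fubini_tonelli_F _ _ _ _ _ _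
    (fun p : tup d.+1 * measurableTypeR R => F (upd i p.2 p.1))) => //.
  by apply: measurableT_comp => //; exact: measurable_upd.
have Fu0 t : (0 <= \int[unif]_s F (upd i s t))%E by apply: integral_ge0.
rewrite (ge0_integral_cubeS mF F0) (ge0_integral_cubeS mFu Fu0).
have mFt x : measurable_fun setT (fun t => F (tcons (x, t))).
  apply: measurableT_comp => //.
  by apply: measurableT_comp; [exact: measurable_tcons|exact: pair1_measurable].
have mFxt : measurable_fun setT (fun p : measurableTypeR R * tup d => F (tcons p)).
  by apply: measurableT_comp => //; exact: measurable_tcons.
case: (unliftP ord0 i) => [j ->|->].
  apply: eq_integral => x _.
  rewrite (IH j _ (mFt x) (fun t => F0 _)); apply: eq_integral => t _.
  by apply: eq_integral => s _; rewrite updS.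
under [RHS]eq_integral => x _.
  under eq_integral => t _ do under eq_integral => y _ do rewrite upd0.
  over.
rewrite (@fubini_tonelli _ _ _ _ _ unif (cube R d) _ mFxt (fun p => F0 _)).
by rewrite integral_cst//= probability_setT mule1.
Qed.

End Slices.

(** * Bounded measurable functions and integration by parts on the torus *)

Section TorusIntegral.
Variables (R : realType) (d : nat).
Implicit Types f g : 'rV[R]_d -> R.

Lemma continuous_fctM f g : continuous f -> continuous g ->
  continuous (fun x => f x * g x).
Proof. by move=> cf cg x; exact: (cvgM (cf x) (cg x)). Qed.

Lemma continuous_fctD f g : continuous f -> continuous g ->
  continuous (fun x => f x + g x).
Proof. by move=> cf cg x; exact: (cvgD (cf x) (cg x)). Qed.

Lemma continuous_fctZ c f : continuous f -> continuous (fun x => c * f x).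
Proof. by move=> cf x; exact: (cvgM (cvg_cst c) (cf x)). Qed.

Lemma continuous_fct_sum (I : Type) (s : seq I) (F : I -> 'rV[R]_d -> R) :
  (forall i, continuous (F i)) -> continuous (fun x => \sum_(i <- s) F i x).
Proof.
move=> cF; elim: s => [|i s IH].
  under eq_fun do rewrite big_nil.
  exact: (@cst_continuous _ _ (0 : R)).
under eq_fun do rewrite big_cons; exact: continuous_fctD.
Qed.

(** Bounded and measurable along the cube: this class is an algebra of integrable functions, so
    linearity of the integral carries no further side condition. *)
Definition tame f :=
  measurable_fun setT (f \o @torus_pt R d) /\ exists C, forall x, `|f x| <= C.

Definition tint f : R := \int[cube R d]_t f (torus_pt t).

Lemma tame_cst c : tame (fun=> c).
Proof. by split; [exact: measurable_cst|exists `|c|]. Qed.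

Lemma tameD f g : tame f -> tame g -> tame (fun x => f x + g x).
Proof.
move=> [mf [C fC]] [mg [D gD]]; split; first exact: measurable_funD.
by exists (C + D) => x; apply: le_trans (ler_normD _ _) _; exact: lerD.
Qed.

Lemma tameM f g : tame f -> tame g -> tame (fun x => f x * g x).
Proof.
move=> [mf [C fC]] [mg [D gD]]; split; first exact: measurable_funM.
by exists (C * D) => x; rewrite normrM; exact: ler_pM.
Qed.

Lemma tameZ c f : tame f -> tame (fun x => c * f x).
Proof. by move=> tf; apply: tameM => //; exact: tame_cst. Qed.

Lemma tameN f : tame f -> tame (fun x => - f x).
Proof.
by move=> /(tameZ (-1)); under eq_fun do rewrite mulN1r.
Qed.

Lemma tameB f g : tame f -> tame g -> tame (fun x => f x - g x).
Proof. by move=> tf tg; apply: tameD => //; exact: tameN. Qed.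

Lemma tame_integrable f :
  tame f -> (cube R d).-integrable setT (EFin \o (f \o @torus_pt R d)).
Proof.
move=> [mf [C fC]]; apply: measurable_bounded_integrable => //.
  by rewrite (le_lt_trans (probability_le1 _ _))// ltry.
exists C; split; first exact: num_real.
by move=> x Cx t _ /=; rewrite (le_trans (fC _))// ltW.
Qed.

Lemma tintD f g : tame f -> tame g ->
  tint (fun x => f x + g x) = tint f + tint g.
Proof.
by move=> tf tg; rewrite /tint RintegralD//; exact: tame_integrable.
Qed.

Lemma tintZ c f : tame f -> tint (fun x => c * f x) = c * tint f.
Proof.
by move=> tf; rewrite /tint RintegralZl//; exact: tame_integrable.
Qed.

Lemma tintN f : tame f -> tint (fun x => - f x) = - tint f.
Proof.
move=> tf; rewrite -[RHS]mulN1r -tintZ//.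
by congr tint; apply/funext => x; rewrite mulN1r.
Qed.

Lemma tintB f g : tame f -> tame g ->
  tint (fun x => f x - g x) = tint f - tint g.
Proof. by move=> tf tg; rewrite tintD ?tintN//; exact: tameN. Qed.

Lemma tint_cst c : tint (fun=> c) = c.
Proof. by rewrite /tint Rintegral_cst//= probability_setT/= mulr1. Qed.

Lemma le_norm_tint f C : tame f -> (forall x, `|f x| <= C) -> `|tint f| <= C.
Proof.
move=> tf fC; have tC := tame_cst C.
have h g : tame g -> (forall x, g x <= C) -> tint g <= C.
  move=> tg gC; rewrite -[leRHS]tint_cst; by apply: le_Rintegral => //; exact: tame_integrable.
have h1 : tint f <= C by apply: h => // x; apply: le_trans (fC x); exact: ler_norm.
have h2 : - tint f <= C.
  rewrite -tintN//; apply: h => [|x]; first exact: tameN.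
  by apply: le_trans (fC x); rewrite -normrN; exact: ler_norm.
by rewrite ler_norml h1 lerNl h2.
Qed.

Lemma continuous_periodic_bounded f : continuous f -> zperiodic f ->
  exists C, forall x, `|f x| <= C.
Proof.
move=> cf pf.
pose A := [set v : 'rV[R]_d | forall i : 'I_d, `[0, 1]%classic (v ord0 i)].
have cA : compact A by exact: (@rV_compact R d (fun=> `[0, 1]%classic) (fun=> @segment_compact R 0 1)).
have : compact (f @` A) by apply: continuous_compact => //; exact: continuous_subspaceT.
move=> /compact_bounded[M [_ /(_ (M + 1))]]; rewrite ltrDl ltr01 => /(_ isT) hM.
exists (M + 1) => x.
have <- : f (x + intv R (\row_i - Num.floor (x 0 i))) = f x by exact: pf.
apply: hM; exists (x + intv R (\row_i - Num.floor (x 0 i))) => //= i.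
rewrite /= in_itv /= !mxE intrN subr_ge0 ge_floor /= lerBlDl ltW //.
by have := floorD1_gt (x 0 i); rewrite intrD mulr1z.
Qed.

Lemma continuous_tame f : continuous f -> zperiodic f -> tame f.
Proof.
by move=> cf pf; split; [exact: measurable_torus_pt|exact: continuous_periodic_bounded].
Qed.

Lemma zperiodic_derive f v : zperiodic f -> zperiodic ('D_v f).
Proof.
move=> pf x k; rewrite /derive.
suff -> : (fun h => h^-1 *: ((f \o shift (x + intv R k)) (h *: v) - f (x + intv R k))) =
  (fun h => h^-1 *: ((f \o shift x) (h *: v) - f x)) by [].
by apply/funext => h; rewrite /= addrA !pf.
Qed.

Lemma derive_line f (a v : 'rV[R]_d) (s : R) :
  derivable f (a + s *: v) v ->
  is_derive s (1 : R) (fun r : R => f (a + r *: v)) ('D_v f (a + s *: v)).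
Proof.
have E : (fun h => h^-1 *: ((f \o shift (a + s *: v)) (h *: v) - f (a + s *: v))) =
    (fun h => h^-1 *: (((fun r : R => f (a + r *: v)) \o shift s) (h *: (1 : R)) - f (a + s *: v))).
  apply/funext => h /=; congr (_ *: (f _ - _)).
  by rewrite scaler1 scalerDl addrCA.
move=> dv; split; first by rewrite /derivable -E.
by rewrite /derive -E.
Qed.

Lemma torus_pt_upd i s (t : d.-tuple (measurableTypeR R)) :
  torus_pt (upd i s t) = torus_pt (upd i 0 t) + s *: delta_mx 0 i.
Proof.
apply/rowP => j; rewrite !mxE !tnth_mktuple /= eq_sym.
by case: (i == j); rewrite ?mulr1 ?add0r ?mulr0 ?addr0.
Qed.

(** On each line in direction [i], the integral over a period is a difference of two values of [f]
    that agree by periodicity. *)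
Lemma tint_derive0 f i : continuous f -> zperiodic f ->
  (forall x, derivable f x (delta_mx 0 i)) ->
  continuous ('D_(delta_mx 0 i) f) -> tint ('D_(delta_mx 0 i) f) = 0.
Proof.
move=> cf pf df cdf; set g := 'D_(delta_mx 0 i) f.
have pg : zperiodic g by exact: zperiodic_derive.
have tg : tame g by exact: continuous_tame.
(* Slicing applies to nonnegative integrands, so the derivative is shifted by a bound [C]; along
   each line the shifted derivative then has integral exactly [C]. *)
have [C gC] := tg.2.
suff : tint (fun x => g x + C) = C.
  by rewrite tintD ?tint_cst//; [lra|exact: tame_cst].
rewrite /tint /Rintegral.
have [mg _] : tame (fun x => g x + C) by apply: tameD => //; exact: tame_cst.
rewrite (ge0_integral_cube_slice i); last 2 first.
- by apply/measurable_EFinP; exact: mg.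
- by move=> t; rewrite lee_fin; have := gC (torus_pt t); rewrite ler_norml; lra.
under eq_integral => t _.
  rewrite integral_uniform; last 2 first.
  - apply/measurable_EFinP.
    apply: (measurableT_comp mg).
    exact: (measurableT_comp (measurable_upd i) (pair1_measurable t)).
  - by move=> s; rewrite lee_fin; have := gC (torus_pt (upd i s t)); rewrite ler_norml; lra.
  rewrite subr0 invr1 mul1e.
  pose F (s : R) : R := f (torus_pt (upd i s t)) + C * s.
  have dF s : is_derive s (1 : R) F (g (torus_pt (upd i s t)) + C).
    rewrite /F torus_pt_upd.
    have h1 := derive_line (df (torus_pt (upd i 0 t) + s *: delta_mx 0 i)).
    rewrite (_ : (fun s0 : R => _) = (fun r => f (torus_pt (upd i 0 t) + r *: delta_mx 0 i)) + C \*: id); last first.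
      by apply/funext => r; rewrite [in LHS]torus_pt_upd.
    have h2 : is_derive s (1 : R) (C \*: (@id R)) (C *: 1) by exact: is_deriveZ.
    have := is_deriveD h1 h2.
    by rewrite /GRing.scale /= mulr1.
  rewrite (@continuous_FTC2 _ _ F) //; last 3 first.
  - apply: continuous_subspaceT => s.
    have -> : (fun x => g (torus_pt (upd i x t)) + C) =
        (fun x => g (torus_pt (upd i 0 t) + x *: delta_mx 0 i) + C).
      by apply/funext => x; rewrite torus_pt_upd.
    apply: cvgD; last exact: cvg_cst.
    apply: (@continuous_comp _ _ _ (fun x : R => torus_pt (upd i 0 t) + x *: delta_mx 0 i) g); last exact: cdf.
    apply: cvgD; first exact: cvg_cst.
    by apply: cvgZr_tmp.
  - have cF : continuous F.
      move=> s; apply: differentiable_continuous; apply/derivable1_diffP.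
      by have [] := dF s.
    split; [by move=> s _; have [] := dF s| |].
    - by apply: cvg_at_right_filter; exact: cF.
    - by apply: cvg_at_left_filter; exact: cF.
  - by move=> s _; rewrite derive1E derive_val.
  rewrite /F.
  have -> : torus_pt (upd i 1 t) = torus_pt (upd i 0 t) + intv R (delta_mx 0 i).
    rewrite torus_pt_upd scale1r; congr (_ + _).
    by apply/rowP => j; rewrite !mxE; case: (_ && _).
  rewrite pf mulr1 mulr0 addr0 -EFinB addrAC subrr add0r.
  over.
by rewrite integral_cst//= probability_setT mule1.
Qed.

Lemma tint_by_parts f g i : continuous f -> zperiodic f -> continuous g -> zperiodic g ->
  (forall x, derivable f x (delta_mx 0 i)) -> continuous ('D_(delta_mx 0 i) f) ->
  (forall x, derivable g x (delta_mx 0 i)) -> continuous ('D_(delta_mx 0 i) g) ->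
  tint (fun x => 'D_(delta_mx 0 i) f x * g x) = - tint (fun x => f x * 'D_(delta_mx 0 i) g x).
Proof.
move=> cf pf cg pg df cdf dg cdg; set v := delta_mx 0 i.
have D : 'D_v (fun x => f x * g x) = (fun x => f x * 'D_v g x + 'D_v f x * g x).
  apply/funext => x; rewrite deriveM//.
  by congr (_ + _); exact: mulrC.
have tf := continuous_tame cf pf; have tg := continuous_tame cg pg.
have tdf := continuous_tame cdf (zperiodic_derive v pf).
have tdg := continuous_tame cdg (zperiodic_derive v pg).
have : tint ('D_v (fun x => f x * g x)) = 0.
  apply: tint_derive0.
  - by move=> x; exact: (cvgM (cf x) (cg x)).
  - by move=> x k; rewrite pf pg.
  - by move=> x; apply: derivableM.
  - by rewrite D => x; exact: (cvgD (cvgM (cf x) (cdg x)) (cvgM (cdf x) (cg x))).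
rewrite D tintD; [|exact: tameM|exact: tameM].
lra.
Qed.

Lemma is_derive_line f (x v : 'rV[R]_d) l :
  is_derive (0 : R) (1 : R) (fun r : R => f (x + r *: v)) l -> is_derive x v f l.
Proof.
have E : (fun h => h^-1 *: ((f \o shift x) (h *: v) - f x)) =
    (fun h => h^-1 *: (((fun r : R => f (x + r *: v)) \o shift 0) (h *: (1 : R)) - f (x + 0 *: v))).
  apply/funext => h /=; rewrite scale0r !addr0; congr (_ *: (f _ - _)).
  by rewrite addrC [in RHS]/GRing.scale /= mulr1.
move=> [dv <-]; split; first by rewrite /derivable E.
by rewrite /derive E.
Qed.

End TorusIntegral.

(** * Real part, imaginary part and modulus *)

Section ComplexModulus.
Variable R : realType.
Implicit Types z w : R[i].

Lemma ReD z w : complex.Re (z + w) = complex.Re z + complex.Re w.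
Proof. by case: z; case: w. Qed.

Lemma ImD z w : complex.Im (z + w) = complex.Im z + complex.Im w.
Proof. by case: z; case: w. Qed.

Lemma ReM z w : complex.Re (z * w) =
  complex.Re z * complex.Re w - complex.Im z * complex.Im w.
Proof. by case: z; case: w. Qed.

Lemma ImM z w : complex.Im (z * w) =
  complex.Re z * complex.Im w + complex.Im z * complex.Re w.
Proof. by case: z; case: w. Qed.

Lemma complex_eq z w :
  complex.Re z = complex.Re w -> complex.Im z = complex.Im w -> z = w.
Proof. by case: z => a b; case: w => c e /= -> ->. Qed.

Lemma Re_sum (I : Type) (s : seq I) (P : pred I) (F : I -> R[i]) :
  complex.Re (\sum_(i <- s | P i) F i) = \sum_(i <- s | P i) complex.Re (F i).
Proof. by apply: (big_morph (fun z => complex.Re z) ReD). Qed.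

Lemma Im_sum (I : Type) (s : seq I) (P : pred I) (F : I -> R[i]) :
  complex.Im (\sum_(i <- s | P i) F i) = \sum_(i <- s | P i) complex.Im (F i).
Proof. by apply: (big_morph (fun z => complex.Im z) ImD). Qed.

Lemma normcE2 z : normc z = Num.sqrt (complex.Re z ^+ 2 + complex.Im z ^+ 2).
Proof. by case: z. Qed.

Lemma normc_ge0 z : 0 <= normc z.
Proof. by rewrite normcE2 sqrtr_ge0. Qed.

Lemma ler_normcD z w : normc (z + w) <= normc z + normc w.
Proof. exact: le_normcD. Qed.

Lemma normc_sum (I : Type) (s : seq I) (P : pred I) (F : I -> R[i]) :
  normc (\sum_(i <- s | P i) F i) <= \sum_(i <- s | P i) normc (F i).
Proof.
apply: (big_ind2 (fun z x => normc z <= x)) => //.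
- by rewrite ComplexField.Normc.normc0.
- by move=> z x w y zx wy; apply: le_trans (ler_normcD _ _) _; exact: lerD.
Qed.

Lemma normcR (x : R) : normc x%:C = `|x|.
Proof. by rewrite normcE2 /= expr0n addr0 sqrtr_sqr. Qed.

Lemma normc_eq0 z : (normc z == 0) = (z == 0).
Proof.
apply/eqP/eqP => [|->]; first exact: ComplexField.Normc.eq0_normc.
exact: ComplexField.Normc.normc0.
Qed.

Lemma normc_conj z : normc (z^*)%C = normc z.
Proof. by case: z => a b; rewrite !normcE2 /= sqrrN. Qed.

Lemma ler_norm_Re z : `|complex.Re z| <= normc z.
Proof. by rewrite normcE2 -sqrtr_sqr ler_sqrt ?lerDl ?addr_ge0 ?sqr_ge0. Qed.

Lemma ler_norm_Im z : `|complex.Im z| <= normc z.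
Proof. by rewrite normcE2 -sqrtr_sqr ler_sqrt ?lerDr ?addr_ge0 ?sqr_ge0. Qed.

Lemma normc_le_ReIm z : normc z <= `|complex.Re z| + `|complex.Im z|.
Proof.
rewrite normcE2 -[leRHS]ger0_norm ?addr_ge0// -sqrtr_sqr ler_sqrt ?sqr_ge0//.
by rewrite sqrrD !real_normK ?num_real// lerD2r lerDl mulrn_wge0 ?mulr_ge0.
Qed.

End ComplexModulus.

(** * Characters and their orthogonality *)

Section Characters.
Variables (R : realType) (d : nat).
Implicit Types (k l : 'rV[int]_d) (x : 'rV[R]_d) (f g : 'rV[R]_d -> R[i]).

Definition phase k x : R := 2 * pi * \sum_i (k 0 i)%:~R * x 0 i.

Lemma echarE k x : echar k x = cos (phase k x) +i* sin (phase k x).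
Proof. by []. Qed.

Lemma phaseD k l x : phase (k + l) x = phase k x + phase l x.
Proof.
rewrite /phase -mulrDr; congr (_ * _); rewrite -big_split /=.
by apply: eq_bigr => i _; rewrite mxE intrD mulrDl.
Qed.

Lemma phaseN k x : phase (- k) x = - phase k x.
Proof.
rewrite /phase -mulrN; congr (_ * _); rewrite -sumrN.
by apply: eq_bigr => i _; rewrite mxE intrN mulNr.
Qed.

Lemma phase_line k x (i : 'I_d) (r : R) :
  phase k (x + r *: delta_mx 0 i) = phase k x + r * (2 * pi * (k 0 i)%:~R).
Proof.
rewrite /phase mulrCA -mulrDr; congr (_ * _).
under eq_bigr do rewrite !mxE mulrDr.
rewrite big_split /=; congr (_ + _).
rewrite (bigD1 i)//= eqxx mulr1 mulrC big1 ?addr0// => j ji.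
by rewrite (negbTE ji) !mulr0.
Qed.

Lemma echarD k l x : echar (k + l) x = echar k x * echar l x.
Proof.
rewrite !echarE phaseD cosD sinD; apply: complex_eq; rewrite ?ReM ?ImM //=.
by rewrite addrC (mulrC (sin _)).
Qed.

Lemma echarN k x : echar (- k) x = (echar k x)^*%C.
Proof. by rewrite !echarE phaseN cosN sinN. Qed.

Lemma echar0 x : echar 0 x = 1.
Proof.
rewrite echarE /phase big1 ?mulr0 ?cos0 ?sin0// => i _.
by rewrite mxE mul0r.
Qed.

Lemma normc_echar k x : normc (echar k x) = 1.
Proof. by rewrite echarE normcE2 /= cos2Dsin2 sqrtr1. Qed.

Lemma continuous_phase k : continuous (phase k).
Proof.
apply: continuous_fctZ; apply: continuous_fct_sum => i; apply: continuous_fctZ.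
exact: coord_continuous.
Qed.

Lemma cos_periodicz (t : R) (n : int) : cos (t + 2 * pi * n%:~R) = cos t.
Proof.
have h (u : R) (j : nat) : cos (u + 2 * pi * j%:R) = cos u.
  by rewrite mulr_natl mulr_natr (periodicn (@cosD2pi R)).
case: n => n; first by rewrite h.
by rewrite NegzE intrN mulrN -[LHS](h _ n.+1) addrNK.
Qed.

Lemma sin_periodicz (t : R) (n : int) : sin (t + 2 * pi * n%:~R) = sin t.
Proof.
have h (u : R) (j : nat) : sin (u + 2 * pi * j%:R) = sin u.
  by rewrite mulr_natl mulr_natr (periodicn (@sinD2pi R)).
case: n => n; first by rewrite h.
by rewrite NegzE intrN mulrN -[LHS](h _ n.+1) addrNK.
Qed.

Lemma zperiodic_echar k : zperiodic (@echar R d k).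
Proof.
move=> x l; rewrite !echarE.
have [n ->] : exists n : int, phase k (x + intv R l) = phase k x + 2 * pi * n%:~R.
  exists (\sum_i k 0 i * l 0 i).
  rewrite /phase -mulrDr; congr (_ * _).
  rewrite rmorph_sum -big_split /=; apply: eq_bigr => i _.
  by rewrite !mxE mulrDr intrM.
by rewrite cos_periodicz sin_periodicz.
Qed.

Definition ctame f := tame (fun x => complex.Re (f x)) /\ tame (fun x => complex.Im (f x)).

Lemma cintegralE f : cintegral f =
  tint (fun x => complex.Re (f x)) +i* tint (fun x => complex.Im (f x)).
Proof. by []. Qed.

Lemma ctame_cst (c : R[i]) : ctame (fun=> c).
Proof. by split; exact: tame_cst. Qed.

Lemma ctameD f g : ctame f -> ctame g -> ctame (fun x => f x + g x).
Proof.
move=> [? ?] [? ?]; split.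
  by under eq_fun do rewrite ReD; exact: tameD.
by under eq_fun do rewrite ImD; exact: tameD.
Qed.

Lemma ctameM f g : ctame f -> ctame g -> ctame (fun x => f x * g x).
Proof.
move=> [? ?] [? ?]; split.
  by under eq_fun do rewrite ReM; apply: tameB; exact: tameM.
by under eq_fun do rewrite ImM; apply: tameD; exact: tameM.
Qed.

Lemma ctame_sum (I : Type) (s : seq I) (P : pred I) (F : I -> 'rV[R]_d -> R[i]) :
  (forall i, ctame (F i)) -> ctame (fun x => \sum_(i <- s | P i) F i x).
Proof.
move=> tF; elim: s => [|i s IH].
  by under eq_fun do rewrite big_nil; exact: ctame_cst.
under eq_fun do rewrite big_cons.
by case: (P i) => //; exact: ctameD.
Qed.

Lemma ctame_echar k : ctame (@echar R d k).
Proof.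
have pe := @zperiodic_echar k.
split; apply: continuous_tame.
- move=> x; apply: (@continuous_comp _ _ _ (phase k) cos); first exact: continuous_phase.
  exact: continuous_cos.
- by move=> x l; rewrite pe.
- move=> x; apply: (@continuous_comp _ _ _ (phase k) sin); first exact: continuous_phase.
  exact: continuous_sin.
- by move=> x l; rewrite pe.
Qed.

Lemma cintegralD f g : ctame f -> ctame g ->
  cintegral (fun x => f x + g x) = cintegral f + cintegral g.
Proof.
move=> [? ?] [? ?]; rewrite !cintegralE; apply: complex_eq => /=.
  by under eq_fun do rewrite ReD; exact: tintD.
by under eq_fun do rewrite ImD; exact: tintD.
Qed.

Lemma cintegralZ c f : ctame f -> cintegral (fun x => c * f x) = c * cintegral f.
Proof.
move=> [? ?]; rewrite !cintegralE; apply: complex_eq => /=.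
  under eq_fun do rewrite ReM.
  by rewrite tintB ?tintZ ?ReM//; exact: tameZ.
under eq_fun do rewrite ImM.
by rewrite tintD ?tintZ ?ImM//; exact: tameZ.
Qed.

Lemma cintegral_sum (I : Type) (s : seq I) (P : pred I) (F : I -> 'rV[R]_d -> R[i]) :
  (forall i, ctame (F i)) ->
  cintegral (fun x => \sum_(i <- s | P i) F i x) = \sum_(i <- s | P i) cintegral (F i).
Proof.
move=> tF; elim: s => [|i s IH].
  under eq_fun do rewrite big_nil.
  by rewrite big_nil cintegralE !tint_cst.
under eq_fun do rewrite big_cons; rewrite big_cons.
case: (P i) => //; rewrite cintegralD ?IH//; exact: ctame_sum.
Qed.

Lemma normc_cintegral_le f C : ctame f -> (forall x, normc (f x) <= C) ->
  normc (cintegral f) <= 2 * C.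
Proof.
move=> [t1 t2] fC; rewrite cintegralE; apply: le_trans (normc_le_ReIm _) _ => /=.
rewrite mulr_natl mulr2n; apply: lerD; apply: le_norm_tint => // x.
  exact: le_trans (ler_norm_Re _) (fC x).
exact: le_trans (ler_norm_Im _) (fC x).
Qed.

Lemma is_derive_affine (a c s : R) : is_derive s (1 : R) (fun r : R => a + r * c) c.
Proof.
have h := is_deriveD (is_derive_cst a s 1) (is_deriveZ c (is_derive_id s (1 : R))).
rewrite (_ : (fun _ => _) = cst a + c \*: id); last first.
  by apply/funext => r; rewrite /= mulrC.
by apply: is_derive_eq h _; rewrite add0r /GRing.scale /= mulr1.
Qed.

Lemma is_derive_cos_phase k x i : is_derive x (delta_mx 0 i) (fun y => cos (phase k y))
  (- (2 * pi * (k 0 i)%:~R) * sin (phase k x)).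
Proof.
apply: is_derive_line.
under eq_fun do rewrite phase_line.
set a := phase k x; set c := (2 * _ * _)%R.
have := @is_derive1_comp _ cos (fun r => a + r * c) _ _ _ (is_derive_cos (a + 0 * c)) (is_derive_affine a c 0).
by rewrite mul0r addr0 mulrC mulrN mulNr.
Qed.

Lemma is_derive_sin_phase k x i : is_derive x (delta_mx 0 i) (fun y => sin (phase k y))
  (2 * pi * (k 0 i)%:~R * cos (phase k x)).
Proof.
apply: is_derive_line.
under eq_fun do rewrite phase_line.
set a := phase k x; set c := (2 * _ * _)%R.
have := @is_derive1_comp _ sin (fun r => a + r * c) _ _ _ (is_derive_sin (a + 0 * c)) (is_derive_affine a c 0).
by rewrite mul0r addr0 mulrC.
Qed.

Lemma continuous_cos_phase k : continuous (fun x => cos (phase k x)).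
Proof.
move=> x; apply: (@continuous_comp _ _ _ (phase k) cos); first exact: continuous_phase.
exact: continuous_cos.
Qed.

Lemma continuous_sin_phase k : continuous (fun x => sin (phase k x)).
Proof.
move=> x; apply: (@continuous_comp _ _ _ (phase k) sin); first exact: continuous_phase.
exact: continuous_sin.
Qed.

Lemma zperiodic_cos_phase k : zperiodic (fun x => cos (phase k x)).
Proof. by move=> x l; have [] := zperiodic_echar k x l. Qed.

Lemma zperiodic_sin_phase k : zperiodic (fun x => sin (phase k x)).
Proof. by move=> x l; have [] := zperiodic_echar k x l. Qed.

Lemma derive_cos_phase k i : 'D_(delta_mx 0 i) (fun x => cos (phase k x)) =
  (fun x => - (2 * pi * (k 0 i)%:~R) * sin (phase k x)).
Proof. by apply/funext => x; have [] := is_derive_cos_phase k x i. Qed.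

Lemma derive_sin_phase k i : 'D_(delta_mx 0 i) (fun x => sin (phase k x)) =
  (fun x => 2 * pi * (k 0 i)%:~R * cos (phase k x)).
Proof. by apply/funext => x; have [] := is_derive_sin_phase k x i. Qed.

Lemma derivable_cos_phase k i x : derivable (fun x => cos (phase k x)) x (delta_mx 0 i).
Proof. by have [] := is_derive_cos_phase k x i. Qed.

Lemma derivable_sin_phase k i x : derivable (fun x => sin (phase k x)) x (delta_mx 0 i).
Proof. by have [] := is_derive_sin_phase k x i. Qed.

Lemma continuous_derive_cos_phase k i : continuous ('D_(delta_mx 0 i) (fun x => cos (phase k x))).
Proof.
by rewrite derive_cos_phase; apply: continuous_fctZ; exact: continuous_sin_phase.
Qed.

Lemma continuous_derive_sin_phase k i : continuous ('D_(delta_mx 0 i) (fun x => sin (phase k x))).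
Proof.
by rewrite derive_sin_phase; apply: continuous_fctZ; exact: continuous_cos_phase.
Qed.

(** For [k != 0], both parts of the character are, up to a nonzero factor, derivatives of periodic
    functions in a direction [i] with [k 0 i != 0]. *)
Lemma cintegral_echar k : cintegral (@echar R d k) = (k == 0)%:R.
Proof.
case: eqVneq => [->|k0].
  rewrite (_ : echar 0 = (fun=> 1)); last by apply/funext => x; rewrite echar0.
  by rewrite cintegralE /= !tint_cst.
have [i ki] : exists i, k 0 i != 0.
  by apply/existsP; apply: contra_neqT k0; rewrite negb_exists => /forallP h; apply/rowP => i; apply/eqP; have := h i; rewrite negbK mxE.
have c0 : 2 * pi * (k 0 i)%:~R != 0 :> R.
  by rewrite !mulf_neq0 ?intr_eq0// gt_eqF// pi_gt0.
rewrite cintegralE; apply: complex_eq => /=.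
- have := @tint_derive0 _ _ _ i (@continuous_sin_phase k) (zperiodic_sin_phase k)
    (@derivable_sin_phase k i) (@continuous_derive_sin_phase k i).
  rewrite derive_sin_phase tintZ; last by case: (ctame_echar k).
  by move=> /eqP; rewrite mulf_eq0 (negbTE c0) => /eqP.
- have := @tint_derive0 _ _ _ i (@continuous_cos_phase k) (zperiodic_cos_phase k)
    (@derivable_cos_phase k i) (@continuous_derive_cos_phase k i).
  rewrite derive_cos_phase tintZ; last by case: (ctame_echar k).
  by move=> /eqP; rewrite mulf_eq0 oppr_eq0 (negbTE c0) => /eqP.
Qed.

Lemma fourier_sum (I : Type) (s : seq I) (c : I -> R[i]) (K : I -> 'rV[int]_d) l :
  fourier (fun x => \sum_(a <- s) c a * echar (K a) x) l = \sum_(a <- s | K a == l) c a.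
Proof.
rewrite /fourier.
under eq_fun do rewrite mulr_suml.
rewrite cintegral_sum; last first.
  by move=> a; apply: ctameM (ctame_echar _); apply: ctameM (ctame_echar _); exact: ctame_cst.
rewrite [RHS]big_mkcond; apply: eq_bigr => a _.
under eq_fun do rewrite -mulrA -echarD.
rewrite cintegralZ ?cintegral_echar ?subr_eq0; last exact: ctame_echar.
by case: eqP; rewrite ?mulr1 ?mulr0.
Qed.

End Characters.

(** * Decay of the Fourier coefficients of smooth functions *)

Section SmoothFourier.
Variables (R : realType) (d : nat).
Implicit Types (k l : 'rV[int]_d) (x : 'rV[R]_d) (f : 'rV[R]_d -> R) (g : 'rV[R]_d -> R[i]).

Lemma smooth_continuous f : smooth setT f -> continuous f.
Proof. by move=> /(_ 0%N) [cf _] x; exact: cf. Qed.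

Lemma smooth_derivable f i x : smooth setT f -> derivable f x (delta_mx 0 i).
Proof. by move=> /(_ 1%N) [_ /(_ i) [df _]]; exact: df. Qed.

Lemma smooth_derive f i : smooth setT f -> smooth setT ('D_(delta_mx 0 i) f).
Proof. by move=> sf n; have [_ /(_ i) []] := sf n.+1. Qed.

Lemma csmooth_cpartial g i : csmooth setT g -> csmooth setT (cpartial i g).
Proof. by move=> [s1 s2]; split; exact: smooth_derive. Qed.

Lemma zperiodic_Re g : zperiodic g -> zperiodic (fun x => complex.Re (g x)).
Proof. by move=> pg x k; rewrite pg. Qed.

Lemma zperiodic_Im g : zperiodic g -> zperiodic (fun x => complex.Im (g x)).
Proof. by move=> pg x k; rewrite pg. Qed.

Lemma zperiodic_cpartial g i : zperiodic g -> zperiodic (cpartial i g).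
Proof.
move=> pg x k; congr (_ +i* _).
  exact: (zperiodic_derive _ (zperiodic_Re pg)).
exact: (zperiodic_derive _ (zperiodic_Im pg)).
Qed.

Lemma csmooth_ctame g : csmooth setT g -> zperiodic g -> ctame g.
Proof.
move=> [s1 s2] pg; split; apply: continuous_tame.
- exact: smooth_continuous.
- exact: zperiodic_Re.
- exact: smooth_continuous.
- exact: zperiodic_Im.
Qed.

(** Integration by parts is available for real functions, so the coefficient is split into the four
    integrals of the real and imaginary parts of [g] against a cosine and a sine. *)
Lemma fourier_cpartial g i k : csmooth setT g -> zperiodic g ->
  fourier (cpartial i g) k = 'i%C * (2 * pi * (k 0 i)%:~R)%:C * fourier g k.
Proof.
move=> sg pg; have [sa sb] := sg.
have tg := csmooth_ctame sg pg.
have tdg := csmooth_ctame (csmooth_cpartial i sg) (zperiodic_cpartial i pg).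
have te := @ctame_echar R d k.
set a := fun x => complex.Re (g x); set b := fun x => complex.Im (g x).
pose c := fun x => cos (phase k x); pose s := fun x => sin (phase k x).
have [pa pb] : zperiodic a /\ zperiodic b by split; [exact: zperiodic_Re|exact: zperiodic_Im].
have bp f h : smooth setT f -> zperiodic f -> (h = c \/ h = s) ->
    tint (fun x => 'D_(delta_mx 0 i) f x * h x) = - tint (fun x => f x * 'D_(delta_mx 0 i) h x).
  move=> sf pf hh; apply: tint_by_parts => //.
  - exact: smooth_continuous.
  - by case: hh => ->; [exact: continuous_cos_phase|exact: continuous_sin_phase].
  - by case: hh => ->; [exact: zperiodic_cos_phase|exact: zperiodic_sin_phase].
  - by move=> x; exact: smooth_derivable.
  - by apply: smooth_continuous; exact: smooth_derive.
  - by move=> x; case: hh => ->; [exact: derivable_cos_phase|exact: derivable_sin_phase].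
  - by case: hh => ->; [exact: continuous_derive_cos_phase|exact: continuous_derive_sin_phase].
have [ta tb] := tg; have [tda tdb] := tdg; have [tc ts] := te.
have F h : ctame h -> fourier h k =
   (tint (fun x => complex.Re (h x) * c x) + tint (fun x => complex.Im (h x) * s x)) +i*
   (tint (fun x => complex.Im (h x) * c x) - tint (fun x => complex.Re (h x) * s x)).
  move=> [th1 th2]; rewrite /fourier cintegralE; apply: complex_eq => /=.
    rewrite -tintD; [|exact: tameM|exact: tameM].
    by congr tint; apply/funext => x; rewrite ReM echarN /= mulrN opprK.
  rewrite -tintB; [|exact: tameM|exact: tameM].
  by congr tint; apply/funext => x; rewrite ImM echarN /= mulrN addrC.
set C := 2 * pi * (k 0 i)%:~R.
have Dc x : 'D_(delta_mx 0 i) c x = - C * s x by have [] := is_derive_cos_phase k x i.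
have Ds x : 'D_(delta_mx 0 i) s x = C * c x by have [] := is_derive_sin_phase k x i.
have B1 f : tame f -> tint (fun x => f x * 'D_(delta_mx 0 i) c x) = - C * tint (fun x => f x * s x).
  move=> tf; rewrite -tintZ; last exact: tameM.
  congr tint; apply/funext => x; apply: (eq_trans (congr1 (fun y => f x * y) (Dc x))).
  by rewrite mulrCA.
have B2 f : tame f -> tint (fun x => f x * 'D_(delta_mx 0 i) s x) = C * tint (fun x => f x * c x).
  move=> tf; rewrite -tintZ; last exact: tameM.
  congr tint; apply/funext => x; apply: (eq_trans (congr1 (fun y => f x * y) (Ds x))).
  by rewrite mulrCA.
rewrite (F _ tg) (F _ tdg).
have E1 : (fun x => complex.Re (cpartial i g x)) = 'D_(delta_mx 0 i) a by [].
have E2 : (fun x => complex.Im (cpartial i g x)) = 'D_(delta_mx 0 i) b by [].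
rewrite /= -/a -/b.
rewrite (bp a c) ?(bp a s) ?(bp b c) ?(bp b s); try by [left|right|].
rewrite !B1 ?B2//.
move: (tint (fun x => a x * c x)) (tint (fun x => a x * s x)) (tint (fun x => b x * c x))
  (tint (fun x => b x * s x)) => u1 u2 u3 u4.
by apply: complex_eq; rewrite /=; ring.
Qed.

Lemma le_enorm_sum (x : 'rV[R]_d) : enorm x <= \sum_i `|x 0 i|.
Proof.
have h0 : 0 <= \sum_i `|x 0 i| by apply: sumr_ge0.
rewrite /enorm -[leRHS]ger0_norm// -sqrtr_sqr ler_sqrt ?sqr_ge0//.
rewrite expr2 mulr_suml; apply: ler_sum => i _.
rewrite -[x 0 i ^+ 2]real_normK ?num_real// expr2 ler_wpM2l//.
by rewrite (bigD1 i)//= lerDl sumr_ge0.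
Qed.

Lemma le_norm_enorm (x : 'rV[R]_d) i : `|x 0 i| <= enorm x.
Proof.
rewrite /enorm -sqrtr_sqr ler_sqrt ?sumr_ge0// => [|j _]; last exact: sqr_ge0.
by rewrite (bigD1 i)//= lerDl sumr_ge0// => j _; exact: sqr_ge0.
Qed.

Lemma enorm_ge0 (x : 'rV[R]_d) : 0 <= enorm x.
Proof. exact: sqrtr_ge0. Qed.

(** Three powers suffice for the weak equation: [gamma - 3 <= - 1 / 2] serves the linear term and
    [1 - 3 <= - sigma] the bilinear one. The three derivatives are taken along the largest
    coordinate of [k], which controls the Euclidean norm up to a factor [d]. *)
Lemma fourier_decay g : csmooth setT g -> zperiodic g ->
  exists2 C, 0 <= C & forall k, normc (fourier g k) * enorm (intv R k) ^+ 3 <= C.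
Proof.
move=> sg pg.
have /boolp.choice[C hC] : forall i : 'I_d, exists C : R,
    0 <= C /\ forall k, normc (fourier g k) * `|(k 0 i)%:~R| ^+ 3 <= C.
  move=> i.
  pose h := cpartial i (cpartial i (cpartial i g)).
  have s1 := csmooth_cpartial i sg; have p1 := zperiodic_cpartial i pg.
  have s2 := csmooth_cpartial i s1; have p2 := zperiodic_cpartial i p1.
  have s3 := csmooth_cpartial i s2; have p3 := zperiodic_cpartial i p2.
  have th : ctame h by exact: csmooth_ctame.
  have [D hD] : exists D, forall x, normc (h x) <= D.
    have [[_ [D1 h1]] [_ [D2 h2]]] := th.
    by exists (D1 + D2) => x; apply: le_trans (normc_le_ReIm _) _; exact: lerD.
  exists (2 * D); split.
    by rewrite mulr_ge0// (le_trans (normc_ge0 (h 0)))//.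
  move=> k; have := @normc_cintegral_le _ _ (fun x => h x * echar (- k) x) D.
  rewrite -[cintegral _]/(fourier h k).
  rewrite (fourier_cpartial _ _ s2 p2) (fourier_cpartial _ _ s1 p1) (fourier_cpartial _ _ sg pg).
  have ni : normc ('i%C : R[i]) = 1 by rewrite normcE2 /= expr0n expr1n add0r sqrtr1.
  rewrite !ComplexField.Normc.normcM ni !mul1r normcR => hle.
  apply: le_trans (hle _ _); last 2 first.
  - by apply: ctameM => //; exact: ctame_echar.
  - by move=> x; rewrite ComplexField.Normc.normcM normc_echar mulr1.
  rewrite mulrC !normrM (ger0_norm (pi_ge0 R)) (ger0_norm (ler0n R 2)).
  have : 1 <= 2 * pi :> R by have := @pi_ge2 R; lra.
  set p := 2 * pi; set t := `|_|; set q := normc _ => p1'.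
  have t0 : 0 <= t by exact: normr_ge0.
  have q0 : 0 <= q by exact: normc_ge0.
  have -> : p * t * (p * t * (p * t * q)) = p ^+ 3 * (t ^+ 3 * q) by ring.
  by rewrite ler_peMl ?mulr_ge0 ?exprn_ge0// exprn_ege1.
exists (d%:R ^+ 3 * \sum_i C i) => [|k].
  by rewrite mulr_ge0 ?exprn_ge0// sumr_ge0// => i _; have [] := hC i.
have e0 := enorm_ge0 (intv R k).
(* In dimension 0 there is no coordinate to choose, and the norm vanishes. *)
have [/existsP[i1 _]|d0] := boolP [exists i : 'I_d, true]; last first.
  have -> : enorm (intv R k) = 0.
    apply/eqP; rewrite eq_le e0 andbT; apply: le_trans (le_enorm_sum _) _.
    by rewrite big1// => i; case/existsP: d0; exists i.
  rewrite expr0n mulr0 mulr_ge0 ?exprn_ge0// sumr_ge0// => i _.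
  by have [] := hC i.
have [i0 hi0] : exists i0, forall i, `|intv R k 0 i| <= `|intv R k 0 i0|.
  case: (@Order.TotalTheory.arg_maxP _ _ _ i1 xpredT (fun i => `|intv R k 0 i|) isT) => i0 _ h.
  by exists i0 => i; exact: h.
have le1 : enorm (intv R k) <= d%:R * `|(k 0 i0)%:~R|.
  apply: le_trans (le_enorm_sum _) _.
  apply: le_trans (ler_sum _ (fun i _ => hi0 i)) _.
  by rewrite sumr_const card_ord -[leLHS]mulr_natl !mxE.
have [C0 /(_ k) hk] := hC i0.
apply: (@le_trans _ _ (d%:R ^+ 3 * C i0)).
  apply: (@le_trans _ _ (normc (fourier g k) * (d%:R * `|(k 0 i0)%:~R|) ^+ 3)).
    by apply: ler_wpM2l; rewrite ?normc_ge0// lerXn2r ?nnegrE ?mulr_ge0.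
  by rewrite exprMn mulrCA ler_wpM2l ?exprn_ge0.
rewrite ler_wpM2l ?exprn_ge0// (bigD1 i0)//= lerDl sumr_ge0// => j _.
by have [] := hC j.
Qed.

End SmoothFourier.

(** * Weighted sums of Fourier coefficients *)

Section FiniteSums.
Variables (R : realType) (T : choiceType).
Implicit Types (I : set T) (a : T -> R) (s : seq T).

Lemma esum_le_seq I a (C : \bar R) : (forall i, 0 <= a i) ->
  (forall s, uniq s -> (forall i, i \in s -> I i) -> ((\sum_(i <- s) a i)%:E <= C)%E) ->
  (\esum_(i in I) (a i)%:E <= C)%E.
Proof.
move=> a0 h; apply: ge_ereal_sup => _ [X [finX XI] <-].
rewrite fsbig_finite//= sumEFin; apply: h; first exact: finmap.fset_uniq.
by move=> i; rewrite in_fset_set// inE => /XI.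
Qed.

Lemma esum_ge_seq I a s : (forall i, 0 <= a i) ->
  uniq s -> (forall i, i \in s -> I i) ->
  ((\sum_(i <- s) a i)%:E <= \esum_(i in I) (a i)%:E)%E.
Proof.
move=> a0 us sI; apply: esum_ge; exists [set` s].
  by split; [exact: finite_seq|move=> i /= /sI].
by rewrite -sumEFin fsbig_seq.
Qed.

(** Each term is at most [C], so the squares add up to at most [C] times the sum: [l^1] embeds in
    [l^2]. *)
Lemma esum_sqr_le I a (C : R) : (forall i, 0 <= a i) ->
  (\esum_(i in I) (a i)%:E <= C%:E)%E ->
  (\esum_(i in I) (a i ^+ 2)%:E <= (C ^+ 2)%:E)%E.
Proof.
move=> a0 hC.
have C0 : 0 <= C by rewrite -lee_fin; apply: le_trans hC; apply: esum_ge0 => i _; rewrite lee_fin.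
have aC i : I i -> a i <= C.
  move=> Ii; rewrite -lee_fin; apply: le_trans hC.
  have := @esum_ge_seq I a [:: i] a0 isT; rewrite big_seq1; apply.
  by move=> j; rewrite inE => /eqP ->.
apply: esum_le_seq => [i|s us sI]; first exact: sqr_ge0.
have sC : \sum_(i <- s) a i <= C.
  by rewrite -lee_fin; apply: le_trans hC; exact: esum_ge_seq.
rewrite lee_fin; apply: (@le_trans _ _ (\sum_(i <- s) C * a i)).
  rewrite !big_seq; apply: ler_sum => i /sI Ii.
  by rewrite expr2 ler_wpM2r// aC.
by rewrite -mulr_sumr expr2 ler_wpM2l.
Qed.

End FiniteSums.

Lemma ler_sum_uniq (R : realType) (T : eqType) (X Y : seq T) (F : T -> R) :
  uniq X -> uniq Y -> {subset X <= Y} -> (forall i, 0 <= F i) ->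
  \sum_(i <- X) F i <= \sum_(i <- Y) F i.
Proof.
move=> uX uY XY F0.
rewrite [leRHS](bigID (mem X)) /= -[in leRHS]big_filter.
rewrite (perm_big [seq i <- Y | i \in X]); last first.
  apply: uniq_perm; rewrite ?filter_uniq// => i.
  by rewrite mem_filter /= andbC; case: (boolP (i \in X)) => [/XY ->|]; rewrite ?andbF.
by rewrite lerDl sumr_ge0.
Qed.

Lemma eq_sum_support (V : zmodType) (T : eqType) (X Y : seq T) (F : T -> V) :
  uniq X -> uniq Y -> (forall i, F i != 0 -> (i \in X) && (i \in Y)) ->
  \sum_(i <- X) F i = \sum_(i <- Y) F i.
Proof.
move=> uX uY h.
have E Z : \sum_(i <- Z) F i = \sum_(i <- [seq i <- Z | F i != 0]) F i.
  by rewrite big_filter [RHS]big_mkcond; apply: eq_bigr => i _; case: eqP.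
rewrite E [RHS]E; apply: perm_big; apply: uniq_perm; rewrite ?filter_uniq// => i.
by rewrite !mem_filter; case: (boolP (F i != 0)) => // /h /andP[-> ->].
Qed.

Section WeightedSums.
Variables (R : realType) (d : nat).
Implicit Types (k l : 'rV[int]_d) (f g : 'rV[int]_d -> R[i]).

Definition en k : R := enorm (intv R k).

Lemma en_ge0 k : 0 <= en k.
Proof. exact: enorm_ge0. Qed.

Lemma en0 : en 0 = 0.
Proof. by rewrite /en /enorm big1 ?sqrtr0// => i _; rewrite !mxE expr0n. Qed.

Lemma enN k : en (- k) = en k.
Proof.
rewrite /en /enorm; congr Num.sqrt; apply: eq_bigr => i _.
by rewrite !mxE intrN sqrrN.
Qed.

Lemma intv_coord_ge1 k : k != 0 -> exists i, 1 <= `|intv R k 0 i|.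
Proof.
move=> k0; have [i ki] : exists i, k 0 i != 0.
  apply/existsP; apply: contra_neqT k0; rewrite negb_exists => /forallP h.
  by apply/rowP => i; apply/eqP; have := h i; rewrite negbK mxE.
exists i; rewrite mxE -intr_norm -[leLHS](mulr1z (1 : R)) ler_int.
by rewrite -gtz0_ge1 normr_gt0.
Qed.

Lemma en_ge1 k : k != 0 -> 1 <= en k.
Proof.
by move=> /intv_coord_ge1[i h]; apply: le_trans h (le_norm_enorm _ _).
Qed.

Lemma en_gt0 k : k != 0 -> 0 < en k.
Proof. by move=> /en_ge1; exact: lt_le_trans. Qed.

Lemma finite_ball (r : R) : exists S : seq 'rV[int]_d,
  uniq S /\ forall k, en k <= r -> k \in S.
Proof.
have [n rn] : exists n : nat, r <= n%:R.
  by exists (Num.truncn r).+1; apply: ltW; exact: truncnS_gt.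
pose F (h : {ffun 'I_d -> 'I_(n.*2.+1)}) : 'rV[int]_d := \row_i ((h i)%:Z - n%:Z).
exists (undup [seq F h | h <- enum {: {ffun 'I_d -> 'I_(n.*2.+1)}}]).
split; first exact: undup_uniq.
move=> k kr; rewrite mem_undup; apply/mapP.
have b i : `|k 0 i| <= n%:Z.
  rewrite -(ler_int R) intr_norm; apply: le_trans rn; apply: le_trans kr.
  by have := le_norm_enorm (intv R k) i; rewrite mxE.
exists [ffun i => inord (absz (k 0 i + n%:Z))]; first by rewrite mem_enum.
apply/rowP => i; rewrite !mxE ffunE.
have := b i; rewrite ler_norml => /andP[b1 b2].
have h : (0 <= k 0 i + n%:Z)%R by lia.
rewrite inordK ?gez0_abs//; first by rewrite addrK.
by rewrite ltnS -addnn -lez_nat PoszD gez0_abs//; lia.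
Qed.

Lemma powR_le_en s t k : k != 0 -> s <= t -> en k `^ s <= en k `^ t.
Proof. by move=> /en_ge1 h st; exact: ler_powR. Qed.

(** A weighted [l^1] bound, phrased with finite lists so that only real numbers occur. It dominates
    the dot-H^(-s) norm, and for positive [s] also the Besov norm of exponent [- s]. *)
Definition wsum_le s f (C : R) :=
  forall S : seq 'rV[int]_d, uniq S -> 0 \notin S ->
    \sum_(k <- S) en k `^ (- s) * normc (f k) <= C.

Lemma Hnorm_le_wsum s f C : wsum_le s f C -> (Hnorm (- s) f <= C%:E)%E.
Proof.
move=> h; rewrite /Hnorm.
have C0 : 0 <= C by have := h [::] isT isT; rewrite big_nil.
have : (\esum_(k in [set k : 'rV[int]_d | k != 0%R]) (en k `^ (- s) * normc (f k))%:E <= C%:E)%E.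
  apply: esum_le_seq => [k|S uS S0]; first by rewrite mulr_ge0 ?powR_ge0 ?normc_ge0.
  by rewrite lee_fin; apply: h => //; apply/negP => /S0; rewrite /= eqxx.
move=> /esum_sqr_le hh.
have {hh} : (\esum_(k in [set k : 'rV[int]_d | k != 0%R])
     ((enorm (intv R k) `^ (2 * - s) * normc (f k) ^+ 2)%R)%:E <= (C ^+ 2)%:E)%E.
  apply: le_trans (hh _); last by move=> k; rewrite mulr_ge0 ?powR_ge0 ?normc_ge0.
  apply: le_esum => k _; rewrite lee_fin exprMn ler_wpM2r ?sqr_ge0//.
  by rewrite -/(en k) mulrC powRrM powR_mulrn ?powR_ge0.
set X := esum _ _ => XC.
have X0 : (0 <= X)%E.
  by apply: esum_ge0 => k _; rewrite lee_fin mulr_ge0 ?powR_ge0 ?sqr_ge0.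
apply: (@le_trans _ _ ((C ^+ 2)%:E `^ 2^-1)%E).
  by apply: gt0_ler_poweR => //; rewrite ?in_itv /= ?X0 ?leey ?lee_fin ?sqr_ge0//=.
by rewrite poweR_EFin powR12_sqrt ?sqr_ge0// sqrtr_sqr ger0_norm.
Qed.

Lemma Hnorm_le_esum s f : (Hnorm (- s) f <=
  \esum_(k in [set k : 'rV[int]_d | k != 0%R]) (en k `^ (- s) * normc (f k))%:E)%E.
Proof.
case E : (esum _ _) => [r| |]; last 2 first.
- by rewrite leey.
- have : (0 <= \esum_(k in [set k : 'rV[int]_d | k != 0%R]) (en k `^ (- s) * normc (f k))%:E)%E.
    by apply: esum_ge0 => k _; rewrite lee_fin mulr_ge0 ?powR_ge0 ?normc_ge0.
  by rewrite E.
apply: Hnorm_le_wsum => S uS S0; rewrite -lee_fin -E; apply: esum_ge_seq => //.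
  by move=> k; rewrite mulr_ge0 ?powR_ge0 ?normc_ge0.
by move=> k kS /=; apply: contraNneq S0 => <-.
Qed.

End WeightedSums.
Arguments en R {d} k.

(** * Littlewood-Paley cutoffs on integer frequencies *)

Section Cutoff.
Variables (R : realType) (d : nat) (phi : 'rV[R]_d -> R).
Hypothesis hphi : LP_cutoff phi.
Implicit Types (k l : 'rV[int]_d) (f g : 'rV[int]_d -> R[i]).

Definition cut (j : nat) k : R := dilate phi j (intv R k).

Definition cutS (N : nat) k : R := \sum_(j < N) cut j k.

Lemma enormZ (c : R) (x : 'rV[R]_d) : 0 <= c -> enorm (c *: x) = c * enorm x.
Proof.
move=> c0; rewrite /enorm.
under eq_bigr do rewrite mxE exprMn.
by rewrite -mulr_sumr sqrtrM ?sqr_ge0// sqrtr_sqr ger0_norm.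
Qed.

Lemma cut_ge0 j k : 0 <= cut j k.
Proof. by have /andP[] := LP_range hphi (2 ^- j *: intv R k). Qed.

Lemma cut_supp j k : cut j k != 0 -> 6 / 7 * 2 ^+ j <= en R k <= 2 * 2 ^+ j.
Proof.
move=> h; have /(LP_supp hphi) /= : supp phi (2 ^- j *: intv R k).
  by apply: subset_closure.
rewrite enormZ ?invr_ge0 ?exprn_ge0// -/(en R k) (mulrC (2 ^- j)).
by rewrite ler_pdivlMr ?ler_pdivrMr ?exprn_gt0.
Qed.

Lemma cut_zero j : cut j 0 = 0.
Proof.
apply/eqP/negPn/negP => /cut_supp /andP[+ _]; rewrite en0.
by apply/negP; rewrite -ltNge; apply: mulr_gt0; rewrite ?exprn_gt0//.
Qed.

Lemma cutS_ge0 N k : 0 <= cutS N k.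
Proof. by apply: sumr_ge0 => j _; exact: cut_ge0. Qed.

Lemma cutS_le1 N k : cutS N k <= 1.
Proof.
have [->|k0] := eqVneq k 0.
  by rewrite /cutS big1// => j _; exact: cut_zero.
have := LP_partition hphi (en_ge1 R k0); rewrite -lee_fin => <-.
rewrite /cutS -sumEFin -(big_mkord xpredT (fun j => (cut j k)%:E)).
by apply: nneseries_lim_ge => j _ _; rewrite lee_fin; exact: cut_ge0.
Qed.

(** The cutoff [j] vanishes at [k] as soon as [6 / 7 * 2 ^+ j] exceeds the norm of [k], so the
    infinite partition of unity is a finite sum there. *)
Lemma cutS_eq1 k : k != 0 -> exists N0, forall N, (N0 <= N)%N -> cutS N k = 1.
Proof.
move=> k0.
have [N0 hN0] : exists N0 : nat, forall j, (N0 <= j)%N -> en R k < 6 / 7 * 2 ^+ j.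
  exists (Num.truncn (2 * en R k)).+1 => j hj.
  have h1 : 2 * en R k < j%:R.
    by apply: (lt_le_trans (truncnS_gt _)); rewrite ler_nat.
  have h2 : j%:R <= 2 ^+ j :> R by rewrite -natrX ler_nat ltnW// ltn_expl.
  have h0 : 0 < 2 ^+ j :> R by exact: exprn_gt0.
  lra.
have z j : (N0 <= j)%N -> cut j k = 0.
  move=> /hN0 h; apply/eqP/negPn/negP => /cut_supp /andP[h1 _].
  by move: (lt_le_trans h h1); rewrite ltxx.
exists N0 => N hN.
have E M : (N0 <= M)%N -> cutS M k = cutS N0 k.
  move=> hM; rewrite /cutS -(subnKC hM) big_split_ord /= [X in _ + X]big1 ?addr0// => j _.
  by rewrite z// leq_addr.
rewrite E//.
have := LP_partition hphi (en_ge1 R k0).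
rewrite (nneseries_split 0 N0) ?add0n; last by move=> j _; rewrite lee_fin cut_ge0.
rewrite eseries0 ?adde0; last by move=> j hj _; rewrite -[dilate _ _ _]/(cut j k) z.
by rewrite big_mkord sumEFin => -[].
Qed.

(** [LP] sums over all frequencies; one list containing the supports of the first [N] cutoffs turns
    all those blocks into sums over the same list. *)
Definition cut_seq_spec (N : nat) (S : seq 'rV[int]_d) :=
  uniq S /\ forall j k, (j < N)%N -> cut j k != 0 -> k \in S.

Lemma cut_seq_exists N : exists S, cut_seq_spec N S.
Proof.
have [S [uS hS]] := @finite_ball R d (2 * 2 ^+ N).
exists S; split => // j k jN /cut_supp /andP[_ h]; apply: hS.
apply: le_trans h _; rewrite ler_wpM2l// ler_weXn2l ?ler1n//; exact: ltnW.
Qed.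

Lemma LP_seq N S j f x : cut_seq_spec N S -> (j < N)%N ->
  LP phi j f x = \sum_(k <- S) f k * (cut j k)%:C * echar k x.
Proof.
move=> [uS hS] jN; rewrite /LP (fsbig_seq _ _ uS).
apply/esym/fsbig_widen => // k [_ /= kS]; rewrite -/(cut j k).
have [->|/(hS _ _ jN)//] := eqVneq (cut j k) 0.
by rewrite mulr0 mul0r.
Qed.

(** A convolution in which the second frequency is solved for: when [k - a] falls outside [S], the
    cutoff kills the term. *)
Lemma fourier_LP_mul N S j j' f g k : cut_seq_spec N S -> (j < N)%N -> (j' < N)%N ->
  fourier (fun x => LP phi j f x * LP phi j' g x) k =
  \sum_(a <- S) (cut j a * cut j' (k - a))%:C * (f a * g (k - a)).
Proof.
move=> hS jN jN'; have [uS hS2] := hS.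
under eq_fun do rewrite (LP_seq f _ hS jN) (LP_seq g _ hS jN') big_distrlr /=.
have -> : (fun x => \sum_(a <- S) \sum_(b <- S) f a * (cut j a)%:C * echar a x * (g b * (cut j' b)%:C * echar b x)) =
  (fun x => \sum_(p <- [seq (a, b) | a <- S, b <- S])
     (f p.1 * (cut j p.1)%:C * (g p.2 * (cut j' p.2)%:C)) * echar (p.1 + p.2) x).
  apply/funext => x; rewrite big_allpairs; apply: eq_bigr => a _; apply: eq_bigr => b _.
  by rewrite echarD mulrACA.
rewrite fourier_sum big_mkcond big_allpairs; apply: eq_bigr => a _ /=.
have E b : (a + b == k) = (b == k - a) by rewrite eq_sym [RHS]eq_sym subr_eq addrC.
under eq_bigr => b _ do rewrite E.
have [kaS|kaS] := boolP (k - a \in S).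
  rewrite (bigD1_seq (k - a))//= eqxx big1 ?addr0 => [|b /negbTE ->//].
  rewrite rmorphM /=; ring.
rewrite big_seq big1 => [|b bS]; last first.
  by case: eqP => // Eb; move: kaS; rewrite -Eb bS.
have -> : cut j' (k - a) = 0 by apply/eqP; apply: contraNT kaS; exact: hS2.
by rewrite mulr0 mul0r.
Qed.

End Cutoff.

(** * Paraproducts and the weak equation *)

Section Paraproducts.
Variables (R : realType) (d : nat) (phi : 'rV[R]_d -> R).
Hypothesis hphi : LP_cutoff phi.
Variables (f g : 'rV[int]_d -> R[i]).
Hypotheses (f0 : f 0 = 0) (g0 : g 0 = 0).
Implicit Types (k a : 'rV[int]_d) (q : 'rV[int]_d * 'rV[int]_d).

(** In [q], the first component is the output frequency and the second the frequency of the first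
    factor; the second factor sits at the difference. *)
Definition pairw (s : R) q : R :=
  en R q.1 `^ (- s) * (normc (f q.2) * normc (g (q.1 - q.2))).

Definition pairsum_le (s C : R) :=
  forall S : seq ('rV[int]_d * 'rV[int]_d), uniq S -> (forall q, q \in S -> q.1 != 0) ->
    \sum_(q <- S) pairw s q <= C.

Lemma pairw_ge0 s q : 0 <= pairw s q.
Proof. by rewrite mulr_ge0 ?powR_ge0// mulr_ge0 ?normc_ge0. Qed.

Lemma para_term_seq N S j j' k : cut_seq_spec phi N S -> (j < N)%N -> (j' < N)%N -> k != 0 ->
  para_term phi f g j j' k =
  \sum_(a <- S) (cut phi j a * cut phi j' (k - a))%:C * (f a * g (k - a)).
Proof.
move=> hS jN jN' k0; rewrite /para_term /mean_free (negbTE k0).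
exact: (fourier_LP_mul _ _ _ hS).
Qed.

Lemma normc_paraterm_seq N S j j' k : cut_seq_spec phi N S -> (j < N)%N -> (j' < N)%N -> k != 0 ->
  normc (para_term phi f g j j' k) <=
  \sum_(a <- S) cut phi j a * cut phi j' (k - a) * (normc (f a) * normc (g (k - a))).
Proof.
move=> hS jN jN' k0; rewrite (para_term_seq hS jN jN' k0).
apply: le_trans (normc_sum _ _ _) _; apply: ler_sum => a _.
by rewrite !ComplexField.Normc.normcM normcR ger0_norm ?mulr_ge0 ?cut_ge0.
Qed.

(** Passing to [l^1] moves the cutoffs onto pairs of frequencies. For a fixed pair, the sum of the
    cutoffs over all blocks factors into two partial sums of the partition of unity, hence is at
    most 1. *)
Lemma paraproduct_wdP s C : pairsum_le s C -> paraproduct_wd phi (- s) f g.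
Proof.
move=> hC; rewrite /paraproduct_wd.
apply: (@le_lt_trans _ _ C%:E); last by rewrite ltry.
apply: ge_ereal_sup => _ [X [finX _] <-].
rewrite fsbig_finite//=.
set Y : seq (nat * nat) := finmap.enum_fset _.
have uY : uniq Y by exact: finmap.fset_uniq.
pose N := (\max_(p <- Y) (p.1 + p.2)).+1.
have YN p : p \in Y -> (p.1 < N)%N && (p.2 < N)%N.
  move=> pY; have := @leq_bigmax_seq _ Y xpredT (fun p => p.1 + p.2)%N p pY isT.
  by rewrite /N !ltnS => h; rewrite (leq_trans (leq_addr _ _) h) (leq_trans (leq_addl _ _) h).
have [S hS] := cut_seq_exists hphi N.
apply: (@le_trans _ _ (\sum_(p <- Y) \esum_(k in [set k : 'rV[int]_d | k != 0%R])
    (en R k `^ (- s) * normc (para_term phi f g p.1 p.2 k))%:E)%E).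
  by apply: lee_sum => p _; exact: Hnorm_le_esum.
rewrite -esum_sum; last by move=> k p _ _; rewrite lee_fin mulr_ge0 ?powR_ge0 ?normc_ge0.
under eq_esum => k _ do rewrite sumEFin.
apply: esum_le_seq => [k|K uK K0].
  by apply: sumr_ge0 => p _; rewrite mulr_ge0 ?powR_ge0 ?normc_ge0.
rewrite lee_fin.
apply: (@le_trans _ _ (\sum_(q <- [seq (k, a) | k <- K, a <- S]) pairw s q)); last first.
  apply: hC; first by apply: allpairs_uniq => [||[? ?] [? ?]]//; case: hS.
  by move=> q /allpairsP[[k a] [/K0 ? _ ->]].
rewrite big_allpairs big_seq [leRHS]big_seq; apply: ler_sum => k /K0 /= k0.
apply: (@le_trans _ _ (en R k `^ (- s) * \sum_(a <- S) normc (f a) * normc (g (k - a)))); last first.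
  by rewrite mulr_sumr.
rewrite -mulr_sumr ler_wpM2l ?powR_ge0//.
apply: (@le_trans _ _ (\sum_(p <- Y) \sum_(a <- S)
   cut phi p.1 a * cut phi p.2 (k - a) * (normc (f a) * normc (g (k - a))))).
  rewrite big_seq [leRHS]big_seq; apply: ler_sum => p /YN /andP[p1 p2].
  exact: (normc_paraterm_seq hS).
rewrite exchange_big /=; apply: ler_sum => a _; rewrite -mulr_suml.
apply: ler_piMl; first by rewrite mulr_ge0 ?normc_ge0.
pose Z : seq (nat * nat) := [seq (j, j') | j <- iota 0 N, j' <- iota 0 N].
have uZ : uniq Z by apply: allpairs_uniq => [||[? ?] [? ?]]//; exact: iota_uniq.
have YZ : {subset Y <= Z}.
  move=> [j j'] /YN /andP[/= h1 h2]; apply/allpairsP; exists (j, j').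
  by rewrite !mem_iota.
apply: (@le_trans _ _ (\sum_(p <- Z) cut phi p.1 a * cut phi p.2 (k - a))).
  by apply: (ler_sum_uniq uY uZ YZ) => p; rewrite mulr_ge0 ?cut_ge0.
have -> : \sum_(p <- Z) cut phi p.1 a * cut phi p.2 (k - a) = cutS phi N a * cutS phi N (k - a).
  rewrite /cutS -(big_mkord xpredT (fun j => cut phi j a)).
  rewrite -(big_mkord xpredT (fun j => cut phi j (k - a))) big_distrlr /=.
  by rewrite /Z big_allpairs /index_iota subn0.
by rewrite mulr_ile1 ?cutS_ge0 ?cutS_le1.
Qed.

(** [A k] lists the finitely many first frequencies of the pairs contributing at [k], so that the
    value of the paraproduct at [k] is a finite sum. *)
Variable A : 'rV[int]_d -> seq 'rV[int]_d.
Hypothesis uA : forall k, uniq (A k).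
Hypothesis hA : forall k a, k != 0 -> f a * g (k - a) != 0 -> a \in A k.

Definition parasum k : R[i] := if k == 0 then 0 else \sum_(a <- A k) f a * g (k - a).

Lemma parasum_sub N k : k != 0 ->
  parasum k - \sum_(j < N) \sum_(j' < N) para_term phi f g j j' k =
  \sum_(a <- A k) (1 - cutS phi N a * cutS phi N (k - a))%:C * (f a * g (k - a)).
Proof.
move=> k0; rewrite /parasum (negbTE k0).
have [S hS] := cut_seq_exists hphi N; have [uS hS2] := hS.
have -> : \sum_(j < N) \sum_(j' < N) para_term phi f g j j' k =
    \sum_(a <- S) (cutS phi N a * cutS phi N (k - a))%:C * (f a * g (k - a)).
  under eq_bigr => j _ do under eq_bigr => j' _ do
    rewrite (para_term_seq hS (ltn_ord j) (ltn_ord j') k0).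
  under eq_bigr => j _ do rewrite exchange_big /=.
  rewrite exchange_big /=; apply: eq_bigr => a _.
  rewrite /cutS big_distrlr rmorph_sum mulr_suml; apply: eq_bigr => j _.
  by rewrite rmorph_sum mulr_suml.
rewrite (@eq_sum_support _ _ S (A k)) => [||//|a]; last 2 first.
- by [].
- move=> h; apply/andP; split; last first.
    by apply: hA => //; apply: contraNneq h => ->; rewrite mulr0.
  have [j ja] : exists j : 'I_N, cut phi j a != 0.
    apply/existsP; apply: contraNT h; rewrite negb_exists => /forallP h.
    rewrite /cutS big1 ?mul0r// => j _; have := h j; rewrite negbK => /eqP //.
  exact: hS2 ja.
rewrite -sumrB; apply: eq_bigr => a _.
by rewrite rmorphB /= mulrBl mul1r.
Qed.

Lemma wsum_parasum s C : pairsum_le s C -> wsum_le s parasum C.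
Proof.
move=> hC K uK K0.
apply: (@le_trans _ _ (\sum_(q <- [seq (k, a) | k <- K, a <- A k]) pairw s q)); last first.
  apply: hC; first by apply: allpairs_uniq_dep => // -[? ?] [? ?] _ _ /= [-> ->].
  by move=> q /allpairsPdep[k [a [kK _ ->]]] /=; apply: contraNneq K0 => <-.
rewrite big_allpairs_dep big_seq [leRHS]big_seq; apply: ler_sum => k kK.
have k0 : k != 0 by apply: contraNneq K0 => <-.
apply: (@le_trans _ _ (en R k `^ (- s) * \sum_(a <- A k) normc (f a) * normc (g (k - a)))); last first.
  by rewrite mulr_sumr.
rewrite /parasum (negbTE k0) ler_wpM2l ?powR_ge0//.
apply: le_trans (normc_sum _ _ _) _; apply: ler_sum => a _.
by rewrite ComplexField.Normc.normcM.
Qed.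

Lemma cutS_eq1_seq (S : seq 'rV[int]_d) : exists N0, forall N, (N0 <= N)%N ->
  forall a, a \in S -> a != 0 -> cutS phi N a = 1.
Proof.
elim: S => [|b S [N0 IH]]; first by exists 0%N.
have [b0|b0] := eqVneq b 0.
  by exists N0 => N /IH h a; rewrite inE => /orP[/eqP ->|/h//]; rewrite b0 eqxx.
have [N1 h1] := cutS_eq1 hphi b0.
exists (maxn N0 N1) => N; rewrite geq_max => /andP[/IH h /h1 h2] a.
by rewrite inE => /orP[/eqP ->|/h].
Qed.

(** A finite list whose sum is within [e] of the supremum leaves at most [e] to any list disjoint
    from it. *)
Lemma pairsum_tail s C e : pairsum_le s C -> 0 < e ->
  exists S0 : seq ('rV[int]_d * 'rV[int]_d), forall S, uniq S ->
    (forall q, q \in S -> q.1 != 0) -> (forall q, q \in S -> q \notin S0) ->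
    \sum_(q <- S) pairw s q <= e.
Proof.
move=> hC e0.
pose E := [set x | exists2 S : seq ('rV[int]_d * 'rV[int]_d),
  uniq S /\ (forall q, q \in S -> q.1 != 0) & x = \sum_(q <- S) pairw s q].
have sE : has_sup E.
  split; first by exists 0; exists [::] => //; rewrite big_nil.
  by exists C => _ [S [uS S0] ->]; exact: hC.
have [_ [S0 [uS0 hS0] ->] h] := sup_adherent e0 sE.
exists S0 => S uS S1 S2.
have : \sum_(q <- S0 ++ S) pairw s q <= sup E.
  apply: sup_upper_bound => //; exists (S0 ++ S) => //; split.
    rewrite cat_uniq uS0 uS andbT /=; apply/hasPn => q /S2 //.
  by move=> q; rewrite mem_cat => /orP[/hS0|/S1].
rewrite big_cat /=; lra.
Qed.

(** The remainder after [N] blocks weighs each pair by one minus a product of two [cutS]. This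
    weight lies in [[0, 1]] and, for [N] large, vanishes on a given finite list of pairs of nonzero
    frequencies; the other pairs form a small tail. *)
Lemma is_paraproduct_parasum s C : pairsum_le s C -> is_paraproduct phi (- s) f g parasum.
Proof.
move=> hC; split.
- exact: paraproduct_wdP hC.
- by rewrite /in_H (le_lt_trans (Hnorm_le_wsum (wsum_parasum hC)))// ltry.
have key e : 0 < e -> exists N0, forall N, (N0 <= N)%N ->
   (Hnorm (- s) (fun k => parasum k - \sum_(j < N) \sum_(j' < N) para_term phi f g j j' k)%R <= e%:E)%E.
  move=> e0; have [S0 hS0] := pairsum_tail hC e0.
  have [N0 hN0] := cutS_eq1_seq ([seq q.2 | q <- S0] ++ [seq q.1 - q.2 | q <- S0]).
  exists N0 => N /hN0 hN; apply: Hnorm_le_wsum => K uK K0.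
  set P := [seq (k, a) | k <- K, a <- A k].
  have uP : uniq P by apply: allpairs_uniq_dep => // -[? ?] [? ?] _ _ /= [-> ->].
  have P0 q : q \in P -> q.1 != 0.
    by move=> /allpairsPdep[k [a [kK _ ->]]] /=; apply: contraNneq K0 => <-.
  apply: (@le_trans _ _ (\sum_(q <- P) (1 - cutS phi N q.2 * cutS phi N (q.1 - q.2)) * pairw s q)).
    rewrite big_allpairs_dep big_seq [leRHS]big_seq; apply: ler_sum => k kK.
    have k0 : k != 0 by apply: contraNneq K0 => <-.
    rewrite parasum_sub//=.
    under [leRHS]eq_bigr => a _ do rewrite /pairw /= mulrCA.
    rewrite -[leRHS]mulr_sumr ler_wpM2l ?powR_ge0//.
    apply: le_trans (normc_sum _ _ _) _; apply: ler_sum => a _.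
    rewrite !ComplexField.Normc.normcM normcR ger0_norm// subr_ge0.
    by rewrite mulr_ile1 ?cutS_ge0 ?cutS_le1.
  apply: (@le_trans _ _ (\sum_(q <- [seq q <- P | q \notin S0]) pairw s q)).
    rewrite big_filter [leRHS]big_mkcond; apply: ler_sum => q _.
    have c1 : 0 <= cutS phi N q.2 * cutS phi N (q.1 - q.2) by rewrite mulr_ge0 ?cutS_ge0.
    case: (boolP (q \in S0)) => /= [qS|_]; last by rewrite ler_piMl ?pairw_ge0//; lra.
    (* The cutoffs never reach frequency 0; pairs using it contribute nothing because [f] and [g]
       vanish there. *)
    have [q2|q2] := eqVneq q.2 0.
      by rewrite /pairw q2 f0 ComplexField.Normc.normc0 mul0r !mulr0.
    have [q1|q1] := eqVneq (q.1 - q.2) 0.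
      by rewrite /pairw q1 g0 ComplexField.Normc.normc0 !mulr0.
    rewrite !hN ?mulr1 ?subrr ?mul0r//.
      by rewrite mem_cat; apply/orP; right; apply/mapP; exists q.
    by rewrite mem_cat; apply/orP; left; apply/mapP; exists q.
  apply: hS0; first exact: filter_uniq.
    by move=> q; rewrite mem_filter => /andP[_ /P0].
  by move=> q; rewrite mem_filter => /andP[].
have H0 N : (0 <= Hnorm (- s) (fun k => parasum k - \sum_(j < N) \sum_(j' < N) para_term phi f g j j' k)%R)%E.
  exact: poweR_ge0.
apply/fine_cvgP; split.
  have [N0 h] := key 1 ltr01; exists N0 => // N /= /h h1.
  rewrite ge0_fin_numE; last exact: H0.
  exact: (le_lt_trans h1 (ltry _)).
apply/cvgrPdist_le => e e0; have [N0 h] := key e e0; exists N0 => // N /= /h h1.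
rewrite sub0r normrN ger0_norm; last by apply: fine_ge0; exact: H0.
rewrite -lee_fin fineK// ge0_fin_numE; last exact: H0.
exact: (le_lt_trans h1 (ltry _)).
Qed.

End Paraproducts.

(** The sup norm of a block is at most the [l^1] norm of its coefficients, and block [j] lives on
    frequencies of norm at most [2 ^ j.+1]. The shift from [j] to [j.+1] is the source of the factor
    [2 ^ e]. *)
Lemma besov_of_wsum (R : realType) (d : nat) (phi : 'rV[R]_d -> R) (hphi : LP_cutoff phi)
  (f : 'rV[int]_d -> R[i]) (e C : R) : 0 < e -> wsum_le e f C -> in_besov phi (- e) f.
Proof.
move=> e0 hC; rewrite /in_besov.
have C0 : 0 <= C by have := hC [::] isT isT; rewrite big_nil.
apply: (@le_lt_trans _ _ (2 `^ e * C)%:E); last by rewrite ltry.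
apply: ge_ereal_sup => _ [j _ <-].
have [S hS] := cut_seq_exists hphi j.+1.
pose B := \sum_(k <- S) normc (f k) * cut phi j k.
have hB x : normc (LP phi j f x) <= B.
  rewrite (LP_seq f x hS (ltnSn j)); apply: le_trans (normc_sum _ _ _) _.
  apply: ler_sum => k _.
  by rewrite !ComplexField.Normc.normcM normc_echar mulr1 normcR ger0_norm ?cut_ge0.
have B0 : 0 <= B by apply: sumr_ge0 => k _; rewrite mulr_ge0 ?normc_ge0 ?cut_ge0.
have hL : (Linfty_norm (LP phi j f) <= B%:E)%E.
  rewrite /Linfty_norm unlock /=; case: ifP => _; last by rewrite lee_fin.
  apply/ess_sup_inf.ess_supP; apply: nearW => t /=.
  by rewrite lee_fin ger0_norm ?normc_ge0.
rewrite EFinM; apply: (@le_trans _ _ ((2 `^ (j%:R * - e))%:E * B%:E)%E).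
  by apply: lee_pmul => //; rewrite ?lee_fin ?powR_ge0//; exact: Lnorm_ge0.
rewrite -!EFinM lee_fin.
have -> : (2 : R) `^ (j%:R * - e) = 2 `^ e * 2 `^ (j.+1%:R * - e).
  rewrite -powRD; last by apply/implyP => _; rewrite pnatr_eq0.
  by congr (_ `^ _); rewrite -natr1; ring.
rewrite -mulrA ler_wpM2l ?powR_ge0//.
apply: le_trans (hC [seq k <- S | k != 0] _ _); last 2 first.
- by apply: filter_uniq; case: hS.
- by rewrite mem_filter eqxx.
rewrite big_filter [leRHS]big_mkcond /B mulr_sumr; apply: ler_sum => k _.
have [->|k0] /= := eqVneq k 0; first by rewrite cut_zero// !mulr0.
have [->|ck] := eqVneq (cut phi j k) 0.
  by rewrite !mulr0 mulr_ge0 ?powR_ge0 ?normc_ge0.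
have /andP[_ h2] := cut_supp hphi ck.
have c1 : cut phi j k <= 1 by have /andP[] := LP_range hphi (2 ^- j *: intv R k).
apply: (@le_trans _ _ (2 `^ (j.+1%:R * - e) * normc (f k))).
  by rewrite ler_wpM2l ?powR_ge0// ler_piMr ?normc_ge0.
rewrite ler_wpM2r ?normc_ge0// powRrM powR_mulrn// !powRN lef_pV2 ?posrE ?powR_gt0 ?en_gt0//.
by rewrite exprS ge0_ler_powR// ?nnegrE ?en_ge0 ?ltW// mulr_gt0 ?exprn_gt0.
Qed.

Lemma normc_opp (R : realType) (z : R[i]) : normc (- z) = normc z.
Proof. by case: z => a b; rewrite !normcE2 /= !sqrrN. Qed.

(** * Additivity of sums of absolutely summable families *)

Section AbsoluteSums.
Variables (R : realType) (T : choiceType) (D : set T).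
Implicit Types (a b p n : T -> R) (z w : T -> R[i]).

Definition asummable a := (\esum_(i in D) `|a i|%:E < +oo)%E.

Lemma asummable_le a b : (forall i, `|b i| <= `|a i|) -> asummable a -> asummable b.
Proof. by move=> h; apply: le_lt_trans; apply: le_esum => i _; rewrite lee_fin. Qed.

Lemma asummableD a b : asummable a -> asummable b -> asummable (fun i => a i + b i).
Proof.
move=> sa sb; apply: (@le_lt_trans _ _ (\esum_(i in D) (`|a i|%:E + `|b i|%:E)))%E.
  by apply: le_esum => i _; rewrite -EFinD lee_fin ler_normD.
by rewrite esumD ?lte_add_pinfty// => i _; rewrite lee_fin.
Qed.

(** [rsum] is defined through the positive and negative parts; its value may be read off any
    summable decomposition. Additivity needs this, since the positive part of a sum is not the sum
    of the positive parts. *)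
Lemma rsum_posB p n : (forall i, 0 <= p i) -> (forall i, 0 <= n i) ->
  asummable p -> asummable n ->
  rsum D (fun i => p i - n i) =
  fine (\esum_(i in D) (p i)%:E)%E - fine (\esum_(i in D) (n i)%:E)%E.
Proof.
move=> p0 n0 sp sn.
have fn q : (forall i, 0 <= q i) -> asummable q -> \esum_(i in D) (q i)%:E \is a fin_num.
  move=> q0; rewrite /asummable; under eq_esum do rewrite ger0_norm//.
  by move=> h; rewrite ge0_fin_numE// esum_ge0// => i _; rewrite lee_fin.
rewrite /rsum -fineB ?fn//; congr fine.
rewrite -(@esumB R T D (EFin \o p) (EFin \o n))//.
- by move=> i _; rewrite lee_fin.
- by move=> i _; rewrite lee_fin.
Qed.

Lemma rsumD a b : asummable a -> asummable b ->
  rsum D (fun i => a i + b i) = rsum D a + rsum D b.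
Proof.
move=> sa sb.
pose pos c (i : T) : R := Num.max (c i) 0; pose neg c (i : T) : R := Num.max (- c i) 0.
have p0 c i : 0 <= pos c i by rewrite le_max lexx orbT.
have n0 c i : 0 <= neg c i by rewrite le_max lexx orbT.
have E c i : c i = pos c i - neg c i.
  by rewrite /pos /neg; case: (lerP (c i) 0); case: (lerP (- c i) 0); lra.
have sp c : asummable c -> asummable (pos c).
  apply: asummable_le => i; rewrite (ger0_norm (p0 _ _)) /pos.
  by case: (lerP (c i) 0) => // h; rewrite ?normr_ge0// ler_norm.
have sn c : asummable c -> asummable (neg c).
  apply: asummable_le => i; rewrite (ger0_norm (n0 _ _)) /neg.
  by case: (lerP (- c i) 0) => // h; rewrite ?normr_ge0// -normrN ler_norm.
have -> : (fun i => a i + b i) = (fun i => (pos a i + pos b i) - (neg a i + neg b i)).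
  by apply/funext => i; rewrite [in LHS](E a) [in LHS](E b); lra.
rewrite [in RHS](funext (E a)) [in RHS](funext (E b)).
have fn q : (forall i, 0 <= q i) -> asummable q -> \esum_(i in D) (q i)%:E \is a fin_num.
  move=> q0; rewrite /asummable; under eq_esum do rewrite ger0_norm//.
  by move=> h; rewrite ge0_fin_numE// esum_ge0// => i _; rewrite lee_fin.
have [pa na pb nb] : [/\ asummable (pos a), asummable (neg a), asummable (pos b) & asummable (neg b)].
  by split; [exact: sp|exact: sn|exact: sp|exact: sn].
rewrite (rsum_posB (p0 a) (n0 a) pa na) (rsum_posB (p0 b) (n0 b) pb nb).
rewrite (rsum_posB _ _ (asummableD pa pb) (asummableD na nb)); last 2 first.
- by move=> i; rewrite addr_ge0.
- by move=> i; rewrite addr_ge0.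
under eq_esum do rewrite EFinD.
under [X in _ - fine X]eq_esum do rewrite EFinD.
rewrite !esumD; try by move=> i _; rewrite lee_fin.
have f1 := fn _ (p0 a) pa; have f2 := fn _ (n0 a) na.
have f3 := fn _ (p0 b) pb; have f4 := fn _ (n0 b) nb.
by rewrite !fineD//; lra.
Qed.

Lemma rsum0 : rsum D (fun=> 0 : R) = 0.
Proof.
rewrite /rsum !esum1 ?subee// => i _.
  by rewrite funenegE /= ?oppe0 ?oppr0 maxxx.
by rewrite funeposE /= maxxx.
Qed.

Lemma rsumN a : asummable a -> rsum D (fun i => - a i) = - rsum D a.
Proof.
move=> sa; have sNa : asummable (fun i => - a i).
  by apply: asummable_le sa => i; rewrite normrN.
apply/eqP; rewrite -addr_eq0 -rsumD//.
under [X in rsum _ X]eq_fun do rewrite addNr.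
by rewrite rsum0.
Qed.

Definition csummable z := asummable (fun i => normc (z i)).

Lemma csummable_Re z : csummable z -> asummable (fun i => complex.Re (z i)).
Proof.
by apply: asummable_le => i; rewrite (ger0_norm (normc_ge0 _)) ler_norm_Re.
Qed.

Lemma csummable_Im z : csummable z -> asummable (fun i => complex.Im (z i)).
Proof.
by apply: asummable_le => i; rewrite (ger0_norm (normc_ge0 _)) ler_norm_Im.
Qed.

Lemma csummableD z w : csummable z -> csummable w -> csummable (fun i => z i + w i).
Proof.
move=> sz sw; apply: asummable_le (asummableD sz sw) => i.
by rewrite !ger0_norm ?addr_ge0 ?normc_ge0// ler_normcD.
Qed.

Lemma csumD z w : csummable z -> csummable w ->
  csum D (fun i => z i + w i) = csum D z + csum D w.
Proof.
move=> sz sw; apply: complex_eq; rewrite /csum /=.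
  under [X in rsum _ X]eq_fun do rewrite ReD.
  by rewrite rsumD//; exact: csummable_Re.
under [X in rsum _ X]eq_fun do rewrite ImD.
by rewrite rsumD//; exact: csummable_Im.
Qed.

Lemma csumN z : csummable z -> csum D (fun i => - z i) = - csum D z.
Proof.
move=> sz; apply: complex_eq; rewrite /csum /=.
  rewrite -rsumN; last exact: csummable_Re.
  by congr rsum; apply/funext => i; case: (z i).
rewrite -rsumN; last exact: csummable_Im.
by congr rsum; apply/funext => i; case: (z i).
Qed.

Lemma csum0 : csum D (fun=> (0 : R[i])) = 0.
Proof.
by apply: complex_eq; rewrite /csum /= rsum0.
Qed.

Lemma csummable_sum (I : Type) (s : seq I) (z : I -> T -> R[i]) :
  (forall j, csummable (z j)) -> csummable (fun i => \sum_(j <- s) z j i).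
Proof.
move=> sz; elim: s => [|j s IH].
  under eq_fun do rewrite big_nil.
  by rewrite /csummable /asummable esum1// => i _; rewrite ComplexField.Normc.normc0 normr0.
under eq_fun do rewrite big_cons.
exact: csummableD.
Qed.

Lemma csum_sum (I : Type) (s : seq I) (z : I -> T -> R[i]) :
  (forall j, csummable (z j)) ->
  csum D (fun i => \sum_(j <- s) z j i) = \sum_(j <- s) csum D (z j).
Proof.
move=> sz; elim: s => [|j s IH].
  by under eq_fun do rewrite big_nil; rewrite big_nil csum0.
under eq_fun do rewrite big_cons; rewrite big_cons.
by rewrite csumD ?IH//; exact: csummable_sum.
Qed.

End AbsoluteSums.

(** * From the equation on Fourier coefficients to the weak formulation *)

Section WeakEquation.
Variables (R : realType) (d : nat) (phi : 'rV[R]_d -> R).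
Hypothesis hphi : LP_cutoff phi.
Variables (m : 'rV[int]_d -> 'rV[R[i]]_d) (theta : 'rV[int]_d -> R[i]).
Implicit Types (k : 'rV[int]_d).

Lemma csummable_wsum s f C (z : 'rV[int]_d -> R[i]) B : 0 <= B -> wsum_le s f C ->
  (forall k, k != 0 -> normc (z k) <= B * (en R k `^ (- s) * normc (f k))) ->
  csummable [set k | k != 0] z.
Proof.
move=> B0 hC h; rewrite /csummable /asummable.
apply: (@le_lt_trans _ _ (B * C)%:E); last by rewrite ltry.
apply: esum_le_seq => // S uS hS; rewrite lee_fin.
apply: (@le_trans _ _ (\sum_(k <- S) B * (en R k `^ (- s) * normc (f k)))).
  rewrite big_seq [leRHS]big_seq; apply: ler_sum => k /hS /= k0.
  by rewrite ger0_norm ?normc_ge0// h.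
rewrite -mulr_sumr ler_wpM2l// hC//.
by apply/negP => /hS; rewrite /= eqxx.
Qed.

Variables (M : R) (gamma sigma C1 C2 : R) (A : 'I_d -> 'rV[int]_d -> seq 'rV[int]_d).
Hypotheses (theta0 : theta 0 = 0).
Hypothesis hM : forall i k, k != 0 -> normc (m k 0 i) <= M.
Hypotheses (hgamma : 0 < gamma <= 2) (hsigma : sigma <= 2).
Let u i := multiplier m theta i.
Hypothesis hC1 : wsum_le 2^-1 theta C1.
Hypothesis hC2 : forall i, pairsum_le theta (u i) sigma C2.
Hypothesis uA : forall i k, uniq (A i k).
Hypothesis hA : forall i k a, k != 0 -> theta a * u i (k - a) != 0 -> a \in A i k.
Hypothesis hE : forall k, k != 0 ->
  ((2 * pi * en R k) `^ gamma)%:C * theta k +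
  'i%C * (2 * pi)%:C * \sum_i (k 0 i)%:~R * parasum theta (u i) (A i) k = 0.

Lemma wsum_multiplier s C i : wsum_le s theta C -> wsum_le s (u i) (Num.max M 0 * C).
Proof.
move=> hC S uS S0; apply: le_trans (ler_wpM2l _ (hC S uS S0)); last by rewrite le_max lexx orbT.
rewrite mulr_sumr big_seq [leRHS]big_seq; apply: ler_sum => k kS.
have k0 : k != 0 by apply: contraNneq S0 => <-.
rewrite ComplexField.Normc.normcM mulrCA ler_wpM2r ?mulr_ge0 ?powR_ge0 ?normc_ge0//.
by rewrite le_max hM.
Qed.

(** Both pairings converge absolutely thanks to the decay of the test function, so they merge into
    one sum whose term at [k] is [fourier psi (- k)] times the equation at [k]. *)
Lemma weak_paraproduct_solutionP :
  weak_paraproduct_solution phi m gamma theta u.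
Proof.
have u0 i : u i 0 = 0 by rewrite /u /multiplier theta0 mulr0.
split.
  exists (- 2^-1); first by rewrite oppr_lt0.
  split; first by rewrite /in_H (le_lt_trans (Hnorm_le_wsum hC1))// ltry.
  by move=> i; rewrite /in_H (le_lt_trans (Hnorm_le_wsum (wsum_multiplier i hC1)))// ltry.
split=> //.
exists (- sigma), (fun i => parasum theta (u i) (A i)); split.
  by move=> i; exact: (is_paraproduct_parasum hphi theta0 (u0 i) (uA i) (@hA i) (hC2 i)).
move=> psi spsi ppsi.
have [D D0 hD] := fourier_decay spsi ppsi.
have hD' k : k != 0 -> normc (fourier psi (- k)) <= D * en R k `^ (- 3%:R).
  move=> k0; rewrite powRN powR_mulrn ?en_ge0// ler_pdivlMr ?exprn_gt0 ?en_gt0//.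
  by have := hD (- k); rewrite -/(en R (- k)) enN.
set F := fun i => parasum theta (u i) (A i).
pose t0 k := theta k * frac_laplacian gamma (fourier psi) (- k).
pose t i k := F i k * fourier (cpartial i psi) (- k).
have s0 : csummable [set k : 'rV[int]_d | k != 0] t0.
  apply: (@csummable_wsum _ _ C1 _ (D * (2 * pi) `^ gamma)) hC1 _ => [|k k0].
    by rewrite mulr_ge0 ?powR_ge0.
  rewrite /t0 /frac_laplacian -/(en R (- k)) enN !ComplexField.Normc.normcM normcR.
  rewrite ger0_norm ?powR_ge0// powRM ?en_ge0 ?mulr_ge0 ?pi_ge0//.
  apply: (@le_trans _ _ (normc (theta k) * ((2 * pi) `^ gamma * en R k `^ gamma * (D * en R k `^ (- 3%:R))))).
    by rewrite !ler_wpM2l ?mulr_ge0 ?powR_ge0 ?normc_ge0// hD'.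
  have -> : normc (theta k) * ((2 * pi) `^ gamma * en R k `^ gamma * (D * en R k `^ (- 3%:R))) =
    D * (2 * pi) `^ gamma * ((en R k `^ gamma * en R k `^ (- 3%:R)) * normc (theta k)) by ring.
  rewrite ler_wpM2l ?mulr_ge0 ?powR_ge0// ler_wpM2r ?normc_ge0//.
  rewrite -powRD; last by apply/implyP => _; rewrite gt_eqF ?en_gt0.
  by apply: powR_le_en => //; case/andP: hgamma => *; lra.
have s1 i : csummable [set k : 'rV[int]_d | k != 0] (t i).
  apply: (@csummable_wsum _ _ C2 _ (D * (2 * pi))) (wsum_parasum (uA i) (hC2 i)) _ => [|k k0].
    by rewrite !mulr_ge0 ?pi_ge0.
  have ni : normc ('i%C : R[i]) = 1 by rewrite normcE2 /= expr0n expr1n add0r sqrtr1.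
  rewrite /t fourier_cpartial// !ComplexField.Normc.normcM ni normcR mul1r normrM.
  rewrite ger0_norm ?mulr_ge0 ?pi_ge0// mxE intrN normrN.
  have hk : `|(k 0 i)%:~R| <= en R k by have := le_norm_enorm (intv R k) i; rewrite mxE.
  apply: (@le_trans _ _ (normc (F i k) * (2 * pi * en R k * (D * en R k `^ (- 3%:R))))).
    rewrite ler_wpM2l ?normc_ge0// ler_pM ?normc_ge0 ?mulr_ge0 ?pi_ge0//; last exact: hD'.
    by rewrite ler_wpM2l ?mulr_ge0 ?pi_ge0.
  have -> : normc (F i k) * (2 * pi * en R k * (D * en R k `^ (- 3%:R))) =
    D * (2 * pi) * ((en R k * en R k `^ (- 3%:R)) * normc (F i k)) by ring.
  rewrite ler_wpM2l ?mulr_ge0 ?pi_ge0// ler_wpM2r ?normc_ge0//.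
  rewrite -{1}[en R k]powRr1 ?en_ge0// -powRD; last by apply/implyP => _; rewrite gt_eqF ?en_gt0.
  by apply: powR_le_en => //; have := hsigma; lra.
have sN i : csummable [set k : 'rV[int]_d | k != 0] (fun k => - t i k).
  by apply: asummable_le (s1 i) => k; rewrite normc_opp.
rewrite /pairing -/t0.
have -> : \sum_i csum [set k : 'rV[int]_d | k != 0] (fun k => F i k * fourier (cpartial i psi) (- k)) =
   - csum [set k : 'rV[int]_d | k != 0] (fun k => \sum_i - t i k).
  rewrite csum_sum// -sumrN; apply: eq_bigr => i _.
  by rewrite csumN// opprK.
rewrite opprK -csumD//; last exact: csummable_sum.
rewrite -[RHS](csum0 R [set k : 'rV[int]_d | k != 0]).
rewrite /csum /rsum.
(* The derivative of the test function is read at [- k]; the sign this produces turns the minus of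
   the weak form into the plus of [hE]. *)
have Z k : k != 0 -> t0 k + \sum_i - t i k = 0.
  move=> k0.
  have -> : t0 k + \sum_i - t i k = fourier psi (- k) *
    (((2 * pi * en R k) `^ gamma)%:C * theta k +
     'i%C * (2 * pi)%:C * \sum_i (k 0 i)%:~R * F i k).
    rewrite mulrDr; congr (_ + _).
      by rewrite /t0 /frac_laplacian -/(en R (- k)) enN; ring.
    rewrite !mulr_sumr; apply: eq_bigr => i _.
    rewrite /t fourier_cpartial// mxE rmorphM /= rmorph_int intrN.
    by ring.
  by rewrite hE ?mulr0.
congr (fine (_ - _) +i* fine (_ - _)); apply: eq_esum => k /= k0; rewrite ?funeposE ?funenegE /= Z//.
Qed.

End WeakEquation.

(** * The multiplier *)

Section Multiplier.
Variables (R : realType) (d : nat) (m : 'rV[int]_d -> 'rV[R[i]]_d).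
Hypothesis hm : standing_multiplier m.
Implicit Types (k l : 'rV[int]_d) (i : 'I_d).

Lemma multN k i : m (- k) 0 i = (m k 0 i)^*%C.
Proof. exact: mult_real. Qed.

Lemma continuous_enorm : continuous (@enorm R d).
Proof.
move=> x; apply: (@continuous_comp _ _ _ (fun x : 'rV[R]_d => \sum_i x 0 i ^+ 2) Num.sqrt).
  apply: continuous_fct_sum => i; under eq_fun do rewrite expr2.
  by apply: continuous_fctM; exact: coord_continuous.
exact: sqrt_continuous.
Qed.

(** Homogeneity brings every frequency to the unit sphere, inside the compact set [B] on which the
    extension is continuous. With [1 <= M], the same constant bounds the symbol 1 of the scalar. *)
Lemma mult_bounded : exists2 M, 1 <= M & forall i k, k != 0 -> normc (m k 0 i) <= M.
Proof.
have [F [sF hF mF]] := mult_CZ hm.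
pose A := [set v : 'rV[R]_d | forall i : 'I_d, `[-1, 1]%classic (v ord0 i)].
pose B := A `&` (@enorm R d @^-1` [set r | 1 <= r]).
have cA : compact A by exact: (@rV_compact R d (fun=> `[-1, 1]%classic) (fun=> @segment_compact R (-1) 1)).
have cB : compact B.
  apply: compact_closedI => //; apply: closed_comp => [x _|]; first exact: continuous_enorm.
  exact: closed_ge.
have B0 x : B x -> x != 0.
  move=> [_ /= h]; apply: contraTneq h => ->.
  by rewrite /enorm big1 ?sqrtr0 ?ler10// => i _; rewrite mxE expr0n.
have bd (g : 'rV[R]_d -> R) : smooth [set x : 'rV[R]_d | x != 0] g -> exists C, forall x, B x -> `|g x| <= C.
  move=> /(_ 0%N) [cg _].
  have : compact (g @` B).
    apply: continuous_compact => //; apply: continuous_in_subspaceT => x; rewrite inE => /B0 x0.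
    exact: cg.
  move=> /compact_bounded[C [_ /(_ (C + 1))]]; rewrite ltrDl ltr01 => /(_ isT) h.
  by exists (C + 1) => x Bx; apply: h; exists x.
have /boolp.choice[C hC] : forall i : 'I_d, exists C : R, forall k, k != 0 -> normc (m k 0 i) <= C.
  move=> i; have [/bd[C1 h1] /bd[C2 h2]] := sF i.
  exists (C1 + C2) => k k0; rewrite mF//.
  have e0 := en_gt0 R k0.
  rewrite -(hF (en R k)^-1) ?invr_gt0//; last first.
    by rewrite -normr_eq0; apply: contraTneq e0 => h0; rewrite /en (normr0_eq0 h0) -(_ : intv R (0 : 'rV[int]_d) = 0) -?/(en R 0) ?en0 ?ltxx//; apply/rowP => j; rewrite !mxE.
  have Bx : B ((en R k)^-1 *: intv R k).
    split => [j /=|/=].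
      have : `|((en R k)^-1 *: intv R k) 0 j| <= 1.
        rewrite mxE normrM ger0_norm ?invr_ge0; last exact: ltW.
        by rewrite mulrC ler_pdivrMr// mul1r; exact: le_norm_enorm.
      by rewrite ler_norml in_itv.
    by rewrite enormZ ?invr_ge0; [rewrite -/(en R k) mulVf ?gt_eqF|exact: ltW].
  by apply: le_trans (normc_le_ReIm _) _; apply: lerD; [exact: h1|exact: h2].
exists (1 + \sum_i `|C i|) => [|i k k0].
  by rewrite lerDl sumr_ge0.
apply: le_trans (hC i k k0) _; apply: le_trans (ler_norm _) _.
by rewrite (bigD1 i)//= addrCA lerDl addr_ge0// sumr_ge0.
Qed.

Lemma intv_eq0 k : (intv R k == 0) = (k == 0).
Proof.
apply/eqP/eqP => [h|->]; last by apply/rowP => j; rewrite !mxE.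
by apply/rowP => j; have /rowP/(_ j) := h; rewrite !mxE => /eqP; rewrite intr_eq0 => /eqP.
Qed.

(** Divided by [n], the frequency [k *+ n + v] tends to [k] uniformly for [en v <= L], and
    homogeneity of degree 0 ignores the division. Far along a fixed direction, the multiplier is
    thus nearly constant over a packet of bounded width. *)
Lemma mult_near k (eta : R) (L : R) : k != 0 -> 0 < eta ->
  exists N : nat, forall n : nat, (N <= n)%N -> forall v : 'rV[int]_d, en R v <= L ->
    k *+ n + v != 0 -> forall i, normc (m (k *+ n + v) 0 i - m k 0 i) <= eta.
Proof.
move=> k0 eta0; have [F [sF hF mF]] := mult_CZ hm.
have ik0 : intv R k != 0 by rewrite intv_eq0.
have near1 (g : 'rV[R]_d -> R) : smooth [set x : 'rV[R]_d | x != 0] g ->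
    exists2 e : R, 0 < e & forall x : 'rV[R]_d, (forall i, `|x 0 i - intv R k 0 i| < e) -> `|g x - g (intv R k)| <= eta / 2.
  move=> /(_ 0%N) [/(_ _ ik0) cg _].
  have /cvgrPdist_le /(_ (eta / 2)) := cg; rewrite divr_gt0// => /(_ isT).
  move=> /nbhs_ballP[e /= e0 he]; exists e => // x hx.
  rewrite distrC; apply: he; split => // i j; rewrite ord1 /ball /= distrC.
  exact: hx.
have /boolp.choice[e he] : forall i : 'I_d, exists e : R, 0 < e /\ forall x : 'rV[R]_d,
    (forall i, `|x 0 i - intv R k 0 i| < e) -> normc (F x 0 i - F (intv R k) 0 i) <= eta.
  move=> i; have [/near1[e1 e10 h1] /near1[e2 e20 h2]] := sF i.
  exists (Num.min e1 e2); split; first by rewrite lt_min e10.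
  move=> x hx; apply: le_trans (normc_le_ReIm _) _.
  rewrite [eta]splitr; apply: lerD.
    have -> : complex.Re (F x 0 i - F (intv R k) 0 i) = complex.Re (F x 0 i) - complex.Re (F (intv R k) 0 i).
      by case: (F x 0 i); case: (F _ 0 i).
    by apply: h1 => j; apply: lt_le_trans (hx j) _; rewrite ge_min lexx.
  have -> : complex.Im (F x 0 i - F (intv R k) 0 i) = complex.Im (F x 0 i) - complex.Im (F (intv R k) 0 i).
    by case: (F x 0 i); case: (F _ 0 i).
  by apply: h2 => j; apply: lt_le_trans (hx j) _; rewrite ge_min lexx orbT.
have [e0 e00 he0] : exists2 e0 : R, 0 < e0 & forall i, e0 <= e i.
  exists (\big[Num.min/1]_i e i); last by move=> i; exact: bigmin_le.
  by apply/bigmin_gtP; split => // i _; have [] := he i.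
exists (Num.truncn (`|L| / e0)).+1 => n hn v vL kv0 i.
have n0 : 0 < n%:R :> R by rewrite ltr0n (leq_trans _ hn).
have hnL : L / n%:R < e0.
  rewrite ltr_pdivrMr// mulrC -ltr_pdivrMr//.
  apply: (@le_lt_trans _ _ (`|L| / e0)); first by rewrite ler_pM2r ?invr_gt0// ler_norm.
  by apply: (lt_le_trans (truncnS_gt _)); rewrite ler_nat.
rewrite (mF _ kv0) (mF _ k0) -(hF n%:R^-1) ?invr_gt0// ?intv_eq0//.
have [_ h] := he i; apply: h => j; rewrite !mxE intrD mulrDr.
have -> : n%:R^-1 * ((k *+ n) 0 j)%:~R = (k 0 j)%:~R :> R.
  by rewrite mulmxnE rmorphMn /= -[(k 0 j)%:~R *+ n]mulr_natl mulrA mulVf ?mul1r ?gt_eqF.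
rewrite addrAC subrr add0r normrM ger0_norm ?invr_ge0 ?ltW// mulrC.
apply: le_lt_trans (lt_le_trans hnL (he0 i)).
rewrite ler_pM2r ?invr_gt0//; apply: le_trans vL.
by have := le_norm_enorm (intv R v) j; rewrite mxE.
Qed.

(* The real vector [m k + m (- k)]. *)
Definition even_part k : 'rV[R]_d := \row_i (2 * complex.Re (m k 0 i)).

Definition rdot (x y : 'rV[R]_d) : R := \sum_i x 0 i * y 0 i.

Lemma rdot_div_free k : rdot (intv R k) (even_part k) = 0.
Proof.
have := congr1 (fun z => complex.Re z) (mult_div_free hm k).
rewrite Re_sum /= => E.
rewrite /rdot; under eq_bigr do rewrite !mxE mulrCA.
rewrite -mulr_sumr -[RHS](mulr0 2) -[in RHS]E; congr (_ * _); apply: eq_bigr => i _.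
have -> : ((k 0 i)%:~R : R[i]) = ((k 0 i)%:~R : R)%:C by rewrite rmorph_int.
by rewrite ReM /= mul0r subr0.
Qed.

Lemma even_part_neq0 k : m k + m (- k) != 0 -> even_part k != 0.
Proof.
apply: contraNneq => /rowP h; apply/eqP/rowP => i; rewrite !mxE multN.
have := h i; rewrite !mxE => hi.
apply: complex_eq; rewrite ?ReD ?ImD /=; case: (m k 0 i) hi => a b /=; lra.
Qed.

Lemma exists_mult_neq0 : exists2 k, k != 0 & exists i, m k 0 i != 0.
Proof.
have [k k0 h] := mult_not_odd hm; exists k => //.
have /even_part_neq0 := h; apply: contraNP => /forallNP h2.
apply/eqP/rowP => i; rewrite !mxE; have /negP := h2 i; rewrite negbK => /eqP ->.
by rewrite mulr0.
Qed.

(** The coefficients [c] recover the coordinates of [x] from its products with the [v j]. If every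
    product were below [S^-1 * enorm x], the coordinates would add up to at most
    [(S - 1) / S * enorm x]; the 1 included in [S] makes [S] positive. *)
Lemma le_enorm_rdot (v : 'I_d -> 'rV[R]_d) (c : 'I_d -> 'I_d -> R) :
  (forall i, delta_mx 0 i = \sum_j c i j *: v j) ->
  exists2 b, 0 < b & forall x, 0 < enorm x -> exists j, b * enorm x <= `|rdot x (v j)|.
Proof.
move=> hv; pose S := 1 + \sum_i \sum_j `|c i j|.
have S1 : 1 <= S by rewrite lerDl sumr_ge0// => i _; rewrite sumr_ge0.
have S0 : 0 < S by apply: lt_le_trans S1.
exists S^-1; first by rewrite invr_gt0.
move=> x x0; apply: contrapT => /forallNP h.
have hj j : `|rdot x (v j)| <= S^-1 * enorm x.
  by apply: ltW; rewrite ltNge; apply/negP; exact: h.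
have xE i : x 0 i = \sum_j c i j * rdot x (v j).
  have -> : x 0 i = rdot x (delta_mx 0 i).
    rewrite /rdot (bigD1 i)//= mxE !eqxx mulr1 big1 ?addr0// => j /negbTE ji.
    by rewrite mxE ji mulr0.
  rewrite hv /rdot; under eq_bigr do rewrite summxE mulr_sumr.
  rewrite exchange_big /=; apply: eq_bigr => j _; rewrite mulr_sumr.
  by apply: eq_bigr => l _; rewrite mxE mulrCA.
have : enorm x <= (S - 1) * (S^-1 * enorm x).
  apply: le_trans (le_enorm_sum _) _; rewrite addrAC subrr add0r mulr_suml.
  apply: ler_sum => i _; rewrite xE mulr_suml.
  apply: le_trans (ler_norm_sum _ _ _) _; apply: ler_sum => j _.
  by rewrite normrM ler_wpM2l.
rewrite mulrBl mul1r mulrA divff ?gt_eqF// mul1r => h1.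
have : 0 < S^-1 * enorm x by rewrite mulr_gt0 ?invr_gt0.
by move: h1; lra.
Qed.

Lemma even_partE k : map_mx (@complex.Re R) (m k + m (- k)) = even_part k.
Proof.
apply/rowP => i; rewrite !mxE multN ReD.
by case: (m k 0 i) => a b /=; rewrite mulr_natl mulr2n.
Qed.

Lemma spanning_ge3 : (3 <= d)%N -> exists2 c, 0 < c & forall x : 'rV[R]_d, 0 < enorm x ->
  exists2 K : 'rV[int]_d, K != 0 & c * enorm x <= `|rdot x (even_part K)|.
Proof.
move=> /(mult_basis hm)[K [bK _ bV]].
pose X := [tuple even_part (K i) | i < d].
have bX : basis_of fullv X.
  rewrite (_ : val X = [seq map_mx (@complex.Re R) (m (K i) + m (- K i)) | i <- enum 'I_d])//.
  by apply: eq_map => i; rewrite even_partE.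
have [|b b0 hb] := @le_enorm_rdot (fun j => even_part (K j)) (fun i j => coord X j (delta_mx 0 i)).
  move=> i; rewrite [LHS](coord_basis bX (memvf _)); apply: eq_bigr => j _.
  by rewrite -tnth_nth tnth_mktuple.
exists b => // x /hb[j hj]; exists (K j) => //.
rewrite -intv_eq0; apply: (basis_not0 bK); apply/mapP; exists j => //.
by rewrite mem_enum.
Qed.

End Multiplier.

(** Planar duality: were [(a1, b1)] and [(a2, b2)] parallel, [(a1, b1)] would be orthogonal to the
    two independent vectors [(p1, q1)] and [(p2, q2)], hence zero. *)
Lemma cross_neq0 (F : fieldType) (a1 b1 a2 b2 p1 q1 p2 q2 : F) :
  p1 * a1 + q1 * b1 = 0 -> p2 * a2 + q2 * b2 = 0 -> p1 * q2 - q1 * p2 != 0 ->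
  (a1 != 0) || (b1 != 0) -> (a2 != 0) || (b2 != 0) -> a1 * b2 - b1 * a2 != 0.
Proof.
move=> e1 e2 pq n1 n2; apply/eqP => D.
have s2 : a1 * p2 + b1 * q2 = 0.
  apply/eqP; move: n2; apply: contraLR => s0; rewrite negb_or !negbK.
  apply/andP; split; apply/eqP/(mulIf s0); rewrite mul0r.
    have -> : a2 * (a1 * p2 + b1 * q2) = a1 * (p2 * a2 + q2 * b2) - q2 * (a1 * b2 - b1 * a2) by ring.
    by rewrite e2 D !mulr0 subr0.
  have -> : b2 * (a1 * p2 + b1 * q2) = b1 * (p2 * a2 + q2 * b2) + p2 * (a1 * b2 - b1 * a2) by ring.
  by rewrite e2 D !mulr0 addr0.
move: n1; rewrite -negb_and => /negP; apply; apply/andP; split; apply/eqP/(mulIf pq); rewrite mul0r.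
  have -> : a1 * (p1 * q2 - q1 * p2) = q2 * (p1 * a1 + q1 * b1) - q1 * (a1 * p2 + b1 * q2) by ring.
  by rewrite e1 s2 !mulr0 subr0.
have -> : b1 * (p1 * q2 - q1 * p2) = p1 * (a1 * p2 + b1 * q2) - p2 * (p1 * a1 + q1 * b1) by ring.
by rewrite e1 s2 !mulr0 subr0.
Qed.

(** In the plane the spanning family has to be constructed. A frequency [K2] almost parallel to
    [K1], but not parallel to it, still has a nonzero even part by continuity; each even part is
    orthogonal to its frequency, so the two even parts are independent. *)
Lemma spanning_eq2 (R : realType) (m : 'rV[int]_2 -> 'rV[R[i]]_2) :
  standing_multiplier m -> exists2 c, 0 < c & forall x : 'rV[R]_2, 0 < enorm x ->
  exists2 K : 'rV[int]_2, K != 0 & c * enorm x <= `|rdot x (even_part m K)|.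
Proof.
move=> hm; have [K1 K10 /(even_part_neq0 hm) v10] := mult_not_odd hm.
have [i vi] : exists i, even_part m K1 0 i != 0.
  apply: contrapT => /forallNP h; move/negP: v10; apply; apply/eqP/rowP => i.
  by apply/eqP; have /negP := h i; rewrite negbK [X in _ -> _ == X]mxE.
have sum2 (F : 'I_2 -> R) : \sum_i F i = F 0 + F 1 by rewrite !big_ord_recl big_ord0 addr0; congr (_ + F _); exact: val_inj.
have [e he] : exists e : 'rV[int]_2, K1 0 0 * e 0 1 - K1 0 1 * e 0 0 != 0.
  have [k0|k0] := eqVneq (K1 0 0) 0.
    exists (delta_mx 0 0); rewrite !mxE /= mulr0 sub0r mulr1 oppr_eq0.
    apply: contraNneq K10 => k1; apply/eqP/rowP => j; rewrite mxE.
    by case: (unliftP 0 j) => [l|] ->//; rewrite ord1 -[RHS]k1; congr (K1 _ _); exact: val_inj.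
  by exists (delta_mx 0 1); rewrite !mxE /= mulr0 subr0 mulr1.
(* [even_part] is twice the real part, so this tolerance is half the modulus of the real part at
   [K1], and the real part at [K2] cannot vanish. *)
have eta0 : 0 < `|even_part m K1 0 i| / 4 by rewrite divr_gt0 ?normr_gt0.
have [N /(_ N (leqnn N) e (lexx _)) hN] := mult_near hm (en R e) K10 eta0.
pose K2 := K1 *+ N + e.
have cr : K1 0 0 * K2 0 1 - K1 0 1 * K2 0 0 = K1 0 0 * e 0 1 - K1 0 1 * e 0 0.
  by rewrite /K2 !mxE !mulmxnE; ring.
have K20 : K2 != 0 by apply: contraNneq he => E; rewrite -cr E !mxE !mulr0 subrr.
have {hN} v2i : even_part m K2 0 i != 0.
  have := hN K20 i; rewrite -/K2 => h.
  have : `|complex.Re (m K2 0 i) - complex.Re (m K1 0 i)| <= `|even_part m K1 0 i| / 4.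
    apply: le_trans h; rewrite (_ : complex.Re (m K2 0 i) - _ = complex.Re (m K2 0 i - m K1 0 i)) ?ler_norm_Re//.
    by case: (m K2 0 i); case: (m K1 0 i).
  move: vi; rewrite !mxE; set a := complex.Re _; set b := complex.Re _ => b0 hab.
  apply/eqP => z; have a0 : b = 0 by lra.
  move: hab; rewrite a0 sub0r normrN normrM ger0_norm// => hab.
  have : 0 < `|2 * a| by rewrite normr_gt0.
  by rewrite normrM ger0_norm//; lra.
set v1 := even_part m K1 in vi v10; set v2 := even_part m K2 in v2i.
have d1 := rdot_div_free hm K1; have d2 := rdot_div_free hm K2.
have all2 (P : 'I_2 -> Prop) : P 0 -> P 1 -> forall j, P j.
  move=> P0 P1 j; case: (unliftP 0 j) => [l|] ->//; rewrite ord1.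
  by have -> : lift 0 0 = 1 :> 'I_2 by exact: val_inj.
have D0 : v1 0 0 * v2 0 1 - v1 0 1 * v2 0 0 != 0.
  move: d1 d2; rewrite /rdot !sum2 => d1 d2.
  apply: (cross_neq0 d1 d2).
  - have intvE (k : 'rV[int]_2) j : intv R k 0 j = (k 0 j)%:~R by rewrite mxE.
    by rewrite !intvE -!intrM -intrB intr_eq0 cr.
  - by move: i vi {v2i eta0}; apply: all2 => ->; rewrite ?orbT.
  - by move: i v2i {vi eta0}; apply: all2 => ->; rewrite ?orbT.
set D := _ - _ in D0.
pose KK (j : 'I_2) := if j == 0 then K1 else K2.
(* Cramer's rule for the standard basis in terms of [v1] and [v2]. *)
pose c (i j : 'I_2) : R := (if i == 0 then (if j == 0 then v2 0 1 else - v1 0 1)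
   else (if j == 0 then - v2 0 0 else v1 0 0)) / D.
have [|b b0 hb] := @le_enorm_rdot _ _ (fun j => even_part m (KK j)) c.
  have key (j l : 'I_2) : (l == j)%:R = c j 0 * even_part m (KK 0) 0 l + c j 1 * even_part m (KK 1) 0 l.
    by elim/all2: j; elim/all2: l; rewrite /c /KK /= -/v1 -/v2 /D; field.
  move=> j; apply/rowP => l; rewrite !big_ord_recl big_ord0 addr0 mxE eqxx /= key !mxE.
  by have -> : lift ord0 ord0 = 1 :> 'I_2 by exact: val_inj.
exists b => // x /hb[j hj]; exists (KK j) => //.
by rewrite /KK; case: ifP.
Qed.

(** As [c] is uniform in [x], the amplitudes of all stages obey one bound in terms of the residual
    and the norm of the target. *)
Lemma spanning_directions (R : realType) (d : nat) (m : 'rV[int]_d -> 'rV[R[i]]_d) :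
  standing_multiplier m -> (2 <= d)%N -> exists2 c, 0 < c & forall x : 'rV[R]_d, 0 < enorm x ->
  exists2 K : 'rV[int]_d, K != 0 & c * enorm x <= `|rdot x (even_part m K)|.
Proof.
move=> hm; rewrite leq_eqVlt => /orP[/eqP d2|]; last exact: spanning_ge3.
by case: d / d2 m hm => m; exact: spanning_eq2.
Qed.

(** * Trigonometric polynomials *)

(* A trigonometric polynomial is a list of atoms (frequency, coefficient);
   repeated frequencies are allowed and add up. *)
Section Atoms.
Variables (R : realType) (d : nat) (m : 'rV[int]_d -> 'rV[R[i]]_d) (gamma : R).
Hypothesis multN : forall k i, m (- k) 0 i = (m k 0 i)^*%C.
Notation atom := ('rV[int]_d * R[i])%type.
Implicit Types (t s w : seq atom) (a b : atom) (k x : 'rV[int]_d) (p : atom * atom).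

Definition conja a : atom := (- a.1, (a.2^*)%C).

(** Real-valuedness, stated as a permutation of atoms so that sums over atoms can be reindexed by
    conjugation. *)
Definition sym t := perm_eq (map conja t) t.

Definition coef t k : R[i] := \sum_(a <- t | a.1 == k) a.2.

Definition mdot x k : R[i] := \sum_i (x 0 i)%:~R * m k 0 i.

Definition pairs t s : seq (atom * atom) := [seq (a, b) | a <- t, b <- s].

Definition new_pairs t w := pairs t w ++ pairs w t ++ pairs w w.

Definition psum p : 'rV[int]_d := p.1.1 + p.2.1.

Definition pnorm p : R := normc p.1.2 * normc p.2.2.

(** The divergence of the flux without its factor [2 pi i]: the first atom of a pair is taken in the
    scalar, the second in the velocity. *)
Definition bil (L : seq (atom * atom)) x : R[i] :=
  \sum_(p <- L | psum p == x) p.1.2 * p.2.2 * mdot x p.2.1.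

(* The Fourier coefficient at [x] of the left-hand side of the equation. *)
Definition residual t x : R[i] :=
  ((2 * pi * en R x) `^ gamma)%:C * coef t x + 'i%C * (2 * pi)%:C * bil (pairs t t) x.

Lemma conjaK : involutive conja.
Proof. by move=> [k c]; rewrite /conja /= opprK conjcK. Qed.

Lemma sym_cat t s : sym t -> sym s -> sym (t ++ s).
Proof. by move=> st ss; rewrite /sym map_cat; exact: perm_cat. Qed.

Lemma sym_block t : sym (t ++ map conja t).
Proof.
rewrite /sym map_cat -map_comp.
have -> : [seq (conja \o conja) i | i <- t] = t.
  by rewrite -[RHS]map_id; apply: eq_map => a; exact: conjaK.
by rewrite perm_catC.
Qed.

Lemma sum_sym (V : nmodType) t (F : atom -> V) : sym t ->
  \sum_(a <- t) F a = \sum_(a <- t) F (conja a).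
Proof. by move=> st; rewrite -(perm_big _ st) big_map. Qed.

Lemma coef_cat t s k : coef (t ++ s) k = coef t k + coef s k.
Proof. by rewrite /coef big_cat. Qed.

Lemma conj_sum (I : Type) (r : seq I) (P : pred I) (F : I -> R[i]) :
  ((\sum_(i <- r | P i) F i)^*)%C = \sum_(i <- r | P i) ((F i)^*)%C.
Proof. exact: rmorph_sum. Qed.

Lemma conjM (z w : R[i]) : ((z * w)^*)%C = (z^*)%C * (w^*)%C.
Proof. exact: rmorphM. Qed.

Lemma conjD (z w : R[i]) : ((z + w)^*)%C = (z^*)%C + (w^*)%C.
Proof. exact: rmorphD. Qed.

Lemma conjR (r : R) : ((r%:C)^*)%C = r%:C.
Proof. by apply: complex_eq => /=; rewrite ?oppr0. Qed.

Lemma coef_sym t k : sym t -> coef t (- k) = ((coef t k)^*)%C.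
Proof.
move=> st; rewrite /coef conj_sum big_mkcond (sum_sym _ st) [RHS]big_mkcond /=.
by apply: eq_bigr => a _; rewrite eqr_opp.
Qed.

Lemma mdotN x k : mdot (- x) (- k) = - ((mdot x k)^*)%C.
Proof.
rewrite /mdot conj_sum -sumrN; apply: eq_bigr => i _.
rewrite multN mxE intrN mulNr conjM; congr (- (_ * _)).
by rewrite rmorph_int.
Qed.

Lemma bil_eq0 L x : (forall p, p \in L -> psum p != x) -> bil L x = 0.
Proof.
by move=> h; rewrite /bil big_seq_cond big1// => p /andP[/h /negbTE ->].
Qed.

Lemma sum_pairs_cat (V : nmodType) t w (P : pred (atom * atom)) (F : atom * atom -> V) :
  \sum_(p <- pairs (t ++ w) (t ++ w) | P p) F p =
  \sum_(p <- pairs t t | P p) F p + \sum_(p <- new_pairs t w | P p) F p.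
Proof.
rewrite /new_pairs /pairs !big_cat /= [LHS]big_mkcond !(big_mkcond P) /=.
rewrite !big_allpairs big_cat /= [RHS]addrA; congr (_ + _).
  by rewrite -big_split; apply: eq_bigr => a _; rewrite big_cat.
by rewrite -big_split; apply: eq_bigr => a _; rewrite big_cat.
Qed.

Lemma mem_pairs t s p : (p \in pairs t s) = (p.1 \in t) && (p.2 \in s).
Proof.
apply/allpairsP/andP => [[[a b] [/= ta sb ->]]|[h1 h2]]; first by [].
by exists p; split => //; case: p {h1 h2}.
Qed.

Lemma mem_pairs_cat t w p : p \in pairs (t ++ w) (t ++ w) ->
  (p \in pairs t t) \/ (p \in new_pairs t w).
Proof.
rewrite /new_pairs !mem_cat !mem_pairs !mem_cat => /andP[/orP[h1|h1] /orP[h2|h2]];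
  rewrite h1 h2 ?orbT; by [left|right].
Qed.

Lemma residual_cat t w x : residual (t ++ w) x = residual t x +
  (((2 * pi * en R x) `^ gamma)%:C * coef w x + 'i%C * (2 * pi)%:C * bil (new_pairs t w) x).
Proof.
rewrite /residual coef_cat /bil sum_pairs_cat !mulrDr -!addrA; congr (_ + _).
by rewrite addrCA.
Qed.

(** The equation preserves real functions; cancelling the residual at a frequency thus cancels it at
    the opposite one. *)
Lemma residual_sym t x : sym t -> residual t (- x) = ((residual t x)^*)%C.
Proof.
move=> st; rewrite /residual enN coef_sym// conjD !conjM !conjR; congr (_ + _).
have -> : bil (pairs t t) (- x) = - ((bil (pairs t t) x)^*)%C.
  rewrite /bil conj_sum -sumrN !(big_mkcond (fun p => psum p == _)) /= !big_allpairs /=.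
  rewrite (sum_sym _ st) /=; apply: eq_bigr => a _.
  rewrite (sum_sym _ st) /=; apply: eq_bigr => b _.
  rewrite /psum /= -opprD eqr_opp; case: ifP => // _.
  by rewrite mdotN !conjM mulrN.
rewrite mulrN -mulNr; congr (_ * _).
by apply: complex_eq; rewrite /= ?ReM ?ImM /=; ring.
Qed.

Lemma sum_group (V : nmodType) (I : Type) (K : eqType) (S : seq K) (L : seq I) (f : I -> K) (F : I -> V) :
  uniq S -> \sum_(x <- S) \sum_(p <- L | f p == x) F p = \sum_(p <- L | f p \in S) F p.
Proof.
move=> uS; under eq_bigr do rewrite big_mkcond.
rewrite exchange_big /= [RHS]big_mkcond; apply: eq_bigr => p _.
case: ifP => [pS|pS]; first by rewrite (bigD1_seq (f p))//= eqxx big1 ?addr0// => x; rewrite eq_sym => /negbTE ->.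
by rewrite big_seq big1// => x xS; case: eqP => // E; rewrite E xS in pS.
Qed.

(** By the triangle inequality, repeated frequencies can only lower the left-hand side, so
    coefficients may be estimated atom by atom. *)
Lemma wsum_coef_le (wt : 'rV[int]_d -> R) (S : seq 'rV[int]_d) t : (forall x, 0 <= wt x) -> uniq S ->
  \sum_(x <- S) wt x * normc (coef t x) <= \sum_(a <- t | a.1 \in S) wt a.1 * normc a.2.
Proof.
move=> w0 uS; rewrite -(sum_group t (fun a => a.1) _ uS); apply: ler_sum => x _.
rewrite (eq_bigr (fun a => wt x * normc a.2)) => [|a /eqP -> //].
by rewrite -mulr_sumr ler_wpM2l// normc_sum.
Qed.

Lemma wsum_bil_le (wt : 'rV[int]_d -> R) (S : seq 'rV[int]_d) L : (forall x, 0 <= wt x) -> uniq S ->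
  \sum_(x <- S) wt x * normc (bil L x) <=
  \sum_(p <- L | psum p \in S) wt (psum p) * (pnorm p * normc (mdot (psum p) p.2.1)).
Proof.
move=> w0 uS; rewrite -(sum_group L psum _ uS); apply: ler_sum => x _.
rewrite (eq_bigr (fun p => wt x * (pnorm p * normc (mdot x p.2.1)))) => [|p /eqP -> //].
rewrite -mulr_sumr ler_wpM2l//; apply: le_trans (normc_sum _ _ _) _.
by apply: ler_sum => p _; rewrite !ComplexField.Normc.normcM.
Qed.

Lemma normc_mdot_le M x k : (forall i, normc (m k 0 i) <= M) -> normc (mdot x k) <= d%:R * M * en R x.
Proof.
move=> hM; apply: le_trans (normc_sum _ _ _) _.
apply: (@le_trans _ _ (\sum_(i < d) M * en R x)); last first.
  by rewrite sumr_const card_ord -[leLHS]mulr_natl mulrA.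
apply: ler_sum => i _; rewrite ComplexField.Normc.normcM mulrC.
rewrite ler_pM ?normc_ge0//.
have -> : ((x 0 i)%:~R : R[i]) = ((x 0 i)%:~R : R)%:C by rewrite rmorph_int.
by rewrite normcR; have := le_norm_enorm (intv R x) i; rewrite mxE.
Qed.

(** Pairs of atoms are grouped by their output frequency and the frequency of their first atom,
    which together determine that of the second. *)
Lemma pairsum_coef_le (wt : 'rV[int]_d -> R) (S : seq ('rV[int]_d * 'rV[int]_d)) t :
  (forall x, 0 <= wt x) -> uniq S -> (forall q, q \in S -> q.1 != 0) ->
  \sum_(q <- S) wt q.1 * (normc (coef t q.2) * normc (coef t (q.1 - q.2))) <=
  \sum_(p <- pairs t t | psum p != 0) wt (psum p) * pnorm p.
Proof.
move=> w0 uS S0.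
pose f p := (psum p, p.1.1).
apply: (@le_trans _ _ (\sum_(q <- S) \sum_(p <- pairs t t | f p == q) wt (psum p) * pnorm p)).
  apply: ler_sum => -[x k] _ /=.
  rewrite (eq_bigr (fun p => wt x * pnorm p)) => [|p /eqP[<- _] //].
  rewrite -mulr_sumr ler_wpM2l//.
  apply: (@le_trans _ _ ((\sum_(a <- t | a.1 == k) normc a.2) * (\sum_(b <- t | b.1 == x - k) normc b.2))).
    by apply: ler_pM; rewrite ?normc_ge0 ?normc_sum.
  rewrite big_distrl /= big_mkcond [leRHS]big_mkcond /pairs big_allpairs /=; apply: ler_sum => a _.
  rewrite mulr_sumr big_mkcond /=.
  case: ifP => [/eqP ak|ak]; last first.
    by apply: sumr_ge0 => b _; case: ifP => // _; rewrite mulr_ge0 ?normc_ge0.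
  apply: ler_sum => b _; case: ifP => [/eqP E|_]; last first.
    by case: ifP => // _; rewrite mulr_ge0 ?normc_ge0.
  by rewrite /f /psum /= ak E addrC subrK eqxx.
rewrite (sum_group _ f _ uS) [leLHS]big_mkcond [leRHS]big_mkcond /=; apply: ler_sum => p _.
case: ifP => [/S0 /= ->//|_]; case: ifP => // _.
by rewrite mulr_ge0 ?mulr_ge0 ?normc_ge0.
Qed.

End Atoms.

(* The Riesz products [\prod_(j < J) (1 + cos (3 ^ j y))]: nonnegative with
   mean [1] and mean square [(3 / 2) ^ J]. *)
Section RieszProducts.
Variable R : realType.

Fixpoint riesz (J : nat) : seq (int * R) :=
  if J is J'.+1 then riesz J' ++
    [seq (a.1 + (3 ^ J')%N%:Z, a.2 / 2) | a <- riesz J'] ++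
    [seq (a.1 - (3 ^ J')%N%:Z, a.2 / 2) | a <- riesz J']
  else [:: (0, 1)].

(** The frequencies are signed sums of distinct powers of 3, and
    [1 + 3 + ... + 3 ^ (J - 1) < 3 ^ J / 2]. Consequently the three translates forming the next list
    are disjoint. *)
Lemma riesz_range J a : a \in riesz J -> - (3 ^ J)%N%:Z < a.1 * 2 < (3 ^ J)%N%:Z.
Proof.
elim: J a => [|J IH] a; first by rewrite inE => /eqP ->.
have e3 : (3 ^ J.+1)%N%:Z = 3 * (3 ^ J)%N%:Z by rewrite expnS PoszM.
have N0 : 0 < (3 ^ J)%N%:Z by rewrite ltz_nat expn_gt0.
rewrite e3 /= !mem_cat; move: (3 ^ J)%N N0 IH => N N0 IH.
case/or3P => [/IH|/mapP[b /IH + ->]|/mapP[b /IH + ->]] /=.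
- by move: (a.1 : int) => y; lia.
- by move: (b.1 : int) => y; lia.
- by move: (b.1 : int) => y; lia.
Qed.

Lemma riesz_ge0 J a : a \in riesz J -> 0 <= a.2.
Proof.
elim: J a => [|J IH] a; first by rewrite inE => /eqP ->.
by rewrite /= !mem_cat => /or3P[/IH|/mapP[b /IH hb ->]|/mapP[b /IH hb ->]] //=; exact: divr_ge0.
Qed.

Lemma riesz_uniq J : uniq [seq a.1 | a <- riesz J].
Proof.
elim: J => [|J IH] //=.
rewrite !map_cat -!map_comp !cat_uniq IH /=.
have inj (c : int) : uniq [seq a.1 + c | a <- riesz J].
  rewrite (_ : [seq a.1 + c | a <- riesz J] = [seq l + c | l <- [seq a.1 | a <- riesz J]]).
    by rewrite map_inj_uniq//; exact: addIr.
  by rewrite -map_comp.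
rewrite inj (inj (- _)) !andbT.
have := @riesz_range J; have : 0 < (3 ^ J)%N%:Z by rewrite ltz_nat expn_gt0.
move: (3 ^ J)%N => N N0 hr; apply/andP; split; last first.
  apply/hasPn => _ /mapP[a /hr ha ->] /=.
  apply/negP => /mapP[b /hr hb] /=.
  by move: ha hb; move: (a.1 : int) (b.1 : int) => y z; lia.
apply/hasPn => c; rewrite mem_cat => /orP[] /mapP[a /hr ha ->] /=;
  apply/negP => /mapP[b /hr hb] /=;
  by move: ha hb; move: (a.1 : int) (b.1 : int) => y z; lia.
Qed.

(** Every factor multiplies the sum by [1 + 1 / 4 + 1 / 4]. *)
Lemma riesz_l2 J : \sum_(a <- riesz J) a.2 ^+ 2 = (3 / 2) ^+ J.
Proof.
elim: J => [|J IH]; first by rewrite big_seq1 expr1n expr0.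
rewrite /= !big_cat /= !big_map /= IH exprSr.
under [X in _ + (X + _)]eq_bigr do rewrite exprMn.
under [X in _ + (_ + X)]eq_bigr do rewrite exprMn.
by rewrite -!mulr_suml IH; field.
Qed.

Lemma riesz_mean J : \sum_(a <- riesz J | a.1 == 0) a.2 = 1.
Proof.
elim: J => [|J IH]; first by rewrite big_mkcond big_seq1.
have := @riesz_range J; have : 0 < (3 ^ J)%N%:Z by rewrite ltz_nat expn_gt0.
rewrite /= !big_cat /= IH; move: (3 ^ J)%N => N N0 hr.
rewrite [X in _ + (X + _)]big1_seq ?[X in _ + (_ + X)]big1_seq ?addr0//.
  by move=> a /andP[/eqP a0 /mapP[b /hr hb ab]]; move: a0; rewrite ab /=; lia.
by move=> a /andP[/eqP a0 /mapP[b /hr hb ab]]; move: a0; rewrite ab /=; lia.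
Qed.

Lemma riesz_cosE J (y : R) : \sum_(a <- riesz J) a.2 * cos (a.1%:~R * y) =
  \prod_(j < J) (1 + cos ((3 ^ j)%N%:R * y)).
Proof.
elim: J => [|J IH]; first by rewrite big_seq1 big_ord0 mul0r cos0 mulr1.
rewrite /= !big_cat /= !big_map /= big_ord_recr /= -IH mulrDr mulr1; congr (_ + _).
rewrite -big_split mulr_suml /=; apply: eq_bigr => a _.
by rewrite !intrD intrN mulrDl mulrBl cosD cosB; field.
Qed.

Lemma riesz_sinE J (y : R) : \sum_(a <- riesz J) a.2 * sin (a.1%:~R * y) = 0.
Proof.
elim: J => [|J IH]; first by rewrite big_seq1 mul0r sin0 mulr0.
rewrite /= !big_cat /= !big_map /= IH add0r -big_split /=.
transitivity (\sum_(a <- riesz J) a.2 * sin (a.1%:~R * y) * cos ((3 ^ J)%N%:R * y)); last first.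
  by rewrite -mulr_suml IH mul0r.
apply: eq_bigr => a _.
by rewrite !intrD intrN mulrDl mulrBl sinD sinB; field.
Qed.

Lemma riesz_cos_ge0 J (y : R) : 0 <= \sum_(a <- riesz J) a.2 * cos (a.1%:~R * y).
Proof.
rewrite riesz_cosE; apply: prodr_ge0 => j _.
by have := @cos_geN1 R ((3 ^ j)%N%:R * y); lra.
Qed.

Lemma sum_uniq_key (V : nmodType) (K I : eqType) (s : seq I) (f : I -> K) (F : I -> V) a :
  uniq (map f s) -> a \in s -> \sum_(b <- s | f b == f a) F b = F a.
Proof.
elim: s => [|c s IH] //= /andP[cs us]; rewrite inE big_cons => /orP[/eqP ->|aS].
  rewrite eqxx big_seq_cond big1 ?addr0// => b /andP[bs /eqP E].
  by move/negP: cs; case; rewrite -E map_f.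
case: eqP => [E|_]; last exact: IH.
by move/negP: cs; case; rewrite E map_f.
Qed.

(** The factor that makes the mean square equal to 1. It is also the mean of the product so
    normalized, and it tends to 0 with [J]. *)
Definition riesz_scale J : R := Num.sqrt ((2 / 3) ^+ J).

Lemma riesz_scale_gt0 J : 0 < riesz_scale J.
Proof. by rewrite sqrtr_gt0 exprn_gt0. Qed.

Lemma riesz_scale_sqr J : riesz_scale J ^+ 2 * (3 / 2) ^+ J = 1.
Proof.
rewrite sqr_sqrtr ?exprn_ge0// -exprMn (_ : 2 / 3 * (3 / 2) = 1) ?expr1n//.
by field.
Qed.

Lemma riesz_scale_small (x : R) : 0 < x -> exists J, riesz_scale J <= x.
Proof.
move=> x0; pose J := (Num.truncn (2 * (x ^+ 2)^-1)).+1; exists J.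
have h1 : 2 * (x ^+ 2)^-1 < J%:R by exact: truncnS_gt.
(* Bernoulli's inequality. *)
have h2 : 1 + J%:R / 2 <= (3 / 2 : R) ^+ J.
  elim: (J) => [|j IH]; first by rewrite mul0r addr0 expr0.
  rewrite exprSr -natr1; have j0 : 0 <= j%:R :> R by []; nra.
have x20 : 0 < x ^+ 2 by exact: exprn_gt0.
have P0 : 0 < (3 / 2 : R) ^+ J by exact: exprn_gt0.
have s0 := riesz_scale_gt0 J.
rewrite -(@ler_pXn2r _ 2) ?nnegrE ?(ltW s0) ?(ltW x0)//.
have -> : riesz_scale J ^+ 2 = ((3 / 2) ^+ J)^-1.
  by apply: (mulIf (lt0r_neq0 P0)); rewrite riesz_scale_sqr mulVf ?lt0r_neq0.
rewrite -[leRHS]invrK lef_pV2 ?posrE ?invr_gt0//.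
have := invr_gt0 (x ^+ 2); rewrite x20; lra.
Qed.

End RieszProducts.

Section RieszTorus.
Variables (R : realType) (d : nat) (e : 'rV[int]_d).
Hypothesis e0 : e != 0.

Lemma mulmxzE (l : int) i : (e *~ l) 0 i = e 0 i * l.
Proof.
have h n : (e *+ n) 0 i = e 0 i * n%:Z by rewrite mulmxnE -[LHS]mulr_natr natz.
by case: l => n; rewrite ?NegzE ?mulrNz ?mxE -pmulrn h ?mulrN.
Qed.

Lemma phaseMz (l : int) (x : 'rV[R]_d) : phase (e *~ l) x = l%:~R * phase e x.
Proof.
rewrite /phase mulrCA; congr (_ * _); rewrite mulr_sumr; apply: eq_bigr => i _.
by rewrite mulrA; congr (_ * _); rewrite mulmxzE intrM mulrC.
Qed.

Definition rieszT J (x : 'rV[R]_d) : R :=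
  \sum_(a <- riesz R J) a.2 * cos (phase (e *~ a.1) x).

Lemma rieszT_ge0 J x : 0 <= rieszT J x.
Proof.
by rewrite /rieszT; under eq_bigr do rewrite phaseMz; exact: riesz_cos_ge0.
Qed.

Lemma rieszT_complex J x :
  \sum_(a <- riesz R J) (a.2)%:C * echar (e *~ a.1) x = (rieszT J x)%:C.
Proof.
apply: complex_eq; rewrite ?Re_sum ?Im_sum.
  by apply: eq_bigr => a _; rewrite ReM /= mul0r subr0.
rewrite /= -[RHS](riesz_sinE J (phase e x)); apply: eq_bigr => a _.
by rewrite -phaseMz /= mul0r addr0.
Qed.

Lemma continuous_rieszT J : continuous (rieszT J).
Proof.
apply: continuous_fct_sum => a; apply: continuous_fctZ.
exact: continuous_cos_phase.
Qed.

Lemma zperiodic_rieszT J : zperiodic (rieszT J).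
Proof.
by move=> x l; apply: eq_bigr => a _; rewrite zperiodic_cos_phase.
Qed.

Lemma tame_rieszT J : tame (rieszT J).
Proof.
by apply: continuous_tame; [exact: continuous_rieszT|exact: zperiodic_rieszT].
Qed.

Lemma mulrz_e_eq0 (l : int) : (e *~ l == 0) = (l == 0).
Proof. apply/eqP/eqP => [h|->]; last by rewrite mulr0z.
have [i ei] := intv_coord_ge1 R e0; rewrite mxE in ei.
have ei0 : e 0 i != 0 by apply: contraTneq ei => ->; rewrite normr0 ler10.
by have /rowP/(_ i) := h; rewrite mulmxzE mxE => /eqP; rewrite mulf_eq0 (negbTE ei0) => /eqP. Qed.

Lemma tint_rieszT J : tint (rieszT J) = 1.
Proof.
have := @fourier_sum R d _ (riesz R J) (fun a => (a.2)%:C) (fun a => e *~ a.1) 0.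
rewrite /fourier; under eq_fun do rewrite rieszT_complex oppr0 echar0 mulr1.
rewrite cintegralE /= => /(congr1 (fun z => complex.Re z)) /= ->.
rewrite Re_sum; under eq_bigl do rewrite mulrz_e_eq0.
exact: riesz_mean.
Qed.

(** Parseval: as the Riesz frequencies are distinct and [e != 0], only diagonal pairs have zero
    frequency. *)
Lemma tint_rieszT_sqr J : tint (fun x => rieszT J x ^+ 2) = (3 / 2) ^+ J.
Proof.
have E x : ((rieszT J x ^+ 2)%:C : R[i]) =
  \sum_(p <- [seq (a, b) | a <- riesz R J, b <- riesz R J]) (p.1.2 * p.2.2)%:C * echar (e *~ (p.1.1 - p.2.1)) x.
  have -> : ((rieszT J x ^+ 2)%:C : R[i]) = (rieszT J x)%:C * ((rieszT J x)%:C^*)%C.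
    by apply: complex_eq; rewrite ?ReM ?ImM /=; ring.
  rewrite -rieszT_complex rmorph_sum big_distrlr /= big_allpairs /=.
  apply: eq_bigr => a _; apply: eq_bigr => b _.
  rewrite mulrzBr echarD echarN rmorphM /=.
  by apply: complex_eq; rewrite ?ReM ?ImM /=; ring.
have := @fourier_sum R d _ [seq (a, b) | a <- riesz R J, b <- riesz R J]
  (fun p => (p.1.2 * p.2.2)%:C) (fun p => e *~ (p.1.1 - p.2.1)) 0.
rewrite /fourier; under eq_fun do rewrite -E oppr0 echar0 mulr1.
rewrite cintegralE /= => /(congr1 (fun z => complex.Re z)) /= ->.
rewrite Re_sum big_mkcond big_allpairs -riesz_l2 big_seq [RHS]big_seq.
apply: eq_bigr => a aJ /=; under eq_bigr do rewrite mulrz_e_eq0 subr_eq0 eq_sym.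
rewrite -big_mkcond /= -mulr_sumr.
by rewrite (sum_uniq_key _ (riesz_uniq R J) aJ) expr2.
Qed.

End RieszTorus.

(** * Smallness of normalized Riesz products in [L^p] with [p < 2] *)

Section RieszLp.
Variables (R : realType) (d : nat).

Lemma powRD_le (x y p : R) : 0 <= x -> 0 <= y -> 0 <= p <= 2 ->
  (x + y) `^ p <= 4 * (x `^ p + y `^ p).
Proof.
move=> x0 y0 /andP[p0 p2].
wlog xy : x y x0 y0 / y <= x.
  move=> h; have [xy|/ltW xy] := leP y x; first exact: h.
  by rewrite addrC [_ `^ _ + _]addrC; exact: h.
apply: (@le_trans _ _ ((2 * x) `^ p)).
  by rewrite ge0_ler_powR ?nnegrE ?addr_ge0 ?mulr_ge0//; lra.
rewrite powRM//; apply: (@le_trans _ _ (4 * x `^ p)).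
  rewrite ler_wpM2r ?powR_ge0//.
  have -> : 4 = (2 : R) `^ 2%:R by rewrite powR_mulrn//; ring.
  by apply: ler_powR => //; rewrite ler1n.
by rewrite ler_wpM2l// lerDl powR_ge0.
Qed.

Lemma tame_powR (f : 'rV[R]_d -> R) p : 0 <= p -> tame f -> (forall x, 0 <= f x) ->
  tame (fun x => f x `^ p).
Proof.
move=> p0 [mf [C fC]] f0; split; first exact: (measurableT_comp (@measurable_powR R p) mf).
exists (C `^ p) => x; rewrite ger0_norm ?powR_ge0// ge0_ler_powR ?nnegrE//.
  exact: le_trans (fC x).
by apply: le_trans (fC x); exact: ler_norm.
Qed.

Lemma le_tint (f g : 'rV[R]_d -> R) : tame f -> tame g -> (forall x, f x <= g x) ->
  tint f <= tint g.
Proof.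
by move=> tf tg fg; apply: le_Rintegral => //; exact: tame_integrable.
Qed.

(** Split at height [M]: below it [g ^ (p - 1) <= M], above it [g ^ (p - 2) <= M ^ (- eps)]. *)
Lemma powR_interpolate (g M p eps : R) : 0 <= g -> 1 <= M -> 0 < eps -> 1 <= p <= 2 - eps ->
  g `^ p <= M * g + M `^ (- eps) * g ^+ 2.
Proof.
move=> g0 M1 e0 /andP[p1 p2].
have M0 : 0 < M by apply: lt_le_trans M1.
have h1 : 0 <= M * g by rewrite mulr_ge0// ltW.
have h2 : 0 <= M `^ (- eps) * g ^+ 2 by rewrite mulr_ge0 ?powR_ge0 ?exprn_ge0.
have [->|gn0] := eqVneq g 0; first by rewrite powR0 ?mulr0 ?expr0n ?mulr0 ?addr0//; lra.
have gp : 0 < g by rewrite lt_neqAle eq_sym gn0.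
have [gM|Mg] := leP g M.
  apply: (@le_trans _ _ (M * g)); last by rewrite lerDl.
  have -> : g `^ p = g `^ (p - 1) * g.
    by rewrite -{3}[g]powRr1// -powRD ?gn0 ?implybT//; congr (_ `^ _); ring.
  rewrite ler_wpM2r//.
  apply: (@le_trans _ _ (M `^ (p - 1))).
    by rewrite ge0_ler_powR ?nnegrE ?subr_ge0// ltW.
  by rewrite -[leRHS]powRr1 ?(ltW M0)// ler_powR//; lra.
apply: (@le_trans _ _ (M `^ (- eps) * g ^+ 2)); last by rewrite lerDr.
have -> : g `^ p = g `^ (p - 2) * g ^+ 2.
  by rewrite -powR_mulrn// -powRD ?gn0 ?implybT//; congr (_ `^ _); ring.
rewrite ler_wpM2r ?exprn_ge0//.
apply: (@le_trans _ _ (g `^ (- eps))).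
  by rewrite ler_powR//; [apply: le_trans M1 (ltW Mg)|lra].
rewrite !powRN lef_pV2 ?posrE ?powR_gt0// ge0_ler_powR ?nnegrE ?(ltW M0) ?(ltW e0)//; exact: ltW.
Qed.

(** With mean [s] and mean square 1, interpolation bounds the integral by [M * s + M ^ (- eps)]; [M]
    is fixed before [J]. The same [J] works for every [e], which matters because [e] is chosen
    later. *)
Lemma riesz_Lp (eps delta : R) : 0 < eps -> 0 < delta -> exists J, forall e : 'rV[int]_d, e != 0 ->
  forall p, 1 <= p <= 2 - eps -> tint (fun x => (riesz_scale R J * rieszT e J x) `^ p) <= delta.
Proof.
move=> eps0 d0.
have [M M1 hM] : exists2 M : R, 1 <= M & M `^ (- eps) <= delta / 2.
  exists (Num.max 1 ((delta / 2) `^ (- eps^-1))); first by rewrite le_max lexx.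
  have dd : 0 < delta / 2 by rewrite divr_gt0.
  set y := (delta / 2) `^ _.
  have y0 : 0 < y by exact: powR_gt0.
  have -> : delta / 2 = y `^ (- eps).
    by rewrite -powRrM mulrNN mulVf ?gt_eqF// powRr1// ltW.
  rewrite !(powRN _ eps) lef_pV2 ?posrE ?powR_gt0 ?lt_max ?ltr01//.
  by rewrite ge0_ler_powR ?nnegrE ?le_max ?ler01 ?lexx ?orbT// ltW.
have M0 : 0 < M by apply: lt_le_trans M1.
have [J hJ] := @riesz_scale_small R (delta / 2 / M) (divr_gt0 (divr_gt0 d0 (ltr0n _ 2)) M0).
exists J => e e0 p p12.
have s0 := riesz_scale_gt0 R J.
set s := riesz_scale R J in hJ s0 *.
have tr := @tame_rieszT R d e J; have r0 := @rieszT_ge0 R d e J.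
have g0 x : 0 <= s * rieszT e J x by rewrite mulr_ge0 ?(ltW s0).
have tr2 : tame (fun x : 'rV[R]_d => rieszT e J x ^+ 2).
  rewrite (_ : (fun x => _) = (fun x : 'rV[R]_d => rieszT e J x * rieszT e J x)).
    exact: tameM.
  by apply/funext => x; rewrite expr2.
apply: (@le_trans _ _ (tint (fun x => (M * s) * rieszT e J x + (M `^ (- eps) * s ^+ 2) * rieszT e J x ^+ 2))).
  apply: le_tint => [||x].
  - by apply: tame_powR => //; [case/andP: p12; lra|exact: tameZ].
  - by apply: tameD; exact: tameZ.
  - by rewrite -(mulrA M) -(mulrA (M `^ _)) -exprMn; exact: powR_interpolate.
rewrite tintD ?tintZ; try by [exact: tameZ|].
rewrite tint_rieszT// tint_rieszT_sqr// mulr1 -mulrA riesz_scale_sqr mulr1.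
by move: hJ; rewrite ler_pdivlMr// (mulrC s); lra.
Qed.

(** [c] stands for the amplitude and the size of the multiplier, [eta] for the oscillation of the
    multiplier over a packet. The two terms separated by [powRD_le] each receive [delta / 8], and
    the factor 4 brings each to [delta / 2]. *)
Lemma riesz_envelope (eps c delta : R) : 0 < eps -> 0 <= c -> 0 < delta ->
  exists J : nat, exists2 eta : R, 0 < eta & forall e : 'rV[int]_d, e != 0 ->
  forall p, 1 <= p <= 2 - eps ->
  tint (fun x => (c * (riesz_scale R J * rieszT e J x) + eta) `^ p) <= delta.
Proof.
move=> eps0 c0 d0.
have C0 : 0 < 8 * (1 + c ^+ 2) by have := exprn_ge0 2 c0; lra.
have [J hJ] := @riesz_Lp eps (delta / (8 * (1 + c ^+ 2))) eps0 (divr_gt0 d0 C0).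
exists J, (Num.min 1 (delta / 8)); first by rewrite lt_min ltr01 divr_gt0.
set eta := Num.min _ _ => e e0 p p12.
have [eta0 eta1 etad] : [/\ 0 < eta, eta <= 1 & eta <= delta / 8].
  by rewrite /eta lt_min ltr01 divr_gt0 ?ge_min ?lexx ?orbT.
have {hJ} hJ := hJ e e0 p p12.
have tr := @tame_rieszT R d e J; have r0 := @rieszT_ge0 R d e J.
have s0 := riesz_scale_gt0 R J.
set g := fun x => riesz_scale R J * rieszT e J x in hJ *.
have g0 x : 0 <= g x by rewrite mulr_ge0 ?(ltW s0).
have tg : tame g by exact: tameZ.
have [p1 p2] := andP p12.
have tgp : tame (fun x => g x `^ p) by apply: tame_powR => //; lra.
apply: (@le_trans _ _ (tint (fun x => 4 * c `^ p * g x `^ p + 4 * eta `^ p))).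
  apply: le_tint => [||x].
  - apply: tame_powR => [|/=|x]; first by lra.
      by apply: tameD; [exact: tameZ|exact: tame_cst].
    by rewrite addr_ge0 ?mulr_ge0// ltW.
  - by apply: tameD; [exact: tameZ|exact: tame_cst].
  - rewrite -mulrA -mulrDr -powRM//; apply: powRD_le; rewrite ?mulr_ge0 ?(ltW eta0)//; lra.
rewrite tintD ?tintZ ?tint_cst//; try by [exact: tameZ|exact: tame_cst].
have hc : c `^ p <= 1 + c ^+ 2.
  have [c1|c1] := leP c 1.
    apply: (@le_trans _ _ 1); last by rewrite lerDl exprn_ge0.
    have E : (1 : R) `^ p = 1 by rewrite powR1.
    by rewrite -[leRHS]E ge0_ler_powR ?nnegrE//; lra.
  apply: (@le_trans _ _ (c ^+ 2)); last by rewrite lerDr.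
  by rewrite -powR_mulrn// ler_powR ?(ltW c1)//; lra.
have he : eta `^ p <= eta.
  have -> : eta `^ p = eta `^ (p - 1) * eta.
    have : eta `^ (p - 1) * eta `^ 1 = eta `^ p.
      rewrite -powRD; last by apply/implyP => _; rewrite gt_eqF.
      by rewrite subrK.
    by rewrite powRr1 ?(ltW eta0).
  rewrite ler_piMl ?(ltW eta0)//.
  have E : (1 : R) `^ (p - 1) = 1 by rewrite powR1.
  by rewrite -[leRHS]E ge0_ler_powR ?nnegrE ?subr_ge0 ?(ltW eta0).
have hi : 0 <= tint (fun x => g x `^ p).
  by rewrite /tint Rintegral_ge0// => t _; exact: powR_ge0.
have : c `^ p * tint (fun x => g x `^ p) <= delta / 8.
  apply: (@le_trans _ _ ((1 + c ^+ 2) * (delta / (8 * (1 + c ^+ 2))))).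
    by apply: ler_pM; rewrite ?powR_ge0.
  have c2 : 1 + c ^+ 2 != 0 by rewrite gt_eqF//; have := exprn_ge0 2 c0; lra.
  by rewrite le_eqVlt; apply/orP; left; apply/eqP; field.
rewrite -mulrA; lra.
Qed.

End RieszLp.

(** * Resonant blocks *)

Section EuclideanTriangle.
Variables (R : realType) (d : nat).
Implicit Types (x y : 'rV[R]_d) (k l : 'rV[int]_d).

(** Cauchy-Schwarz, obtained from the nonnegative sum of the squares of [b * x 0 i - a * y 0 i],
    where [a] and [b] are the two norms. *)
Lemma enormD x y : enorm (x + y) <= enorm x + enorm y.
Proof.
have e0 (z : 'rV[R]_d) : 0 <= enorm z by exact: enorm_ge0.
have sq (z : 'rV[R]_d) : enorm z ^+ 2 = \sum_i z 0 i ^+ 2.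
  by rewrite sqr_sqrtr// sumr_ge0// => i _; exact: sqr_ge0.
rewrite -(@ler_pXn2r _ 2) ?nnegrE ?addr_ge0// sqrrD !sq.
have -> : \sum_i (x + y) 0 i ^+ 2 =
    \sum_i x 0 i ^+ 2 + (\sum_i x 0 i * y 0 i) *+ 2 + \sum_i y 0 i ^+ 2.
  rewrite -sumrMnl -!big_split /=; apply: eq_bigr => i _.
  by rewrite mxE sqrrD.
rewrite lerD2r lerD2l lerMn2r /=.
have [xz|xz] := eqVneq (enorm x) 0.
  rewrite xz mul0r big1// => i _; have := le_norm_enorm x i.
  by rewrite xz normr_le0 => /eqP ->; rewrite mul0r.
have [yz|yz] := eqVneq (enorm y) 0.
  rewrite yz mulr0 big1// => i _; have := le_norm_enorm y i.
  by rewrite yz normr_le0 => /eqP ->; rewrite mulr0.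
have x0 : 0 < enorm x by rewrite lt_neqAle eq_sym xz e0.
have y0 : 0 < enorm y by rewrite lt_neqAle eq_sym yz e0.
set a := enorm x in x0 *; set b := enorm y in y0 *.
have : 0 <= \sum_i (b * x 0 i - a * y 0 i) ^+ 2 by apply: sumr_ge0 => i _; exact: sqr_ge0.
have -> : \sum_i (b * x 0 i - a * y 0 i) ^+ 2 =
    b ^+ 2 * \sum_i x 0 i ^+ 2 - 2 * (a * b) * (\sum_i x 0 i * y 0 i) + a ^+ 2 * \sum_i y 0 i ^+ 2.
  by rewrite !mulr_sumr -sumrB -big_split /=; apply: eq_bigr => i _; ring.
rewrite -!sq -/a -/b.
have ab0 : 0 < a * b by rewrite mulr_gt0.
move=> h; rewrite -(ler_pM2l ab0); nra.
Qed.

Lemma intvD k l : intv R (k + l) = intv R k + intv R l.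
Proof. by apply/rowP => i; rewrite !mxE intrD. Qed.

Lemma enD k l : en R (k + l) <= en R k + en R l.
Proof. by rewrite /en intvD enormD. Qed.

Lemma enB k l : en R (k - l) <= en R k + en R l.
Proof. by rewrite -[in leRHS](enN R l) enD. Qed.

Lemma ler_enD k l : en R k - en R l <= en R (k + l).
Proof. by have := enB (k + l) l; rewrite addrK; lra. Qed.

Lemma enMn k n : en R (k *+ n) = n%:R * en R k.
Proof.
rewrite /en -enormZ//; congr enorm; apply/rowP => i.
by rewrite !mxE mulmxnE rmorphMn /= -[LHS]mulr_natl.
Qed.

Lemma enMz k (l : int) : en R (k *~ l) = `|l|%:~R * en R k.
Proof. by case: l => n; rewrite ?NegzE ?mulrNz ?enN -pmulrn enMn ?normrN. Qed.

End EuclideanTriangle.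

Section Block.
Variables (R : realType) (d : nat) (m : 'rV[int]_d -> 'rV[R[i]]_d).
Hypothesis multN : forall k i, m (- k) 0 i = (m k 0 i)^*%C.
Notation atom := ('rV[int]_d * R[i])%type.
Variables (p xi e : 'rV[int]_d) (A B : R[i]) (J : nat) (t : seq atom).
Implicit Types (a b : int * R) (k v x : 'rV[int]_d).

(* A packet of frequencies around [k] whose envelope is the Riesz product in
   direction [e], normalized in mean square. The packets at [p] and [p + xi]
   resonate only at [0], [xi] and [- xi]. *)
Definition rblock k (C : R[i]) : seq atom :=
  [seq (k + e *~ a.1, C * (riesz_scale R J * a.2)%:C) | a <- riesz R J].

Definition hblock := rblock p A ++ rblock (p + xi) B.

Definition block := hblock ++ map (@conja R d) hblock.

Lemma block_sym : sym block.
Proof. exact: sym_block. Qed.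

(** [L] bounds the low data: old frequencies, envelope and [xi]. A block frequency is within [2 * L]
    of [p] or [- p], so [4 * L] covers the sum of two deviations, or of one deviation and an old
    frequency. The margin in [sep] absorbs shifts by [xi]. *)
Variables (L Theta : R).
Hypotheses (xi0 : xi != 0) (e0 : e != 0).
Hypothesis far1 : forall v, en R v <= 4 * L -> Theta <= en R (p + v).
Hypothesis far2 : forall v, en R v <= 4 * L -> Theta <= en R (p *+ 2 + v).
Hypothesis sep : forall l : int, l != 0 -> Theta + 2 * en R xi <= en R (e *~ l).
Hypothesis xiTheta : en R xi < Theta.
Hypothesis xiL : en R xi <= L.
Hypothesis eL : forall a, a \in riesz R J -> en R (e *~ a.1) <= L.
Hypothesis tL : forall x : atom, x \in t -> en R x.1 <= L.

Lemma rblock_freq k C (x : atom) : x \in rblock k C ->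
  exists2 a, a \in riesz R J & x.1 = k + e *~ a.1.
Proof. by move=> /mapP[a aJ ->]; exists a. Qed.

Lemma hblock_freq (x : atom) : x \in hblock -> exists (a : int * R) (b : bool),
  a \in riesz R J /\ x.1 = p + (xi *+ b + e *~ a.1).
Proof.
rewrite mem_cat => /orP[/rblock_freq[a aJ ->]|/rblock_freq[a aJ ->]].
  by exists a, false; rewrite mulr0n add0r.
by exists a, true; rewrite addrA.
Qed.

Lemma block_freq (x : atom) : x \in block -> exists (a : int * R) (b : bool),
  a \in riesz R J /\ (x.1 = p + (xi *+ b + e *~ a.1) \/ x.1 = - (p + (xi *+ b + e *~ a.1))).
Proof.
rewrite mem_cat => /orP[/hblock_freq[a [b [aJ ->]]]|/mapP[y /hblock_freq[a [b [aJ E]]] ->]].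
  by exists a, b; split => //; left.
by exists a, b; split => //; right; rewrite /= E.
Qed.

Lemma en_shift (a : int * R) (b : bool) : a \in riesz R J -> en R (xi *+ b + e *~ a.1) <= 2 * L.
Proof.
move=> aJ; have := enD R (xi *+ b) (e *~ a.1); have := eL aJ.
have : en R (xi *+ b) <= en R xi by case: b; rewrite ?mulr0n ?en0 ?en_ge0.
move: xiL; lra.
Qed.

Lemma L_ge0 : 0 <= L.
Proof. by apply: le_trans xiL; exact: en_ge0. Qed.

Lemma block_ge (x : atom) : x \in block -> Theta <= en R x.1.
Proof.
have L0 := L_ge0.
move=> /block_freq[a [b [/(en_shift b) h []->]]]; rewrite ?enN; apply: far1; lra.
Qed.

Lemma same_sign_far (x y : atom) : x \in hblock -> y \in hblock -> Theta <= en R (x.1 + y.1).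
Proof.
move=> /hblock_freq[a [b [aJ ->]]] /hblock_freq[a' [b' [aJ' ->]]].
rewrite addrACA -mulr2n; apply: far2; apply: le_trans (enD _ _ _) _.
by have := en_shift b aJ; have := en_shift b' aJ'; lra.
Qed.

Lemma mixed_far (x y : atom) : x \in t -> y \in block -> Theta <= en R (x.1 + y.1).
Proof.
have L0 := L_ge0.
move=> /tL xL /block_freq[a [b [/(en_shift b) h []->]]].
  by rewrite addrCA; apply: far1; have := enD R x.1 (xi *+ b + e *~ a.1); lra.
rewrite -enN opprD opprK addrCA; apply: far1.
by have := enD R (- x.1) (xi *+ b + e *~ a.1); rewrite enN; lra.
Qed.

(** The carriers cancel, leaving 0, [xi] or [- xi] plus a multiple of [e]; as soon as this multiple
    is nonzero, [sep] sends the sum beyond [Theta]. *)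
Lemma opp_sign (x y : atom) : x \in hblock -> y \in hblock ->
  (x.1 - y.1 \in [:: 0; xi; - xi]) || (Theta <= en R (x.1 - y.1)).
Proof.
move=> /hblock_freq[a [b [aJ ->]]] /hblock_freq[a' [b' [aJ' ->]]].
have -> : p + (xi *+ b + e *~ a.1) - (p + (xi *+ b' + e *~ a'.1)) =
    (xi *+ b - xi *+ b') + e *~ (a.1 - a'.1).
  by rewrite opprD addrACA subrr add0r mulrzBr opprD addrACA.
have [->|aa] := eqVneq a.1 a'.1.
  rewrite subrr mulr0z addr0.
  by case: b; case: b'; rewrite ?mulr0n ?subrr ?subr0 ?sub0r !inE eqxx ?orbT.
apply/orP; right; rewrite addrC.
have := ler_enD R (e *~ (a.1 - a'.1)) (xi *+ b - xi *+ b').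
have : en R (xi *+ b - xi *+ b') <= en R xi.
  by case: b; case: b'; rewrite ?mulr0n ?subrr ?subr0 ?sub0r ?enN ?en0 ?en_ge0.
have := @sep (a.1 - a'.1); rewrite subr_eq0 aa => /(_ isT).
by have := en_ge0 R xi; lra.
Qed.

Lemma new_pairs_psum pr : pr \in new_pairs t block ->
  (psum pr \in [:: 0; xi; - xi]) || (Theta <= en R (psum pr)).
Proof.
rewrite /new_pairs /psum !mem_cat !mem_pairs => /or3P[] /andP[h1 h2].
- by rewrite (mixed_far h1 h2) orbT.
- by rewrite addrC (mixed_far h2 h1) orbT.
move: h1 h2; rewrite [pr.1 \in _]mem_cat [pr.2 \in _]mem_cat => /orP[h1|/mapP[x h1 ->]] /orP[h2|/mapP[y h2 ->]] /=.
- by rewrite (same_sign_far h1 h2) orbT.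
- exact: opp_sign.
- by rewrite addrC; exact: opp_sign.
- by rewrite -opprD enN (same_sign_far h1 h2) orbT.
Qed.

Section Resonance.
Variables (V : nmodType) (F : atom * atom -> V).

Let rs (s1 s2 : seq atom) : V := \sum_(q <- pairs s1 s2 | psum q == xi) F q.

Lemma rsE s1 s2 : rs s1 s2 = \sum_(a <- s1) \sum_(b <- s2 | a.1 + b.1 == xi) F (a, b).
Proof.
rewrite /rs /pairs big_mkcond big_allpairs; apply: eq_bigr => a _.
by rewrite [RHS]big_mkcond.
Qed.

Lemma rs_catl s1 s2 s3 : rs (s1 ++ s2) s3 = rs s1 s3 + rs s2 s3.
Proof. by rewrite /rs /pairs !(big_mkcond (fun q => psum q == xi)) !big_allpairs big_cat. Qed.

Lemma rs_catr s1 s2 s3 : rs s1 (s2 ++ s3) = rs s1 s2 + rs s1 s3.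
Proof.
rewrite /rs /pairs !(big_mkcond (fun q => psum q == xi)) !big_allpairs -big_split /=.
by apply: eq_bigr => a _; rewrite big_cat.
Qed.

Lemma rs0 s1 s2 : (forall x y : atom, x \in s1 -> y \in s2 -> x.1 + y.1 != xi) -> rs s1 s2 = 0.
Proof.
move=> h; rewrite /rs big_seq_cond big1// => q /andP[].
by rewrite mem_pairs => /andP[h1 h2]; rewrite /psum (negbTE (h _ _ h1 h2)).
Qed.

Lemma ne_xi k : Theta <= en R k -> k != xi.
Proof. by apply: contraTneq => ->; rewrite -ltNge. Qed.

Lemma xiN : - xi != xi.
Proof.
apply/eqP => E; have : en R (xi *+ 2) = 0 by rewrite mulr2n -{1}E addNr en0.
by rewrite enMn => /eqP; rewrite mulf_eq0 pnatr_eq0 /= gt_eqF ?en_gt0.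
Qed.

Lemma rs_diag k k' (C C' : R[i]) : k - k' != xi ->
  (forall l : int, l != 0 -> k - k' + e *~ l != xi) ->
  rs (rblock k C) (map (@conja R d) (rblock k' C')) = 0 /\
  rs (map (@conja R d) (rblock k' C')) (rblock k C) = 0.
Proof.
move=> kk kl.
have h (x y : atom) : x \in rblock k C -> y \in rblock k' C' -> x.1 - y.1 != xi.
  move=> /rblock_freq[a aJ ->] /rblock_freq[b bJ ->].
  have -> : k + e *~ a.1 - (k' + e *~ b.1) = k - k' + e *~ (a.1 - b.1).
    by rewrite mulrzBr opprD addrACA.
  by have [->|ab] := eqVneq a.1 b.1; [rewrite subrr mulr0z addr0|apply: kl; rewrite subr_eq0].
split; apply: rs0 => x y.
  by move=> hx /mapP[z hz ->]; exact: h.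
by move=> /mapP[z hz ->] hx; rewrite addrC; exact: h.
Qed.

Definition atomP (a : int * R) : atom := (p + e *~ a.1, A * (riesz_scale R J * a.2)%:C).
Definition atomQ (a : int * R) : atom := (p + xi + e *~ a.1, B * (riesz_scale R J * a.2)%:C).

(** An atom at [p + xi] reaches [xi] only with the conjugate of the atom at [p] having the same
    Riesz frequency, in either order. [F] is arbitrary so that one computation gives both the exact
    interaction and its absolute size. *)
Lemma resonance_sum :
  \sum_(q <- new_pairs t block | psum q == xi) F q =
  \sum_(a <- riesz R J) (F (atomQ a, conja (atomP a)) + F (conja (atomP a), atomQ a)).
Proof.
have tw (x y : atom) : x \in t -> y \in block -> x.1 + y.1 != xi.
  by move=> h1 h2; apply: ne_xi; exact: mixed_far.
rewrite /new_pairs !big_cat /= -!/(rs _ _) (rs0 tw) add0r.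
rewrite rs0 ?add0r; last by move=> x y h1 h2; rewrite addrC; exact: tw.
rewrite /block rs_catl !(rs_catr _ hblock).
rewrite [rs hblock hblock]rs0 ?add0r; last first.
  by move=> x y h1 h2; apply: ne_xi; exact: same_sign_far.
rewrite [rs (map _ _) (map _ _)]rs0 ?addr0; last first.
  move=> x y /mapP[x' h1 ->] /mapP[y' h2 ->]; apply: ne_xi.
  by rewrite -opprD enN; exact: same_sign_far.
rewrite /hblock map_cat !rs_catl !rs_catr.
have l_xi (l : int) v : l != 0 -> en R v <= en R xi -> v + e *~ l != xi.
  move=> l0 hv; apply: ne_xi; rewrite addrC.
  have := ler_enD R (e *~ l) v; have := sep l0; have := en_ge0 R xi; lra.
have [||-> ->] := @rs_diag p p A A; rewrite ?subrr 1?eq_sym//.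
  by move=> l l0; apply: l_xi => //; rewrite en0 en_ge0.
have [||-> ->] := @rs_diag (p + xi) (p + xi) B B; rewrite ?subrr 1?eq_sym//.
  by move=> l l0; apply: l_xi => //; rewrite en0 en_ge0.
have E0 : p - (p + xi) = - xi by rewrite opprD addrA subrr sub0r.
have [||-> ->] := @rs_diag p (p + xi) A B; rewrite ?E0 ?xiN//.
  by move=> l l0; apply: l_xi => //; rewrite enN.
rewrite !add0r !addr0 big_split /= ; congr (_ + _).
  rewrite rsE big_map big_seq [RHS]big_seq.
  apply: eq_bigr => a aJ; rewrite !big_map /=.
  rewrite -(sum_uniq_key (fun b => F (atomQ a, conja (atomP b))) (riesz_uniq R J) aJ).
  apply: eq_bigl => b; rewrite /psum /=.
  have -> : p + xi + e *~ a.1 - (p + e *~ b.1) = xi + e *~ (a.1 - b.1).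
    by rewrite mulrzBr opprD addrACA [p + xi]addrC addrK.
  by rewrite -subr_eq0 addrAC subrr add0r mulrz_e_eq0// subr_eq0 eq_sym.
rewrite rsE !big_map big_seq [RHS]big_seq.
apply: eq_bigr => a aJ; rewrite big_map /=.
rewrite -(sum_uniq_key (fun b => F (conja (atomP a), atomQ b)) (riesz_uniq R J) aJ).
apply: eq_bigl => b; rewrite /psum /= addrC.
have -> : p + xi + e *~ b.1 - (p + e *~ a.1) = xi + e *~ (b.1 - a.1).
  by rewrite mulrzBr opprD addrACA [p + xi]addrC addrK.
by rewrite -subr_eq0 addrAC subrr add0r mulrz_e_eq0// subr_eq0.
Qed.

End Resonance.

(** A weighted mean, the weights adding up to 1. The two terms correspond to the two orders of a
    resonant pair; far along a direction they approach the product of [xi] with the even part. *)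
Definition resonance_coef : R[i] := \sum_(a <- riesz R J)
  ((riesz_scale R J * a.2) ^+ 2)%:C * (((mdot m xi (p + e *~ a.1))^*)%C + mdot m xi (p + xi + e *~ a.1)).

Lemma mdot_oppr x k : mdot m x (- k) = ((mdot m x k)^*)%C.
Proof.
rewrite /mdot conj_sum; apply: eq_bigr => i _; rewrite multN conjM; congr (_ * _).
by rewrite rmorph_int.
Qed.

Lemma block_bil : bil m (new_pairs t block) xi = B * (A^*)%C * resonance_coef.
Proof.
rewrite /bil (resonance_sum (fun q => q.1.2 * q.2.2 * mdot m xi q.2.1)) /resonance_coef mulr_sumr.
apply: eq_bigr => a _; rewrite /= mdot_oppr conjM conjR.
by rewrite rmorphXn /=; ring.
Qed.

Lemma riesz_scale_sum : \sum_(a <- riesz R J) (riesz_scale R J * a.2) ^+ 2 = 1.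
Proof. by under eq_bigr do rewrite exprMn; rewrite -mulr_sumr riesz_l2 riesz_scale_sqr. Qed.

(** Normalization in mean square makes this independent of [J], unlike [l1 block]. *)
Lemma block_pnorm : \sum_(q <- new_pairs t block | psum q == xi) pnorm q = 2 * (normc A * normc B).
Proof.
transitivity (2 * (normc A * normc B) * \sum_(a <- riesz R J) (riesz_scale R J * a.2) ^+ 2).
  rewrite (resonance_sum (@pnorm R d)) mulr_sumr; apply: eq_bigr => a _.
  rewrite /pnorm /= normc_conj !ComplexField.Normc.normcM normcR -(@real_normK _ (riesz_scale R J * a.2)) ?num_real//.
  ring.
by rewrite riesz_scale_sum mulr1.
Qed.

Lemma sum_pairs_sym (V : nmodType) (s1 s2 : seq atom) (F : atom * atom -> V) x : sym s1 -> sym s2 ->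
  \sum_(q <- pairs s1 s2 | psum q == - x) F q =
  \sum_(q <- pairs s1 s2 | psum q == x) F (conja q.1, conja q.2).
Proof.
move=> h1 h2; rewrite !(big_mkcond (fun q => psum q == _)) /= /pairs !big_allpairs /=.
rewrite (sum_sym _ h1) /=; apply: eq_bigr => a _; rewrite (sum_sym _ h2) /=.
by apply: eq_bigr => b _; rewrite /psum /= -opprD eqr_opp.
Qed.

Lemma block_pnormN : sym t ->
  \sum_(q <- new_pairs t block | psum q == - xi) pnorm q = 2 * (normc A * normc B).
Proof.
move=> st; rewrite -block_pnorm /new_pairs !big_cat /=.
by rewrite !sum_pairs_sym ?block_sym//; congr (_ + (_ + _)); apply: eq_bigr => q _; rewrite /pnorm /= !normc_conj.
Qed.

Definition l1 (s : seq atom) : R := \sum_(a <- s) normc a.2.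

Lemma l1_ge0 s : 0 <= l1 s.
Proof. by apply: sumr_ge0 => a _; exact: normc_ge0. Qed.

Lemma sum_pnorm (s1 s2 : seq atom) : \sum_(q <- pairs s1 s2) pnorm q = l1 s1 * l1 s2.
Proof. by rewrite /pairs big_allpairs /l1 big_distrlr. Qed.

Lemma sum_pnorm_new s : \sum_(q <- new_pairs t s) pnorm q = 2 * (l1 t * l1 s) + l1 s ^+ 2.
Proof. by rewrite /new_pairs !big_cat /= !sum_pnorm; ring. Qed.

Lemma l1_block : l1 block = 2 * (normc A + normc B) * (riesz_scale R J * \sum_(a <- riesz R J) a.2).
Proof.
have hr k C : l1 (rblock k C) = normc C * (riesz_scale R J * \sum_(a <- riesz R J) a.2).
  rewrite /l1 big_map /= !mulr_sumr big_seq [RHS]big_seq; apply: eq_bigr => a /riesz_ge0 a0.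
  by rewrite ComplexField.Normc.normcM normcR ger0_norm// mulr_ge0// ltW// riesz_scale_gt0.
have hh : l1 hblock = (normc A + normc B) * (riesz_scale R J * \sum_(a <- riesz R J) a.2).
  by rewrite /l1 big_cat /= -!/(l1 _) !hr mulrDl.
rewrite /l1 big_cat big_map /=; under [X in _ + X]eq_bigr do rewrite normc_conj.
by rewrite -!/(l1 _) hh; ring.
Qed.

Lemma powRN_le s x : 0 <= s -> 0 < Theta -> Theta <= en R x -> en R x `^ (- s) <= Theta `^ (- s).
Proof.
move=> s0 T0 Tx; have x0 : 0 < en R x by apply: lt_le_trans Tx.
by rewrite !powRN lef_pV2 ?posrE ?powR_gt0// ge0_ler_powR ?nnegrE ?(ltW T0) ?(ltW x0).
Qed.

Lemma Theta_gt0 : 0 < Theta.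
Proof. by apply: le_lt_trans xiTheta; exact: en_ge0. Qed.

Lemma block_wsum s : 0 <= s -> \sum_(a <- block) en R a.1 `^ (- s) * normc a.2 <= Theta `^ (- s) * l1 block.
Proof.
move=> s0; rewrite /l1 mulr_sumr big_seq [leRHS]big_seq; apply: ler_sum => a /block_ge h.
by rewrite ler_wpM2r ?normc_ge0// powRN_le// Theta_gt0.
Qed.

(** The outputs [xi] and [- xi] contribute [2 * (normc A * normc B)] each, whence the 4; all other
    nonzero outputs lie beyond [Theta]. *)
Lemma block_pairs_wsum s : 0 <= s -> sym t ->
  \sum_(q <- new_pairs t block | psum q != 0) en R (psum q) `^ (- s) * pnorm q <=
  4 * (normc A * normc B) * en R xi `^ (- s) + Theta `^ (- s) * (2 * (l1 t * l1 block) + l1 block ^+ 2).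
Proof.
move=> s0 st.
have -> : 4 * (normc A * normc B) * en R xi `^ (- s) =
   \sum_(q <- new_pairs t block) (if psum q == xi then en R xi `^ (- s) * pnorm q else 0) +
   \sum_(q <- new_pairs t block) (if psum q == - xi then en R xi `^ (- s) * pnorm q else 0).
  by rewrite -!big_mkcond -!mulr_sumr block_pnorm block_pnormN//; ring.
rewrite -sum_pnorm_new mulr_sumr -!big_split /= big_mkcond big_seq [leRHS]big_seq.
apply: ler_sum => q /new_pairs_psum hq.
have p0 : 0 <= pnorm q by rewrite mulr_ge0 ?normc_ge0.
have g0 r x : 0 <= en R x `^ r * pnorm q by rewrite mulr_ge0 ?powR_ge0.
have T0 : 0 <= Theta `^ (- s) * pnorm q by rewrite mulr_ge0 ?powR_ge0.
case/orP: hq => [|hq]; last first.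
  apply: (@le_trans _ _ (Theta `^ (- s) * pnorm q)).
    case: ifP => // _; rewrite ler_wpM2r//; exact: powRN_le Theta_gt0 hq.
  by rewrite lerDr addr_ge0//; case: ifP.
rewrite !inE => /or3P[/eqP ->|/eqP ->|/eqP ->]; rewrite ?eqxx /=.
- by rewrite !addr_ge0//; case: ifP.
- by rewrite xi0 -addrA lerDl addr_ge0//; case: ifP.
- by rewrite oppr_eq0 xi0 enN addrAC lerDr addr_ge0//; case: ifP.
Qed.

Variables (gamma sigma M : R).
Hypotheses (hgamma : 0 < gamma) (gs : gamma <= sigma) (s1 : 1 <= sigma).
Hypothesis hM : forall i k, k != 0 -> normc (m k 0 i) <= M.
Hypothesis t0 : forall x : atom, x \in t -> x.1 != 0.
Hypothesis Theta1 : 1 <= Theta.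

Lemma block_neq0 (x : atom) : x \in block -> x.1 != 0.
Proof.
move=> /block_ge h; apply: contraTneq h => ->.
by rewrite en0 -ltNge; exact: Theta_gt0.
Qed.

(** Against the weight [- (sigma + 1)], the linear term loses [gamma <= sigma] powers and the
    bilinear one a single power, so each keeps a full inverse power of a frequency beyond [Theta].
    At [xi] and [- xi] the change is of the size of the residual, so they are left out. *)
Lemma block_residual_diff (S : seq 'rV[int]_d) : uniq S -> 0 \notin S -> xi \notin S -> - xi \notin S ->
  \sum_(x <- S) en R x `^ (- (sigma + 1)) * normc (residual m gamma (t ++ block) x - residual m gamma t x) <=
  Theta^-1 * ((2 * pi) `^ gamma * l1 block + 2 * pi * (d%:R * M) * (2 * (l1 t * l1 block) + l1 block ^+ 2)).
Proof.
move=> uS S0 Sx SNx.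
have T0 := Theta_gt0.
have pi0 := @pi_ge0 R.
have M0 : 0 <= d%:R * M.
  have [->|d0] := eqVneq (d : nat) 0%N; first by rewrite mul0r.
  have [i ei] := intv_coord_ge1 R e0.
  by rewrite mulr_ge0//; apply: le_trans (hM i e0); exact: normc_ge0.
have T1 : Theta^-1 = Theta `^ (- 1) by rewrite powRN powRr1// ltW.
have Ts : Theta `^ (- sigma) <= Theta^-1.
  by rewrite T1 ler_powR//; have := s1; lra.
have w0 (x : 'rV[int]_d) : 0 <= en R x `^ (- (sigma + 1)) by exact: powR_ge0.
apply: (@le_trans _ _ (\sum_(x <- S) (2 * pi) `^ gamma * ((en R x `^ (- (sigma + 1)) * en R x `^ gamma) * normc (coef block x)) +
   \sum_(x <- S) 2 * pi * (en R x `^ (- (sigma + 1)) * normc (bil m (new_pairs t block) x)))).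
  rewrite -big_split /=; apply: ler_sum => x _.
  rewrite residual_cat addrAC subrr add0r.
  apply: (@le_trans _ _ (en R x `^ (- (sigma + 1)) * (((2 * pi) `^ gamma * en R x `^ gamma) * normc (coef block x) + 2 * pi * normc (bil m (new_pairs t block) x)))).
    rewrite ler_wpM2l//; apply: le_trans (ler_normcD _ _) _.
    have ni : normc ('i%C : R[i]) = 1 by rewrite normcE2 /= expr0n expr1n add0r sqrtr1.
    rewrite !ComplexField.Normc.normcM ni !normcR mul1r.
    by rewrite !ger0_norm ?powR_ge0 ?mulr_ge0// powRM ?en_ge0 ?mulr_ge0.
  rewrite le_eqVlt; apply/orP; left; apply/eqP; ring.
rewrite [leRHS]mulrDr; apply: lerD.
  rewrite -mulr_sumr mulrCA ler_wpM2l ?powR_ge0//.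
  apply: le_trans (wsum_coef_le (wt := fun x => en R x `^ (- (sigma + 1)) * en R x `^ gamma) _ _ uS) _.
    by move=> x; rewrite mulr_ge0 ?powR_ge0.
  rewrite big_mkcond /l1 mulr_sumr big_seq [leRHS]big_seq; apply: ler_sum => a ab.
  have h := block_ge ab; case: ifP => _; last by rewrite mulr_ge0 ?normc_ge0 ?invr_ge0 ?ltW.
  rewrite ler_wpM2r ?normc_ge0//.
  have a0 : 0 < en R a.1 by apply: lt_le_trans h.
  rewrite -powRD; last by apply/implyP => _; rewrite gt_eqF.
  apply: (@le_trans _ _ (en R a.1 `^ (- 1))); last by rewrite T1 powRN_le.
  by rewrite ler_powR//; [apply: le_trans h|have := gs; lra].
rewrite -mulr_sumr.
apply: (@le_trans _ _ (2 * pi * (Theta^-1 * (d%:R * M) * (\sum_(q <- new_pairs t block) pnorm q)))); last first.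
  rewrite sum_pnorm_new.
  set N := 2 * (_) + _; have N0 : 0 <= N by rewrite /N addr_ge0 ?mulr_ge0 ?exprn_ge0 ?l1_ge0.
  have -> : Theta^-1 * (2 * pi * (d%:R * M) * N) = 2 * pi * (Theta^-1 * (d%:R * M) * N) by ring.
  by [].
rewrite ler_wpM2l ?mulr_ge0//; apply: le_trans (wsum_bil_le m _ w0 uS) _.
rewrite big_mkcond mulr_sumr big_seq [leRHS]big_seq; apply: ler_sum => q qn.
have p0 : 0 <= pnorm q by rewrite mulr_ge0 ?normc_ge0.
case: ifPn => [qS|_]; last by rewrite mulr_ge0 // mulr_ge0 // invr_ge0 ltW.
have h : Theta <= en R (psum q).
  have := new_pairs_psum qn; rewrite !inE => /orP[|//] /or3P[] /eqP E; rewrite E in qS.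
  - by rewrite qS in S0.
  - by rewrite qS in Sx.
  - by rewrite qS in SNx.
have q0 : q.2.1 != 0.
  move: qn; rewrite /new_pairs !mem_cat !mem_pairs => /or3P[] /andP[_ h2];
    by [exact: block_neq0|exact: t0].
have x0 : 0 < en R (psum q) by apply: lt_le_trans h.
apply: (@le_trans _ _ (en R (psum q) `^ (- (sigma + 1)) * (pnorm q * (d%:R * M * en R (psum q))))).
  by rewrite !ler_wpM2l ?powR_ge0// (normc_mdot_le _ (fun i => hM i q0)).
have -> : en R (psum q) `^ (- (sigma + 1)) * (pnorm q * (d%:R * M * en R (psum q))) =
   (en R (psum q) `^ (- (sigma + 1)) * en R (psum q) `^ 1) * (d%:R * M) * pnorm q.
  by rewrite powRr1 ?en_ge0//; ring.
rewrite -powRD; last by apply/implyP => _; rewrite gt_eqF.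
rewrite ler_wpM2r// ler_wpM2r//.
have -> : - (sigma + 1) + 1 = - sigma by ring.
by apply: (le_trans (powRN_le _ T0 h) Ts); have := s1; lra.
Qed.

End Block.

(** * Pointwise bounds on packets and the size of the resonance coefficient *)

Section Envelope.
Variables (R : realType) (d : nat) (m : 'rV[int]_d -> 'rV[R[i]]_d).
Hypothesis multN : forall k i, m (- k) 0 i = (m k 0 i)^*%C.
Notation atom := ('rV[int]_d * R[i])%type.
Implicit Types (t s w : seq atom) (k : 'rV[int]_d) (x : 'rV[R]_d) (o : option 'I_d).

(* [None] stands for the scalar unknown and [Some i] for the i-th component of
   the velocity. *)
Definition symbol o k : R[i] := if o is Some i then m k 0 i else 1.

Definition trig o t x : R[i] := \sum_(a <- t) symbol o a.1 * a.2 * echar a.1 x.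

Lemma symbolN o k : symbol o (- k) = ((symbol o k)^*)%C.
Proof. by case: o => [i|] /=; [exact: multN|apply: complex_eq; rewrite /= ?oppr0]. Qed.

Lemma trig_cat o t s x : trig o (t ++ s) x = trig o t x + trig o s x.
Proof. by rewrite /trig big_cat. Qed.

Lemma trig_conja o t x : trig o (map (@conja R d) t) x = ((trig o t x)^*)%C.
Proof.
rewrite /trig conj_sum big_map; apply: eq_bigr => a _ /=.
by rewrite symbolN echarN !conjM.
Qed.

Lemma trig_real o t x : sym t -> trig o t x = (complex.Re (trig o t x))%:C.
Proof.
move=> st; have : trig o t x = ((trig o t x)^*)%C.
  by rewrite -trig_conja /trig (perm_big _ st).
by case: (trig o t x) => a b /= [] E; apply: complex_eq => //=; lra.
Qed.

Variables (e : 'rV[int]_d) (J : nat).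

(** With the symbol frozen at [z], the modulus of the packet is that of its nonnegative Riesz
    envelope times a constant; the variation of the symbol is paid with the [l^1] norm. *)
Lemma normc_trig_rblock o k (C z : R[i]) M eta x : normc z <= M -> 0 <= eta ->
  (forall a, a \in riesz R J -> normc (symbol o (k + e *~ a.1) - z) <= eta) ->
  normc (trig o (rblock e J k C) x) <=
  normc C * (M * (riesz_scale R J * rieszT e J x) + eta * (riesz_scale R J * \sum_(a <- riesz R J) a.2)).
Proof.
move=> zM eta0 h; have s0 := ltW (riesz_scale_gt0 R J).
have -> : trig o (rblock e J k C) x =
   C * echar k x * (z * (riesz_scale R J * rieszT e J x)%:C +
    \sum_(a <- riesz R J) (symbol o (k + e *~ a.1) - z) * (riesz_scale R J * a.2)%:C * echar (e *~ a.1) x).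
  rewrite /trig big_map rmorphM /= -rieszT_complex mulrA mulr_sumr -big_split /= mulr_sumr.
  by apply: eq_bigr => a _; rewrite /= echarD rmorphM /=; ring.
rewrite !ComplexField.Normc.normcM normc_echar mulr1 ler_wpM2l ?normc_ge0//.
apply: le_trans (ler_normcD _ _) _; apply: lerD.
  rewrite ComplexField.Normc.normcM normcR ger0_norm ?mulr_ge0 ?rieszT_ge0//.
  by rewrite ler_wpM2r ?mulr_ge0 ?rieszT_ge0.
apply: le_trans (normc_sum _ _ _) _; rewrite !mulr_sumr big_seq [leRHS]big_seq.
apply: ler_sum => a aJ; rewrite !ComplexField.Normc.normcM normc_echar mulr1 normcR.
rewrite ger0_norm; last by rewrite mulr_ge0 ?(riesz_ge0 aJ).
by rewrite ler_wpM2r ?h// mulr_ge0 ?(riesz_ge0 aJ).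
Qed.

(** The factor 4 counts two packets and their conjugates. *)
Lemma normc_trig_block o p xi (A B z : R[i]) M eta rho x : normc z <= M -> 0 <= eta ->
  normc A <= rho -> normc B <= rho ->
  (forall a, a \in riesz R J -> normc (symbol o (p + e *~ a.1) - z) <= eta /\
    normc (symbol o (p + xi + e *~ a.1) - z) <= eta) ->
  normc (trig o (block p xi e A B J) x) <=
  4 * rho * M * (riesz_scale R J * rieszT e J x) +
  4 * rho * eta * (riesz_scale R J * \sum_(a <- riesz R J) a.2).
Proof.
move=> zM eta0 hA hB h; have s0 := ltW (riesz_scale_gt0 R J).
rewrite /block trig_cat trig_conja; apply: le_trans (ler_normcD _ _) _.
rewrite normc_conj /hblock trig_cat.
have := ler_normcD (trig o (rblock e J p A) x) (trig o (rblock e J (p + xi) B) x).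
have := @normc_trig_rblock o p A z M eta x zM eta0 (fun a aJ => (h a aJ).1).
have := @normc_trig_rblock o (p + xi) B z M eta x zM eta0 (fun a aJ => (h a aJ).2).
have M0 : 0 <= M by apply: le_trans zM; exact: normc_ge0.
have S0 : 0 <= \sum_(a <- riesz R J) a.2 by rewrite big_seq sumr_ge0// => a /riesz_ge0.
set Y := M * _ + _.
have Y0 : 0 <= Y by rewrite /Y addr_ge0 ?mulr_ge0 ?rieszT_ge0.
have := ler_wpM2r Y0 hA; have := ler_wpM2r Y0 hB.
have -> : 4 * rho * M * (riesz_scale R J * rieszT e J x) +
  4 * rho * eta * (riesz_scale R J * \sum_(a <- riesz R J) a.2) = 4 * (rho * Y) by rewrite /Y; ring.
lra.
Qed.

(** The coefficient is a weighted mean of quantities that all satisfy this bound; the factor 2 comes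
    from the two orders of a pair. *)
Lemma resonance_coef_near p xi (K : 'rV[int]_d) eta : 0 <= eta ->
  (forall i a, a \in riesz R J -> normc (m (p + e *~ a.1) 0 i - m K 0 i) <= eta /\
    normc (m (p + xi + e *~ a.1) 0 i - m K 0 i) <= eta) ->
  normc (resonance_coef m p xi e J - (rdot (intv R xi) (even_part m K))%:C) <=
  2 * (d%:R * eta * en R xi).
Proof.
move=> eta0 h.
have mdotB k : (forall i, normc (m k 0 i - m K 0 i) <= eta) ->
    normc (mdot m xi k - mdot m xi K) <= d%:R * eta * en R xi.
  move=> hk; have := @normc_mdot_le R d (fun l => \row_i (m l 0 i - m K 0 i)) eta xi k.
  rewrite /mdot -sumrB; under eq_bigr do rewrite mxE mulrBr.
  by apply=> i; rewrite mxE.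
have -> : (rdot (intv R xi) (even_part m K))%:C = ((mdot m xi K)^*)%C + mdot m xi K.
  rewrite /rdot /mdot conj_sum -big_split rmorph_sum; apply: eq_bigr => i _ /=.
  rewrite !mxE conjM.
  have E : ((xi 0 i)%:~R : R[i]) = ((xi 0 i)%:~R : R)%:C by rewrite rmorph_int.
  by rewrite E conjR; case: (m K 0 i) => u v; apply: complex_eq => /=; ring.
set D := ((mdot m xi K)^*)%C + _.
have -> : resonance_coef m p xi e J - D = \sum_(a <- riesz R J)
  ((riesz_scale R J * a.2) ^+ 2)%:C * ((((mdot m xi (p + e *~ a.1))^*)%C + mdot m xi (p + xi + e *~ a.1)) - D).
  under eq_bigr do rewrite mulrBr.
  by rewrite sumrB -mulr_suml -rmorph_sum riesz_scale_sum mul1r.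
apply: le_trans (normc_sum _ _ _) _.
rewrite -[leRHS]mul1r -[X in _ <= X * _](riesz_scale_sum R J) mulr_suml big_seq [leRHS]big_seq; apply: ler_sum => a aJ.
rewrite ComplexField.Normc.normcM normcR ger0_norm ?sqr_ge0// ler_wpM2l ?sqr_ge0//.
have -> : ((mdot m xi (p + e *~ a.1))^*)%C + mdot m xi (p + xi + e *~ a.1) - D =
  ((mdot m xi (p + e *~ a.1) - mdot m xi K)^*)%C + (mdot m xi (p + xi + e *~ a.1) - mdot m xi K).
  rewrite /D; case: (mdot m xi (p + e *~ a.1)) (mdot m xi K) (mdot m xi (p + xi + e *~ a.1)) => a1 b1 [a2 b2] [a3 b3].
  by apply: complex_eq => /=; ring.
apply: le_trans (ler_normcD _ _) _; rewrite normc_conj.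
have := mdotB (p + e *~ a.1) (fun i => (h i a aJ).1).
have := mdotB (p + xi + e *~ a.1) (fun i => (h i a aJ).2); lra.
Qed.

End Envelope.

Lemma amplitude_field (F : realFieldType) (u v w y z : F) : u != 0 -> v != 0 -> w != 0 ->
  4 / (u * w) * (y / v * (z * (u * w * v))) = 4 * z * y.
Proof. by move=> u0 v0 w0; field; rewrite u0 v0 w0. Qed.

(** * One stage of the iteration *)

Section Stage.
Variables (R : realType) (d : nat) (m : 'rV[int]_d -> 'rV[R[i]]_d) (gamma : R).
Notation atom := ('rV[int]_d * R[i])%type.
Implicit Types (t w : seq atom) (k xi e : 'rV[int]_d).

Lemma exists_threshold (T0 x eps delta Y X : R) : 0 < eps -> 0 < delta -> 0 <= Y -> 0 <= X ->
  exists T, [/\ T0 <= T, 1 <= T, x < T, T `^ (- eps) * Y <= delta & T^-1 * X <= delta].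
Proof.
move=> e0 d0 Y0 X0.
pose y := (Y / delta) `^ eps^-1.
have y0 : 0 <= y by exact: powR_ge0.
have Xd : 0 <= X / delta by rewrite divr_ge0// ltW.
pose T := `|T0| + 1 + `|x| + y + X / delta; exists T.
have a1 := ler_norm T0; have a2 := ler_norm x; have a3 := normr_ge0 T0; have a4 := normr_ge0 x.
have T0' : 0 < T by rewrite /T; lra.
split; rewrite ?/T; try lra.
  rewrite -/T powRN mulrC ler_pdivrMr ?powR_gt0// -ler_pdivrMl//.
  have -> : delta^-1 * Y = y `^ eps.
    by rewrite /y -powRrM mulVf ?gt_eqF// powRr1 ?divr_ge0 ?(ltW d0)// mulrC.
  by rewrite ge0_ler_powR ?nnegrE ?(ltW e0) ?(ltW T0')// /T; lra.
by rewrite -/T mulrC ler_pdivrMr// -ler_pdivrMl// mulrC /T; lra.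
Qed.

Lemma exists_far (T : R) : (0 < d)%N -> exists2 e : 'rV[int]_d, e != 0 &
  forall l : int, l != 0 -> T <= en R (e *~ l).
Proof.
move=> d0; pose i0 := Ordinal d0; pose mu := (Num.truncn T).+1.
pose e : 'rV[int]_d := delta_mx 0 i0 *+ mu.
have h1 : 1 <= en R (delta_mx 0 i0 : 'rV[int]_d).
  by apply: en_ge1; apply/eqP => /rowP/(_ i0); rewrite !mxE !eqxx.
have h2 : T <= mu%:R by apply: ltW; exact: truncnS_gt.
have e0 : e != 0.
  apply/eqP => /(congr1 (en R)); rewrite enMn en0 => /eqP.
  by rewrite mulf_eq0 pnatr_eq0 /= gt_eqF//; apply: lt_le_trans h1.
exists e => // l l0; rewrite enMz /e enMn.
have h3 : 1 <= (`|l|%:~R : R) by rewrite (ler_int R 1) -gtz0_ge1 normr_gt0.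
apply: le_trans h2 _; rewrite -[leLHS]mul1r ler_pM// ler_peMr//.
Qed.

(** Only the product [X] of [B] and the conjugate of [A] is prescribed. Taking [A] to be the square
    root of the modulus of [X] gives both amplitudes the same modulus. *)
Lemma exists_amplitude (Z res : R[i]) (rho : R) : Z != 0 -> 0 <= rho ->
  normc res <= rho ^+ 2 * (2 * pi * normc Z) ->
  exists A B : R[i], [/\ 'i%C * (2 * pi)%:C * (B * (A^*)%C * Z) = - res,
    normc A * normc B * (2 * pi * normc Z) = normc res, normc A <= rho & normc B <= rho].
Proof.
move=> Z0 rho0 h.
have pi0 := @pi_gt0 R.
have nZ : 0 < normc Z by rewrite lt_neqAle eq_sym normc_eq0 Z0 normc_ge0.
have P0 : 0 < 2 * pi * normc Z by rewrite !mulr_gt0.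
have P1 : ((2 * pi)%:C : R[i]) != 0 by apply/eqP => -[] E; move: pi0; lra.
pose X := res * 'i%C / ((2 * pi)%:C * Z).
have i2 : ('i%C : R[i]) * 'i%C = -1 by apply: complex_eq; rewrite ?ReM ?ImM /=; ring.
have hX : 'i%C * (2 * pi)%:C * (X * Z) = - res.
  have -> : 'i%C * (2 * pi)%:C * (X * Z) = ('i%C * 'i%C) * res * (((2 * pi)%:C * Z) / ((2 * pi)%:C * Z)).
    by rewrite /X; ring.
  by rewrite divff ?mulf_neq0// i2 mulr1 mulN1r.
have ni : normc ('i%C : R[i]) = 1 by rewrite normcE2 /= expr0n expr1n add0r sqrtr1.
have nX : normc X * (2 * pi * normc Z) = normc res.
  rewrite -[RHS]normc_opp -hX !ComplexField.Normc.normcM ni normcR ger0_norm ?mulr_ge0 ?(ltW pi0)//.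
  by ring.
have nX2 : normc X <= rho ^+ 2 by rewrite -(ler_pM2r P0) nX.
have [X0|X0] := eqVneq X 0.
  exists 0, 0; rewrite X0 mul0r in hX; rewrite X0 ComplexField.Normc.normc0 mul0r in nX.
  by rewrite !mul0r ComplexField.Normc.normc0 !mul0r -nX hX.
have sX : 0 < Num.sqrt (normc X) by rewrite sqrtr_gt0 lt_neqAle eq_sym normc_eq0 X0 normc_ge0.
pose A : R[i] := (Num.sqrt (normc X))%:C.
have A0 : A != 0 by apply/eqP => -[] E; rewrite E ltxx in sX.
have nA : normc A = Num.sqrt (normc X) by rewrite normcR ger0_norm ?sqrtr_ge0.
have nA2 : Num.sqrt (normc X) ^+ 2 = normc X by rewrite sqr_sqrtr ?normc_ge0.
have nB : normc (X / A) = Num.sqrt (normc X).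
  apply: (mulIf (lt0r_neq0 sX)); rewrite -{1}nA -ComplexField.Normc.normcM mulfVK//.
have sr : Num.sqrt (normc X) <= rho.
  by rewrite -(@ler_pXn2r _ 2) ?nnegrE ?sqrtr_ge0// nA2.
exists A, (X / A); split; rewrite ?nA ?nB//.
  by rewrite conjR divfK.
by rewrite -expr2 nA2.
Qed.

Hypotheses (hm : standing_multiplier m) (hd : (2 <= d)%N).

(** At least [gamma] for the linear term, and at least 1 so that the threshold gains a full power.
    For [d >= 2] it does not exceed [d / 2 + max (gamma - 1, 0)], and [gamma <= 2] keeps it at most
    2, within reach of the decay of test functions. *)
Definition sobolev_exponent : R := Num.max gamma 1.
Notation sigma := sobolev_exponent.

(** In [stage_pairs], [C0] multiplies the one contribution governed by the residual at the target;
    every other cost is charged to [delta]. The parameter [eps] sets both the negative weight on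
    coefficients and the range of Lebesgue exponents. *)
Record stage_spec C0 t xi Theta eps delta w : Prop := {
  stage_sym : sym w ;
  stage_far : forall a : atom, a \in w -> Theta <= en R a.1 ;
  stage_neq0 : forall a : atom, a \in w -> a.1 != 0 ;
  stage_wsum : \sum_(a <- w) en R a.1 `^ (- eps) * normc a.2 <= delta ;
  stage_psum : forall q : atom * atom, q \in new_pairs t w ->
    (psum q \in [:: 0; xi; - xi]) || (Theta <= en R (psum q)) ;
  stage_solved : residual m gamma (t ++ w) xi = 0 ;
  stage_pairs : \sum_(q <- new_pairs t w | psum q != 0) en R (psum q) `^ (- sigma) * pnorm q <=
    C0 * (en R xi `^ (- (sigma + 1)) * normc (residual m gamma t xi)) + delta ;
  stage_diff : forall S : seq 'rV[int]_d, uniq S -> 0 \notin S -> xi \notin S -> - xi \notin S ->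
    \sum_(x <- S) en R x `^ (- (sigma + 1)) *
      normc (residual m gamma (t ++ w) x - residual m gamma t x) <= delta ;
  stage_envelope : exists W : 'rV[R]_d -> R, [/\ tame W,
    forall o x, normc (trig m o w x) <= W x &
    forall p, 1 <= p <= 2 - eps -> tint (fun x => W x `^ p) <= delta]
}.

(** The choices are ordered so that each depends on earlier ones only: the amplitude bound [rho]
    from the residual, [J] and [eta] from the Lebesgue budget, the multiplier tolerance [eta1], the
    threshold [T], the spacing [e], the radius [L], and the multiple [n] of the direction [K]. [C0]
    is fixed before the polynomial, hence common to all stages. *)
Lemma stage_exists : exists2 C0, 0 < C0 & forall t xi Theta eps delta,
  sym t -> (forall x : atom, x \in t -> x.1 != 0) -> xi != 0 -> 0 < eps -> 0 < delta ->
  exists w, stage_spec C0 t xi Theta eps delta w.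
Proof.
have [M M1 hM] := mult_bounded hm.
have [c c0 hc] := spanning_directions hm hd.
have pi0 := @pi_gt0 R.
have M0 : 0 < M by apply: lt_le_trans M1.
have dR0 : 0 < d%:R :> R by rewrite ltr0n; apply: leq_trans hd.
(* The pairs resonating at [xi] and [- xi] weigh at most [4 * rho ^+ 2], and [rho ^+ 2] is the
   residual divided by [pi * c * en R xi]. *)
exists (4 / (pi * c)); first by rewrite divr_gt0// mulr_gt0.
move=> t xi Theta0 eps delta st t0 xi0 eps0 delta0.
have x0 : 0 < en R xi by exact: en_gt0.
have [K K0 hK] := hc (intv R xi) x0; rewrite -/(en R xi) in hK.
set res := residual m gamma t xi.
(* Tuned to the lower bound [c / 2 * en R xi] on the resonance coefficient: then [2 * pi * normc Z]
   is at least [pi * c * en R xi]. *)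
pose rho := Num.sqrt (normc res / (pi * c * en R xi)).
have D0 : 0 < pi * c * en R xi by rewrite !mulr_gt0.
have rho0 : 0 <= rho by exact: sqrtr_ge0.
have rho2 : rho ^+ 2 * (pi * c * en R xi) = normc res.
  by rewrite sqr_sqrtr ?divr_ge0 ?normc_ge0 ?(ltW D0)// divfK ?gt_eqF.
have cM0 : 0 <= 4 * rho * M by rewrite !mulr_ge0// ltW.
have [J [eta eta0 hJ]] := @riesz_envelope R d eps (4 * rho * M) delta eps0 cM0 delta0.
have [kS kSE] : exists kS, kS = riesz_scale R J * \sum_(a <- riesz R J) a.2 by eexists.
have kS0 : 0 <= kS.
  by rewrite kSE mulr_ge0 ?(ltW (riesz_scale_gt0 R J))// big_seq sumr_ge0// => a /riesz_ge0.
have rk0 : 0 <= 4 * rho * kS by rewrite !mulr_ge0.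
(* The first bound lets the resonance coefficient lose at most half of its limiting lower bound; the
   second keeps the envelope error below [eta], the 1 protecting against a zero denominator. *)
pose eta1 := Num.min (c / (4 * d%:R)) (eta / (4 * rho * kS + 1)).
have eta10 : 0 < eta1 by rewrite lt_min !divr_gt0 ?mulr_gt0//; clear -rk0; lra.
have eta1c : 4 * (d%:R * eta1) <= c.
  have : eta1 <= c / (4 * d%:R) by rewrite ge_min lexx.
  by rewrite ler_pdivlMr ?mulr_gt0//; clear; lra.
have eta1e : 4 * rho * eta1 * kS <= eta.
  have : eta1 <= eta / (4 * rho * kS + 1) by rewrite ge_min lexx orbT.
  by rewrite ler_pdivlMr; [clear -rk0 eta10; nra|clear -rk0; lra].
have l1t := l1_ge0 t.
(* [X1] bounds the numerator of the drift and [X2] the mass of the new pairs, with the [l^1] norm of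
   the block replaced by [4 * rho * kS], which is known before the block. *)
pose X1 := (2 * pi) `^ gamma * (4 * rho * kS) + 2 * pi * (d%:R * M) * (2 * (l1 t * (4 * rho * kS)) + (4 * rho * kS) ^+ 2).
pose X2 := 2 * (l1 t * (4 * rho * kS)) + (4 * rho * kS) ^+ 2.
have X20 : 0 <= X2 by rewrite /X2 addr_ge0 ?mulr_ge0 ?exprn_ge0.
have X10 : 0 <= X1 by rewrite /X1 -/X2 addr_ge0// !mulr_ge0 ?powR_ge0 ?(ltW pi0) ?(ltW dR0) ?(ltW M0).
have [T [T0 T1 xT Teps TX]] := @exists_threshold Theta0 (en R xi) eps delta (4 * rho * kS) (X1 + X2)
  eps0 delta0 rk0 (addr_ge0 X10 X20).
have Tp : 0 < T by apply: lt_le_trans T1.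
have sig1 : 1 <= sigma by rewrite le_max lexx orbT.
have gsig : gamma <= sigma by rewrite le_max lexx.
have Tsig : T `^ (- sigma) <= T^-1.
  have -> : T^-1 = T `^ (- 1) by rewrite powRN powRr1// ltW.
  by rewrite ler_powR//; rewrite lerN2.
have [TX1 TX2] : T^-1 * X1 <= delta /\ T^-1 * X2 <= delta.
  have := @mulr_ge0 R T^-1 X1; have := @mulr_ge0 R T^-1 X2.
  by rewrite invr_ge0 (ltW Tp) X10 X20 => /(_ isT isT) h1 /(_ isT isT) h2; move: TX; rewrite mulrDr; clear -h1 h2; split; lra.
have [e e0 sep] := exists_far (T + 2 * en R xi) (ltnW hd).
pose L := en R xi + (\sum_(a <- riesz R J) en R (e *~ a.1) + \sum_(a <- t) en R a.1).
have s1_0 : 0 <= \sum_(a <- riesz R J) en R (e *~ a.1) by apply: sumr_ge0 => a _; exact: en_ge0.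
have s2_0 : 0 <= \sum_(a <- t) en R a.1 by apply: sumr_ge0 => a _; exact: en_ge0.
have xiL : en R xi <= L by rewrite /L; clear -s1_0 s2_0; lra.
have L0 : 0 <= L by apply: le_trans xiL; exact: ltW.
have mem_le (I : eqType) (s : seq I) (f : I -> R) a : (forall b, 0 <= f b) -> a \in s -> f a <= \sum_(b <- s) f b.
  move=> f0 aS; rewrite (big_rem a)//= lerDl; apply: sumr_ge0 => b _; exact: f0.
have eL a : a \in riesz R J -> en R (e *~ a.1) <= L.
  move=> /(mem_le _ _ (fun a : int * R => en R (e *~ a.1))) h.
  by have := h (fun=> en_ge0 _ _); rewrite /L; clear -x0 s1_0 s2_0; lra.
have tL (x : atom) : x \in t -> en R x.1 <= L.
  move=> /(mem_le _ _ (fun a : atom => en R a.1)) h.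
  by have := h (fun=> en_ge0 _ _); rewrite /L; clear -x0 s1_0 s2_0; lra.
have [N hN] := mult_near hm (4 * L) K0 eta10.
(* Far enough both for the multiplier to be within [eta1] of its value at [K] and for every shift of
   [p] by at most [4 * L] to stay beyond [T]. *)
pose n := maxn N (Num.truncn (T + 4 * L)).+1; pose p := K *+ n.
have nT : T + 4 * L <= n%:R.
  apply: (le_trans (ltW (truncnS_gt _))); by rewrite ler_nat leq_maxr.
have enK : n%:R <= en R p.
  by rewrite /p enMn -[leLHS]mulr1 ler_wpM2l// en_ge1.
have far1 v : en R v <= 4 * L -> T <= en R (p + v).
  by move=> hv; have := ler_enD R p v; clear -nT enK hv; lra.
have far2 v : en R v <= 4 * L -> T <= en R (p *+ 2 + v).
  by move=> hv; have := ler_enD R (p *+ 2) v; rewrite enMn; clear -nT enK hv L0 Tp; lra.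
have near v : en R v <= 4 * L -> forall i, normc (m (p + v) 0 i - m K 0 i) <= eta1.
  move=> hv; apply: hN => //; first exact: leq_maxl.
  by apply: contraTneq (far1 v hv) => ->; rewrite en0 -ltNge.
have near2 i a : a \in riesz R J -> normc (m (p + e *~ a.1) 0 i - m K 0 i) <= eta1 /\
    normc (m (p + xi + e *~ a.1) 0 i - m K 0 i) <= eta1.
  move=> /eL ha; split; first by apply: near; clear -ha L0; lra.
  by rewrite -addrA; apply: near; have := enD R xi (e *~ a.1); clear -ha xiL L0; lra.
set Z := resonance_coef m p xi e J.
have Zc : c / 2 * en R xi <= normc Z.
  have h := resonance_coef_near (ltW eta10) near2.
  have := ler_normcD (Z - (rdot (intv R xi) (even_part m K))%:C) (- Z).
  rewrite addrAC subrr add0r !normc_opp normcR.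
  have : 2 * (d%:R * eta1 * en R xi) <= c / 2 * en R xi.
    rewrite mulrA ler_wpM2r ?(ltW x0)//; clear -eta1c; lra.
  move: h hK; rewrite -/Z; clear; lra.
have Z0 : Z != 0.
  by rewrite -normc_eq0 gt_eqF//; apply: lt_le_trans Zc; rewrite mulr_gt0// divr_gt0.
have hres : normc res <= rho ^+ 2 * (2 * pi * normc Z).
  rewrite -rho2 ler_wpM2l ?sqr_ge0//.
  have -> : pi * c * en R xi = 2 * pi * (c / 2 * en R xi) by field.
  by rewrite ler_wpM2l// mulr_ge0// ltW.
have [A [B [hAB nAB nA nB]]] := exists_amplitude Z0 rho0 hres.
have multN' := multN hm.
have l1w : l1 (block p xi e A B J) <= 4 * rho * kS.
  by rewrite l1_block -kSE ler_wpM2r//; clear -nA nB; lra.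
have l1w0 := l1_ge0 (block p xi e A B J).
have Q2 : 2 * (l1 t * l1 (block p xi e A B J)) + l1 (block p xi e A B J) ^+ 2 <= X2.
  apply: lerD; first by rewrite ler_wpM2l// ler_wpM2l.
  by rewrite lerXn2r ?nnegrE.
exists (block p xi e A B J); split.
- exact: block_sym.
- by move=> a ha; apply: le_trans T0 _; exact: block_ge far1 xiL eL a ha.
- by move=> a ha; exact: block_neq0 far1 xT xiL eL a ha.
- apply: le_trans (block_wsum A B far1 xT xiL eL (ltW eps0)) _.
  by apply: le_trans Teps; rewrite ler_wpM2l ?powR_ge0.
- move=> q hq; have := new_pairs_psum far1 far2 sep xiL eL tL hq.
  by case/orP => [->//|h]; rewrite (le_trans T0 h) orbT.
- rewrite residual_cat.
  have -> : coef (block p xi e A B J) xi = 0.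
    rewrite /coef big_seq_cond big1// => a /andP[/(block_ge far1 xiL eL) h /eqP E].
    by rewrite E in h; move: xT; rewrite ltNge h.
  rewrite mulr0 add0r (block_bil multN' A B xi0 e0 far1 far2 sep xT xiL eL tL) hAB.
  by rewrite subrr.
- apply: le_trans (block_pairs_wsum A B xi0 e0 far1 far2 sep xT xiL eL tL _ st) _; first exact: le_trans sig1.
  apply: lerD.
    rewrite -/res -rho2.
    have -> : - (sigma + 1) = - sigma - 1 by ring.
    rewrite powRD; last by apply/implyP => _; rewrite gt_eqF.
    have -> : en R xi `^ (- 1) = (en R xi)^-1 by rewrite powRN powRr1// ltW.
    have -> : 4 / (pi * c) * (en R xi `^ (- sigma) * (en R xi)^-1 * (rho ^+ 2 * (pi * c * en R xi))) =
      4 * rho ^+ 2 * en R xi `^ (- sigma) by apply: amplitude_field; rewrite ?gt_eqF.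
    rewrite ler_wpM2r ?powR_ge0// ler_wpM2l//.
    by rewrite expr2 ler_pM ?normc_ge0.
  apply: le_trans TX2; apply: ler_pM; rewrite ?powR_ge0//.
  by rewrite addr_ge0 ?mulr_ge0 ?exprn_ge0.
- move=> S uS S0 Sx SNx.
  apply: le_trans (block_residual_diff A B e0 far1 far2 sep xT xiL eL tL gsig sig1 hM t0 T1 uS S0 Sx SNx) _.
  apply: le_trans TX1; rewrite ler_wpM2l ?invr_ge0 ?(ltW Tp)// /X1 -/X2.
  apply: lerD; first by rewrite ler_wpM2l ?powR_ge0.
  by rewrite ler_wpM2l ?mulr_ge0 ?(ltW pi0) ?(ltW dR0) ?(ltW M0).
- exists (fun x => 4 * rho * M * (riesz_scale R J * rieszT e J x) + eta); split.
  + by apply: tameD; [apply: tameZ; apply: tameZ; exact: tame_rieszT|exact: tame_cst].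
  + move=> o x.
    have [z zM hz] : exists2 z : R[i], normc z <= M & forall a, a \in riesz R J ->
        normc (symbol m o (p + e *~ a.1) - z) <= eta1 /\ normc (symbol m o (p + xi + e *~ a.1) - z) <= eta1.
      case: o => [i|]; first by exists (m K 0 i); [exact: hM|exact: near2].
      exists 1; first by rewrite (normcR 1) normr1.
      have E : normc (1 - 1 : R[i]) <= eta1.
        have /eqP -> : normc (1 - 1 : R[i]) == 0 by rewrite normc_eq0 subrr.
        exact: ltW.
      by move=> a _; split; exact: E.
    apply: le_trans (normc_trig_block multN' x zM (ltW eta10) nA nB hz) _.
    by rewrite -kSE lerD2l.
  + by move=> q hq; exact: hJ.
Qed.

End Stage.

(** * The iteration *)

Section Enumeration.
Variables (R : realType) (d : nat) (k0 : 'rV[int]_d).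
Hypothesis k00 : k0 != 0.
Implicit Types (k : 'rV[int]_d) (n : nat).

(* An enumeration of the nonzero frequencies in which each of them occurs
   only finitely often. *)
Definition target n : 'rV[int]_d :=
  if pickle_inv n is Some k then (if k == 0 then k0 *+ n.+1 else k) else k0 *+ n.+1.

Lemma mulrn_neq0 n : k0 *+ n.+1 != 0.
Proof.
apply/eqP => /(congr1 (en R)); rewrite enMn en0 => /eqP.
by rewrite mulf_eq0 pnatr_eq0 /= gt_eqF// en_gt0.
Qed.

Lemma target_neq0 n : target n != 0.
Proof.
rewrite /target; case: pickle_inv => [k|]; last exact: mulrn_neq0.
by have [_|//] := eqVneq k 0; exact: mulrn_neq0.
Qed.

Lemma target_pickle k : k != 0 -> target (pickle k) = k.
Proof. by move=> k1; rewrite /target pickleK_inv (negbTE k1). Qed.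

(* From stage [settle k] on, the coefficient of the iterates at [k] and the pairs
   of atoms resonating at [k] are frozen, and the residual at [k] vanishes. *)
Definition settle k : nat := (pickle k + pickle (- k) + Num.truncn (en R k)).+1.

Lemma settle_en k n : (settle k <= n)%N -> en R k < n%:R.
Proof.
move=> h; apply: lt_le_trans (truncnS_gt _) _; rewrite ler_nat.
by apply: leq_trans h; rewrite /settle ltnS leq_addl.
Qed.

(** A default target at index [n] has norm at least [n.+1], more than that of [k]; otherwise [k] is
    reached only at its own code. *)
Lemma target_settle k n : (settle k <= n)%N -> target n != k.
Proof.
move=> h; have kn := settle_en h.
have far : k0 *+ n.+1 != k.
  apply: contraTneq kn => <-; rewrite enMn -leNgt.
  apply: (@le_trans _ _ (n.+1%:R * 1)); first by rewrite mulr1 ler_nat.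
  by rewrite ler_wpM2l// en_ge1.
rewrite /target; case E : (pickle_inv n) => [l|]//.
case: ifP => // _; apply: contraTneq h => lk; rewrite -ltnNge /settle ltnS.
have : oapp pickle n (pickle_inv n : option 'rV[int]_d) = n by rewrite pickle_invK.
by rewrite E /= lk => ->; rewrite -addnA leq_addr.
Qed.

Lemma settleN k : settle (- k) = settle k.
Proof. by rewrite /settle opprK enN (addnC (pickle (- k))). Qed.

Lemma targetN_settle k n : (settle k <= n)%N -> - target n != k.
Proof. by move=> h; rewrite eqr_oppLR target_settle// settleN. Qed.

(** The first term drives new frequencies to infinity, the second protects the coefficient at [k0],
    and the last keeps new interactions away from frequencies already targeted. *)
Definition threshold n : R := n.+1%:R + en R k0 + \sum_(j < n.+1) en R (target j).

Lemma threshold_target j n : (j <= n)%N -> en R (target j) < threshold n.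
Proof.
move=> jn; rewrite /threshold (bigD1 (Ordinal (jn : j < n.+1)%N))//=.
have := en_ge0 R k0; have : 0 < n.+1%:R :> R by [].
have : 0 <= \sum_(i < n.+1 | i != Ordinal (jn : j < n.+1)%N) en R (target i).
  by apply: sumr_ge0 => i _; exact: en_ge0.
lra.
Qed.

Lemma threshold_base n : en R k0 < threshold n.
Proof.
rewrite /threshold; have : 0 < n.+1%:R :> R by [].
have : 0 <= \sum_(i < n.+1) en R (target i) by apply: sumr_ge0 => i _; exact: en_ge0.
lra.
Qed.

Lemma threshold_ge n : n%:R < threshold n.
Proof.
rewrite /threshold -natr1; have := en_ge0 R k0.
have : 0 <= \sum_(i < n.+1) en R (target i) by apply: sumr_ge0 => i _; exact: en_ge0.
lra.
Qed.

Lemma settle_threshold k n : (settle k <= n)%N -> en R k < threshold n.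
Proof. by move=> /settle_en h; apply: lt_trans h (threshold_ge n). Qed.

End Enumeration.

Section Scheme.
Variables (R : realType) (d : nat) (m : 'rV[int]_d -> 'rV[R[i]]_d) (gamma : R).
Notation atom := ('rV[int]_d * R[i])%type.

(** The bound on powers of sums costs a weight [4 ^+ n.+1]; the ratio 8 still leaves
    [2^-1 ^+ n.+1]. *)
Definition tolerance (n : nat) : R := 8^-1 ^+ n.+1.

Lemma tolerance_gt0 n : 0 < tolerance n.
Proof. by rewrite exprn_gt0. Qed.

Lemma sum_tolerance n : \sum_(j < n) tolerance j <= 1.
Proof.
suff : \sum_(j < n) tolerance j <= 1 - 8 * tolerance n.
  by have := tolerance_gt0 n; lra.
elim: n => [|n IH]; first by rewrite big_ord0 /tolerance expr1; lra.
rewrite big_ord_recr /=; have := tolerance_gt0 n.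
have -> : tolerance n.+1 = 8^-1 * tolerance n by rewrite /tolerance -exprS.
lra.
Qed.

Lemma sym_base (k0 : 'rV[int]_d) : sym [:: (k0, 1 : R[i]); (- k0, 1)].
Proof.
have c1 k : conja (k, 1 : R[i]) = (- k, 1).
  by congr (_, _); apply: complex_eq; rewrite /= ?oppr0.
rewrite /sym (_ : map _ _ = [:: (- k0, 1); (k0, 1)]); last by rewrite !map_cons !c1 opprK.
by apply/permP => P /=; rewrite !addn0 addnC.
Qed.

(** The start is a nonzero real polynomial. Since [n.+2%:R^-1] tends to 0, each exponent [p < 2]
    with [1 <= p], and each negative weight, is covered by all but finitely many stages. *)
Record scheme (k0 : 'rV[int]_d) (C0 : R) (t w : nat -> seq atom) : Prop := {
  scheme0 : t 0%N = [:: (k0, 1); (- k0, 1)] ;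
  schemeS : forall n, t n.+1 = t n ++ w n ;
  scheme_stage : forall n, stage_spec m gamma C0 (t n) (target k0 n) (threshold R k0 n)
    (n.+2%:R^-1) (tolerance n) (w n)
}.

Lemma scheme_exists k0 : standing_multiplier m -> (2 <= d)%N -> k0 != 0 ->
  exists2 C0, 0 < C0 & exists t w, scheme k0 C0 t w.
Proof.
move=> hm hd k00; have [C0 C00 hC] := stage_exists gamma hm hd; exists C0 => //.
pose good (t : seq atom) := sym t /\ forall x : atom, x \in t -> x.1 != 0.
(* The choice function is total; on lists that are not [good] it returns an arbitrary value. *)
have /boolp.choice[next hnext] : forall p : nat * seq atom, exists w, good p.2 ->
    stage_spec m gamma C0 p.2 (target k0 p.1) (threshold R k0 p.1) (p.1.+2%:R^-1) (tolerance p.1) w.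
  move=> [n t] /=; have [gt|ng] := pselect (good t); last by exists [::].
  have e0 : 0 < n.+2%:R^-1 :> R by rewrite invr_gt0.
  have [w hw] := hC t (target k0 n) (threshold R k0 n) (n.+2%:R^-1) (tolerance n)
    gt.1 gt.2 (target_neq0 R k00 n) e0 (tolerance_gt0 n).
  by exists w.
pose t := fix t n := if n is n'.+1 then t n' ++ next (n', t n') else [:: (k0, 1); (- k0, 1)] : seq atom.
have gt n : good (t n).
  elim: n => [|n IH].
    split; first exact: sym_base.
    by move=> x; rewrite !inE => /orP[] /eqP -> //=; rewrite oppr_eq0.
  have h := hnext (n, t n) IH.
  split; first by apply: sym_cat IH.1 (stage_sym h).
  by move=> x; rewrite mem_cat => /orP[/IH.2//|]; exact: (stage_neq0 h).
exists t, (fun n => next (n, t n)); split => // n.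
exact: (hnext (n, t n) (gt n)).
Qed.

End Scheme.

Section SchemeLimit.
Variables (R : realType) (d : nat) (m : 'rV[int]_d -> 'rV[R[i]]_d) (gamma : R).
Hypothesis hm : standing_multiplier m.
Notation atom := ('rV[int]_d * R[i])%type.
Notation sigma := (sobolev_exponent gamma).
Variables (k0 : 'rV[int]_d) (C0 : R) (t w : nat -> seq atom).
Hypotheses (k00 : k0 != 0) (C00 : 0 < C0) (hs : scheme m gamma k0 C0 t w).
Implicit Types (k x : 'rV[int]_d) (n N j : nat).

Let multN' := multN hm.

Definition theta_lim k : R[i] := coef (t (settle R k)) k.

Definition drift n x : R := normc (residual m gamma (t n.+1) x - residual m gamma (t n) x).

Definition weight x : R := en R x `^ (- (sigma + 1)).

Lemma t_sum (V : nmodType) (F : atom -> V) n :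
  \sum_(a <- t n) F a = \sum_(a <- t 0%N) F a + \sum_(j < n) \sum_(a <- w j) F a.
Proof.
elim: n => [|n IH]; first by rewrite big_ord0 addr0.
by rewrite (schemeS hs) big_cat big_ord_recr /= IH addrA.
Qed.

Lemma t_pairs_sum (V : nmodType) (F : atom * atom -> V) (P : pred (atom * atom)) n :
  \sum_(q <- pairs (t n) (t n) | P q) F q = \sum_(q <- pairs (t 0%N) (t 0%N) | P q) F q +
    \sum_(j < n) \sum_(q <- new_pairs (t j) (w j) | P q) F q.
Proof.
elim: n => [|n IH]; first by rewrite big_ord0 addr0.
by rewrite (schemeS hs) sum_pairs_cat big_ord_recr /= IH addrA.
Qed.

Lemma sym_t n : sym (t n).
Proof.
elim: n => [|n IH]; first by rewrite (scheme0 hs); exact: sym_base.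
by rewrite (schemeS hs); exact: sym_cat IH (stage_sym (scheme_stage hs n)).
Qed.

Lemma t_neq0 n (x : atom) : x \in t n -> x.1 != 0.
Proof.
elim: n => [|n IH]; last first.
  by rewrite (schemeS hs) mem_cat => /orP[/IH//|]; exact: (stage_neq0 (scheme_stage hs n)).
by rewrite (scheme0 hs) !inE => /orP[] /eqP -> //=; rewrite oppr_eq0.
Qed.

Lemma coef_w n k : en R k < threshold R k0 n -> coef (w n) k = 0.
Proof.
move=> h; rewrite /coef big_seq_cond big1// => a /andP[/(stage_far (scheme_stage hs n)) h1 /eqP E].
by move: h1; rewrite E leNgt h.
Qed.

Lemma coef_t n k : (settle R k <= n)%N -> coef (t n) k = theta_lim k.
Proof.
rewrite /theta_lim; elim: n => [|n IH]; first by rewrite leqn0 => /eqP ->.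
rewrite leq_eqVlt => /orP[/eqP -> //|h]; rewrite (schemeS hs) coef_cat IH//.
by rewrite coef_w ?addr0//; exact: settle_threshold.
Qed.

Lemma theta_lim0 : theta_lim 0 = 0.
Proof.
rewrite /theta_lim /coef big_seq_cond big1// => a /andP[/t_neq0 h /eqP E].
by rewrite E eqxx in h.
Qed.

Lemma theta_lim_base : theta_lim k0 = 1.
Proof.
suff : forall n, coef (t n) k0 = 1 by exact.
elim=> [|n IH]; last by rewrite (schemeS hs) coef_cat IH coef_w ?addr0//; exact: threshold_base.
rewrite (scheme0 hs) /coef !big_cons big_nil eqxx /=.
case: eqP => [E|_]; last by rewrite addr0.
have : en R (k0 *+ 2) = 0 by rewrite mulr2n -{1}E addNr en0.
by rewrite enMn => /eqP; rewrite mulf_eq0 pnatr_eq0 /= gt_eqF ?en_gt0.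
Qed.

Lemma new_pairs_settle k n (q : atom * atom) : k != 0 -> (settle R k <= n)%N ->
  q \in new_pairs (t n) (w n) -> psum q != k.
Proof.
move=> k1 h /(stage_psum (scheme_stage hs n)); apply: contraTneq => ->.
rewrite !inE (negbTE k1) negb_or -ltNge settle_threshold// andbT.
by rewrite eq_sym (negbTE (target_settle k00 h)) eq_sym (negbTE (targetN_settle k00 h)).
Qed.

(** A later stage either targets [k] or [- k] again, and restores the zero, or it acts only at 0, at
    its own target and its opposite, and beyond a threshold larger than all earlier targets. *)
Lemma residual_solved j n k : (j < n)%N -> (k == target k0 j) || (k == - target k0 j) ->
  residual m gamma (t n) k = 0.
Proof.
move=> + hk; have hen : en R k = en R (target k0 j) by case/orP: hk => /eqP ->; rewrite ?enN.
have k1 : k != 0.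
  by apply: contraTneq (en_gt0 R (target_neq0 R k00 j)) => E; rewrite -hen E en0 ltxx.
have stage i : (k == target k0 i) || (k == - target k0 i) -> residual m gamma (t i.+1) k = 0.
  have h := stage_solved (scheme_stage hs i).
  move=> /orP[] /eqP ->; rewrite ?(residual_sym _ multN' _ (sym_t _)) (schemeS hs) h//.
  by apply: complex_eq => /=; rewrite ?oppr0.
elim: n => [//|n IH]; rewrite ltnS leq_eqVlt => /orP[/eqP E|jn].
  by rewrite -E; exact: stage.
have [/stage//|nk] := boolP ((k == target k0 n) || (k == - target k0 n)).
have kT : en R k < threshold R k0 n by rewrite hen threshold_target// ltnW.
rewrite (schemeS hs) residual_cat IH// add0r coef_w// bil_eq0 ?mulr0 ?addr0// => q hq.
have := stage_psum (scheme_stage hs n) hq; apply: contraTneq => ->.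
by rewrite !inE (negbTE k1) (negbTE nk) -ltNge.
Qed.

Lemma residual_settle k n : k != 0 -> (settle R k <= n)%N -> residual m gamma (t n) k = 0.
Proof.
move=> k1 h; apply: (@residual_solved (pickle k)); last by rewrite target_pickle// eqxx.
by apply: leq_trans h; rewrite /settle ltnS -addnA leq_addr.
Qed.

Lemma drift_sum n (S : seq 'rV[int]_d) : uniq S -> 0 \notin S ->
  target k0 n \notin S -> - target k0 n \notin S ->
  \sum_(x <- S) weight x * drift n x <= tolerance R n.
Proof.
move=> uS S0 h1 h2; have := stage_diff (scheme_stage hs n) uS S0 h1 h2.
by rewrite /drift (schemeS hs).
Qed.

Lemma weight_ge0 x : 0 <= weight x. Proof. exact: powR_ge0. Qed.

Lemma residual0_bounded : exists B, forall S : seq 'rV[int]_d, uniq S ->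
  \sum_(x <- S) weight x * normc (residual m gamma (t 0%N) x) <= B.
Proof.
pose F := undup ([seq a.1 | a <- t 0%N] ++ [seq psum q | q <- pairs (t 0%N) (t 0%N)]).
pose f x := weight x * normc (residual m gamma (t 0%N) x).
have f0 x : 0 <= f x by rewrite mulr_ge0 ?weight_ge0 ?normc_ge0.
exists (\sum_(x <- F) f x) => S uS.
have -> : \sum_(x <- S) f x = \sum_(x <- [seq x <- S | f x != 0]) f x.
  by rewrite big_filter [LHS](bigID (fun x => f x != 0)) /= [X in _ + X]big1 ?addr0// => x /negPn /eqP.
apply: ler_sum_uniq; rewrite ?filter_uniq ?undup_uniq// => x.
rewrite mem_filter => /andP[+ _]; apply: contraNT; rewrite mem_undup mem_cat negb_or => /andP[h1 h2].
rewrite /f /residual /coef big_seq_cond big1 => [|a /andP[at0 /eqP E]]; last first.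
  by move: h1; rewrite -E map_f.
rewrite bil_eq0 => [|q qt]; last by apply: contraNneq h2 => <-; exact: map_f.
have /eqP -> : normc (((2 * pi * en R x) `^ gamma)%:C * 0 + 'i%C * (2 * pi)%:C * 0 : R[i]) == 0.
  by rewrite normc_eq0 !mulr0 addr0.
by rewrite mulr0.
Qed.

Lemma residual_drift n x : normc (residual m gamma (t n) x) <=
  normc (residual m gamma (t 0%N) x) + \sum_(j < n) drift j x.
Proof.
elim: n => [|n IH]; first by rewrite big_ord0 addr0.
rewrite big_ord_recr /= addrA.
have -> : residual m gamma (t n.+1) x = residual m gamma (t n) x +
  (residual m gamma (t n.+1) x - residual m gamma (t n) x) by rewrite addrC subrK.
by apply: le_trans (ler_normcD _ _) _; rewrite lerD2r.
Qed.

(* When a frequency is targeted for the first time, its residual is the initial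
   one plus the drifts of the earlier stages; when it recurs, it is zero. *)
Lemma residual_targets_bounded : exists B, forall N,
  \sum_(n < N) weight (target k0 n) * normc (residual m gamma (t n) (target k0 n)) <= B.
Proof.
have [B hB] := residual0_bounded; exists (B + 1) => N.
pose fresh n := [forall j : 'I_n, (target k0 n != target k0 j) && (target k0 n != - target k0 j)].
pose I := [seq n <- iota 0 N | fresh n].
have freshP n j : n \in I -> (j < n)%N -> (target k0 n != target k0 j) /\ (target k0 n != - target k0 j).
  by rewrite mem_filter => /andP[/forallP h _] jn; have /andP[] := h (Ordinal jn).
have injI : {in I &, injective (target k0)}.
  move=> n n' nI nI' E; apply/eqP; apply: contraT; rewrite neq_ltn => /orP[h|h].
    by have [] := freshP _ _ nI' h; rewrite E eqxx.
  by have [] := freshP _ _ nI h; rewrite E eqxx.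
have uI : uniq I by rewrite filter_uniq// iota_uniq.
have uT (P : pred nat) : uniq [seq target k0 n | n <- I & P n].
  rewrite map_inj_in_uniq; first exact: filter_uniq uI.
  by move=> n n'; rewrite !(mem_filter P) => /andP[_ h] /andP[_ h']; exact: injI.
rewrite -(big_mkord xpredT (fun n => weight (target k0 n) * normc (residual m gamma (t n) (target k0 n)))).
apply: (@le_trans _ _ (\sum_(n <- I) weight (target k0 n) * normc (residual m gamma (t n) (target k0 n)))).
  rewrite /index_iota subn0 [leLHS](bigID fresh) /= -big_filter -/I [X in _ + X]big1 ?addr0// => n.
  rewrite negb_forall => /existsP[j]; rewrite negb_and !negbK => h.
  have /eqP -> : normc (residual m gamma (t n) (target k0 n)) == 0.
    by rewrite normc_eq0 (residual_solved (ltn_ord j)).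
  by rewrite mulr0.
apply: (@le_trans _ _ (\sum_(n <- I) (weight (target k0 n) * normc (residual m gamma (t 0%N) (target k0 n)) +
    \sum_(j < N | (j < n)%N) weight (target k0 n) * drift j (target k0 n)))).
  rewrite big_seq [leRHS]big_seq; apply: ler_sum => n; rewrite mem_filter mem_iota /= => /andP[_ nN].
  rewrite -mulr_sumr -mulrDr ler_wpM2l ?weight_ge0//; apply: le_trans (residual_drift _ _) _.
  by rewrite lerD2l (big_ord_widen N (fun j => drift j _))// ltnW.
rewrite big_split /=; apply: lerD.
  rewrite -(big_map (target k0) xpredT (fun x => weight x * normc (residual m gamma (t 0%N) x))).
  by apply: hB; have := uT predT; rewrite filter_predT.
apply: le_trans (sum_tolerance R N).
(* The double sum is regrouped by the stage [j] causing the drift: fresh targets after [j] are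
   distinct and avoid the target of [j] and its opposite, so one use of [drift_sum] bounds them
   together. *)
under eq_bigr do rewrite big_mkcond; rewrite exchange_big /=; apply: ler_sum => j _.
rewrite -big_mkcond -big_filter -(big_map (target k0) xpredT (fun x => weight x * drift j x)).
apply: drift_sum; first exact: (uT (fun n => (j < n)%N)).
- apply/mapP => -[n _ E]; by have := target_neq0 R k00 n; rewrite -E eqxx.
- apply/mapP => -[n]; rewrite mem_filter => /andP[jn nI] E.
  by have [] := freshP _ _ nI jn; rewrite E eqxx.
- apply/mapP => -[n]; rewrite mem_filter => /andP[jn nI] E.
  by have [_] := freshP _ _ nI jn; rewrite E eqxx.
Qed.

End SchemeLimit.

Lemma bounded_partial_sums (R : realType) (g u : nat -> R) (D : R) (J : nat) :
  (forall n, 0 <= g n) -> (forall n, 0 <= u n) -> (forall n : nat, \sum_(j < n) u j <= D) ->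
  (forall n, (J <= n)%N -> g n <= u n) -> exists C, forall n : nat, \sum_(j < n) g j <= C.
Proof.
move=> g0 u0 uD hg; exists (\sum_(j < J) g j + D) => n.
apply: (@le_trans _ _ (\sum_(j < n) ((if (j < J)%N then g j else 0) + u j))).
  apply: ler_sum => j _; case: ifPn => [_|]; first by rewrite lerDl.
  by rewrite -leqNgt add0r; exact: hg.
rewrite big_split /=; apply: lerD; last exact: uD.
rewrite -(big_mkord xpredT (fun j => if (j < J)%N then g j else 0)) -(big_mkord xpredT g).
rewrite -big_mkcond -big_filter; apply: ler_sum_uniq => //; rewrite ?filter_uniq ?iota_uniq//.
by move=> i; rewrite mem_filter !mem_index_iota => /andP[-> _].
Qed.

(** * Summability of the limit coefficients and the equation they satisfy *)

Section LimitEstimates.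
Variables (R : realType) (d : nat) (m : 'rV[int]_d -> 'rV[R[i]]_d) (gamma : R).
Hypothesis hm : standing_multiplier m.
Notation atom := ('rV[int]_d * R[i])%type.
Notation sigma := (sobolev_exponent gamma).
Variables (k0 : 'rV[int]_d) (C0 : R) (t w : nat -> seq atom).
Hypotheses (k00 : k0 != 0) (C00 : 0 < C0) (hs : scheme m gamma k0 C0 t w).
Implicit Types (k x : 'rV[int]_d) (n N j : nat).
Notation theta := (theta_lim t).

Lemma settle_bound (S : seq 'rV[int]_d) : exists n, forall k, k \in S -> (settle R k <= n)%N.
Proof.
exists (\max_(k <- S) settle R k)%N => k kS.
by rewrite (big_rem k)//= leq_maxl.
Qed.

Lemma theta_wsum eps : 0 < eps -> exists C, wsum_le eps theta C.
Proof.
move=> e0; pose g n := \sum_(a <- w n) en R a.1 `^ (- eps) * normc a.2.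
have g0 n : 0 <= g n by apply: sumr_ge0 => a _; rewrite mulr_ge0 ?powR_ge0 ?normc_ge0.
have [C hC] : exists C, forall n, \sum_(j < n) g j <= C.
  apply: (@bounded_partial_sums _ g (tolerance R) 1 (Num.truncn eps^-1)) => // [n|n|n hn].
    exact: ltW (tolerance_gt0 R n).
    exact: sum_tolerance.
  apply: le_trans (stage_wsum (scheme_stage hs n)).
  rewrite /g big_seq [leRHS]big_seq; apply: ler_sum => a aw.
  rewrite ler_wpM2r ?normc_ge0//; apply: powR_le_en; first exact: (stage_neq0 (scheme_stage hs n)).
  rewrite lerN2 -[leRHS]invrK lef_pV2 ?posrE ?invr_gt0//.
  apply: le_trans (ltW (truncnS_gt _)) _; rewrite ler_nat; exact: leq_trans hn _.
exists (\sum_(a <- t 0%N) en R a.1 `^ (- eps) * normc a.2 + C) => S uS _.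
have [n hn] := settle_bound S.
rewrite (eq_big_seq (fun k => en R k `^ (- eps) * normc (coef (t n) k))); last first.
  by move=> k /hn h; rewrite (coef_t hs h).
apply: le_trans (wsum_coef_le _ _ uS) _; first by move=> x; exact: powR_ge0.
apply: (@le_trans _ _ (\sum_(a <- t n) en R a.1 `^ (- eps) * normc a.2)).
  rewrite big_mkcond; apply: ler_sum => a _; case: ifP => // _.
  by rewrite mulr_ge0 ?powR_ge0 ?normc_ge0.
by rewrite (t_sum hs) lerD2l.
Qed.

(** On a finite list of pairs, [theta] agrees with the coefficients of one iterate. Its pairs are
    the initial ones and those created by each stage, which cost [C0] times the weighted residual at
    the target plus a summable tolerance. *)
Lemma theta_pairsum M : 1 <= M -> (forall i k, k != 0 -> normc (m k 0 i) <= M) ->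
  exists C, forall i, pairsum_le theta (multiplier m theta i) sigma C.
Proof.
move=> M1 hM; have [B hB] := residual_targets_bounded hm k00 hs.
pose P0 := \sum_(q <- pairs (t 0%N) (t 0%N) | psum q != 0) en R (psum q) `^ (- sigma) * pnorm q.
exists (M * (P0 + (C0 * B + 1))) => i S uS S0.
have M0 : 0 <= M by apply: le_trans M1.
have [n hn] := settle_bound ([seq q.2 | q <- S] ++ [seq q.1 - q.2 | q <- S]).
apply: (@le_trans _ _ (\sum_(q <- S) M * (en R q.1 `^ (- sigma) *
    (normc (coef (t n) q.2) * normc (coef (t n) (q.1 - q.2)))))).
  rewrite big_seq [leRHS]big_seq; apply: ler_sum => q qS; rewrite /pairw [leRHS]mulrCA ler_wpM2l ?powR_ge0//.
  have h1 : (settle R q.2 <= n)%N by apply: hn; rewrite mem_cat map_f.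
  have h2 : (settle R (q.1 - q.2) <= n)%N.
    by apply: hn; rewrite mem_cat orbC (map_f (fun q => q.1 - q.2)).
  rewrite !(coef_t hs)// mulrCA ler_wpM2l ?normc_ge0// /multiplier ComplexField.Normc.normcM.
  have [->|b0] := eqVneq (q.1 - q.2) 0.
    have /eqP -> : normc (theta 0) == 0 by rewrite normc_eq0 (theta_lim0 k00 hs).
    by rewrite !mulr0.
  by rewrite ler_wpM2r ?normc_ge0// hM.
rewrite -mulr_sumr ler_wpM2l//.
apply: le_trans (pairsum_coef_le (wt := fun x => en R x `^ (- sigma)) (t n) _ uS S0) _; first by move=> x; exact: powR_ge0.
rewrite (t_pairs_sum hs) lerD2l.
apply: (@le_trans _ _ (\sum_(j < n) (C0 * (weight gamma (target k0 j) *
    normc (residual m gamma (t j) (target k0 j))) + tolerance R j))).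
  by apply: ler_sum => j _; exact: (stage_pairs (scheme_stage hs j)).
rewrite big_split /= -mulr_sumr; apply: lerD; last exact: sum_tolerance.
by apply: ler_wpM2l; [exact: ltW|exact: hB].
Qed.

Definition support_pairs k : seq 'rV[int]_d := undup [seq a.1 | a <- t (settle R k)].

Lemma mem_coef (s : seq atom) k : coef s k != 0 -> exists2 a : atom, a \in s & a.1 = k.
Proof.
move=> h; have [/hasP[a aS /eqP E]|/hasPn hN] := boolP (has (fun a : atom => a.1 == k) s).
  by exists a.
move: h; rewrite /coef big_seq_cond big1 ?eqxx// => a /andP[/hN /negbTE ->//].
Qed.

Lemma pair_settled k n (q : atom * atom) : k != 0 -> (settle R k <= n)%N ->
  q \in pairs (t n) (t n) -> psum q = k -> q.1.1 \in support_pairs k.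
Proof.
move=> k1; elim: n => [|n IH]; rewrite leq_eqVlt => /orP[/eqP E|h].
- by rewrite mem_undup E mem_pairs => /andP[h _] _; exact: (map_f (fun a : atom => a.1)).
- by [].
- by rewrite mem_undup E mem_pairs => /andP[h _] _; exact: (map_f (fun a : atom => a.1)).
rewrite (schemeS hs) => /mem_pairs_cat[|hq E]; first exact: IH.
by have := new_pairs_settle k00 hs k1 h hq; rewrite E eqxx.
Qed.

Lemma support_pairsP k a : k != 0 -> theta a * theta (k - a) != 0 -> a \in support_pairs k.
Proof.
move=> k1; have [n hn] := settle_bound [:: k; a; k - a].
rewrite -!(coef_t hs (hn _ _)) ?inE ?eqxx ?orbT// mulf_eq0 negb_or => /andP[/mem_coef[x xt xa] /mem_coef[y yt yb]].
rewrite -xa; apply: (@pair_settled k n (x, y)) => //; first by apply: hn; rewrite inE eqxx.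
  by rewrite mem_pairs xt.
by rewrite /psum /= xa yb addrC subrK.
Qed.

(** Grouping atoms by frequency turns the sum over pairs of atoms into a convolution of
    coefficients. *)
Lemma bil_coef (s : seq atom) (S : seq 'rV[int]_d) k : uniq S ->
  (forall a, coef s a * coef s (k - a) != 0 -> a \in S) ->
  bil m (pairs s s) k = \sum_(a <- S) coef s a * coef s (k - a) * mdot m k (k - a).
Proof.
move=> uS hS.
(* [S] may miss frequencies whose atoms cancel; enlarging it by all atom frequencies makes the
   grouping exhaustive and adds only zero terms. *)
rewrite (@eq_sum_support _ _ S (undup (S ++ [seq a.1 | a <- s]))) ?undup_uniq//; last first.
  by move=> a; rewrite mem_undup mem_cat => h; rewrite hS ?orTb//; apply: contraNneq h => ->; rewrite mul0r.
rewrite /bil big_mkcond /pairs big_allpairs /=.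
transitivity (\sum_(c <- undup (S ++ [seq a.1 | a <- s])) \sum_(a <- s | a.1 == c)
   a.2 * coef s (k - a.1) * mdot m k (k - a.1)).
  rewrite sum_group ?undup_uniq// [RHS]big_seq_cond [LHS]big_seq; apply: eq_big => [a|a ha].
    by have [ha|//] := boolP (a \in s); rewrite mem_undup mem_cat (map_f (fun a : atom => a.1) ha) orbT.
  transitivity (\sum_(b <- s | b.1 == k - a.1) a.2 * b.2 * mdot m k (k - a.1)); last first.
    by rewrite -big_distrl -big_distrr.
  rewrite [RHS]big_mkcond; apply: eq_bigr => b _ /=.
  rewrite /psum /= -subr_eq0 -[in RHS]subr_eq0 opprB addrA [b.1 + a.1]addrC.
  by case: eqP => // /eqP; rewrite subr_eq0 => /eqP <-; rewrite [a.1 + _]addrC addrK.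
apply: eq_bigr => c _; rewrite [in RHS]/coef !mulr_suml.
by apply: eq_bigr => a /eqP ->.
Qed.

(** At a stage past the settling of [k] and of all frequencies paired in it, the expression is the
    residual of the iterate, which vanishes. *)
Lemma theta_equation k : k != 0 -> ((2 * pi * en R k) `^ gamma)%:C * theta k +
  'i%C * (2 * pi)%:C * \sum_i (k 0 i)%:~R *
    parasum theta (multiplier m theta i) support_pairs k = 0.
Proof.
move=> k1; have [n hn] := settle_bound (k :: support_pairs k ++ [seq k - a | a <- support_pairs k]).
have hk : (settle R k <= n)%N by apply: hn; rewrite inE eqxx.
rewrite -[RHS](residual_settle hm k00 hs k1 hk) /residual (coef_t hs hk); congr (_ + _ * _).
rewrite (@bil_coef (t n) (support_pairs k) k) ?undup_uniq//; last first.
  move=> a; rewrite mulf_eq0 negb_or => /andP[/mem_coef[x xt xa] /mem_coef[y yt yb]].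
  rewrite -xa; apply: (@pair_settled k n (x, y)) => //; first by rewrite mem_pairs xt.
  by rewrite /psum /= xa yb addrC subrK.
rewrite /parasum (negbTE k1); under eq_bigr do rewrite mulr_sumr.
rewrite exchange_big /=; apply: eq_big_seq => a ha.
rewrite !(coef_t hs) ?hn ?inE ?mem_cat ?ha ?orbT//; last first.
  by rewrite (map_f (fun a => k - a) ha) !orbT.
rewrite /mdot mulr_sumr; apply: eq_bigr => i _.
by rewrite /multiplier; ring.
Qed.

End LimitEstimates.

(** * Limits in Lebesgue spaces *)

Section LpLimit.
Variables (R : realType) (d : nat) (h W : nat -> 'rV[R]_d -> R).
Hypotheses (th : forall n, tame (h n)) (tW : forall n, tame (W n)).
Hypothesis hW : forall n x, `|h n x| <= W n x.
Hypothesis hB : forall p, 1 <= p < 2 -> exists B, forall N : nat,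
  \sum_(n < N) 4 ^+ n.+1 * tint (fun x => W n x `^ p) <= B.
Implicit Types (x : 'rV[R]_d) (N n : nat) (p : R).

Definition partial N x : R := \sum_(n < N) h n x.
Definition majorant N x : R := \sum_(n < N) W n x.
(** An upper limit exists at every point, so measurability and periodicity hold without exceptional
    set; it is the true limit wherever the majorants stay bounded. *)
Definition limit x : R := fine (limn_esup (fun N => (partial N x)%:E)).

Lemma W_ge0 n x : 0 <= W n x.
Proof. exact: le_trans (hW n x). Qed.

Lemma majorant_ge0 N x : 0 <= majorant N x.
Proof. by apply: sumr_ge0 => n _; exact: W_ge0. Qed.

Lemma majorant_nd N N' x : (N <= N')%N -> majorant N x <= majorant N' x.
Proof.
move=> /subnKC <-; rewrite /majorant big_split_ord /= lerDl.
by apply: sumr_ge0 => n _; exact: W_ge0.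
Qed.

Lemma norm_partial N x : `|partial N x| <= majorant N x.
Proof. by apply: le_trans (ler_norm_sum _ _ _) _; apply: ler_sum => n _; exact: hW. Qed.

Lemma limit_cvg x K : (forall N, majorant N x <= K) ->
  (partial N x @[N --> \oo] --> limit x) /\ `|limit x| <= K.
Proof.
move=> hK.
have E : partial ^~ x = series (h ^~ x) by apply/funext => N; rewrite seriesEord.
have c1 : cvgn (partial ^~ x).
  rewrite E; apply: normed_cvg; apply: nondecreasing_is_cvgn.
    by apply: nondecreasing_series => n _ _; exact: normr_ge0.
  exists K => _ [N _ <-]; apply: le_trans (hK N).
  rewrite /normed_series_of seriesEord; apply: ler_sum => n _; exact: hW.
have c2 : (partial N x)%:E @[N --> \oo] --> (limn (partial ^~ x))%:E by apply: cvg_EFin; [exact: nearW|exact: c1].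
have l : limit x = limn (partial ^~ x).
  by rewrite /limit is_cvg_limn_esupE ?(cvg_lim _ c2)//; apply/cvg_ex; eexists; exact: c2.
split; first by rewrite l.
rewrite l; have c3 : `|partial N x| @[N --> \oo] --> `|limn (partial ^~ x)| by exact: cvg_norm.
rewrite -(cvg_lim _ c3)//; apply: limr_le; first by apply/cvg_ex; eexists; exact: c3.
by apply: nearW => N; exact: le_trans (norm_partial N x) (hK N).
Qed.

(** [powRD_le] is iterated, splitting off the first term each time; the geometric weights are
    affordable because the stage tolerances decay faster. *)
Lemma powR_sum_le (a : nat -> R) p N : 1 <= p <= 2 -> (forall n, 0 <= a n) ->
  (\sum_(n < N) a n) `^ p <= \sum_(n < N) 4 ^+ n.+1 * a n `^ p.
Proof.
move=> /andP[p1 p2]; have p0 : p != 0 by rewrite gt_eqF//; lra.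
elim: N a => [|N IH] a a0; first by rewrite !big_ord0 powR0.
rewrite !big_ord_recl /= expr1.
apply: le_trans (powRD_le (p := p) _ _ _) _; rewrite ?a0 ?sumr_ge0//; first by lra.
rewrite mulrDr lerD2l.
apply: (@le_trans _ _ (4 * \sum_(n < N) 4 ^+ n.+1 * a n.+1 `^ p)).
  by rewrite ler_wpM2l//; exact: (IH (fun n => a n.+1)).
by rewrite mulr_sumr; apply: ler_sum => n _; rewrite mulrA -exprS.
Qed.

Lemma tame_tint_sum (F : nat -> 'rV[R]_d -> R) N : (forall n, tame (F n)) ->
  tame (fun x => \sum_(n < N) F n x) /\
  tint (fun x => \sum_(n < N) F n x) = \sum_(n < N) tint (F n).
Proof.
move=> tF; elim: N => [|N [IH1 IH2]].
  rewrite (_ : (fun x => \sum_(n < 0) F n x) = fun=> 0); last by apply/funext => x; rewrite big_ord0.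
  by rewrite big_ord0 tint_cst; split => //; exact: tame_cst.
rewrite (_ : (fun x => \sum_(n < N.+1) F n x) = fun x => \sum_(n < N) F n x + F N x); last first.
  by apply/funext => x; rewrite big_ord_recr.
by rewrite tintD// IH2 big_ord_recr; split => //; exact: tameD.
Qed.

Lemma tame_majorant N : tame (majorant N).
Proof. exact: (tame_tint_sum N tW).1. Qed.

Lemma tame_partial N : tame (partial N).
Proof. exact: (tame_tint_sum N th).1. Qed.

Lemma tint_majorant_powR p : 1 <= p < 2 -> exists B, forall N, tint (fun x => majorant N x `^ p) <= B.
Proof.
move=> p12; have [B hB'] := hB p12; exists B => N; have /andP[p1 p2] := p12.
apply: le_trans (hB' N).
have tWp n : tame (fun x => W n x `^ p) by apply: tame_powR; [lra|exact: tW|exact: W_ge0].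
have [t1 E1] := tame_tint_sum N (fun n => tameZ (4 ^+ n.+1) (tWp n)).
apply: (@le_trans _ _ (tint (fun x => \sum_(n < N) 4 ^+ n.+1 * W n x `^ p))).
  apply: le_tint => //; first by apply: tame_powR; [lra|exact: tame_majorant|exact: majorant_ge0].
  by move=> x; apply: (@powR_sum_le (fun n => W n x)) => [|n]; [lra|exact: W_ge0].
by rewrite E1; apply: ler_sum => n _; rewrite tintZ.
Qed.

(** [G] is the increasing limit of the [p]-th powers of the majorants, integrable by monotone
    convergence; where it is finite, the series converges. *)
Lemma envelope p : 1 <= p < 2 -> exists G : d.-tuple (measurableTypeR R) -> \bar R,
  [/\ forall t, (0 <= G t)%E, measurable_fun setT G, (\int[cube R d]_t G t < +oo)%E &
   forall t N, ((majorant N (torus_pt t) `^ p)%:E <= G t)%E].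
Proof.
move=> p12; have /andP[p1 p2] := p12.
pose g N (t : d.-tuple (measurableTypeR R)) := (majorant N (torus_pt t) `^ p)%:E.
have tg N : tame (fun x => majorant N x `^ p).
  by apply: tame_powR; [lra|exact: tame_majorant|exact: majorant_ge0].
have mg N : measurable_fun setT (g N) by apply/measurable_EFinP; exact: (tg N).1.
have g0 N t : (0 <= g N t)%E by rewrite lee_fin powR_ge0.
have gnd t : {homo g ^~ t : n m / (n <= m)%N >-> (n <= m)%E}.
  move=> N N' NN'; rewrite lee_fin ge0_ler_powR ?nnegrE ?majorant_ge0 ?majorant_nd//; lra.
have cg t : cvgn (g ^~ t) by exact: ereal_nondecreasing_is_cvgn.
exists (fun t => limn (g ^~ t)); split.
- by move=> t; apply: lime_ge => //; exact: nearW.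
- under eq_fun => t do rewrite -is_cvg_limn_esupE//.
  exact: measurable_fun_limn_esup.
- have [B hB'] := tint_majorant_powR p12.
  have c := @cvg_monotone_convergence _ _ _ (cube R d) setT measurableT g mg (fun n t _ => g0 n t) (fun t _ => gnd t).
  apply: (@le_lt_trans _ _ B%:E); last exact: ltry.
  rewrite -(cvg_lim _ c)//; apply: lime_le; first by apply/cvg_ex; eexists; exact: c.
  apply: nearW => N; have := hB' N; rewrite -lee_fin; apply: le_trans.
  rewrite le_eqVlt; apply/orP; left; apply/eqP; rewrite /tint /Rintegral fineK//.
  exact: integrable_fin_num (tame_integrable (tg N)).
- by move=> t N; apply: lime_ge => //; exists N => // N' /= NN'; exact: (gnd t _ _ NN').
Qed.

Lemma measurable_limit : measurable_fun setT (limit \o @torus_pt R d).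
Proof.
apply: measurableT_comp; first exact: fine_measurable.
by apply: measurable_fun_limn_esup => N; apply/measurable_EFinP; exact: (tame_partial N).1.
Qed.

Lemma limit_in_Lp p : 1 <= p < 2 -> in_Lp p%:E limit.
Proof.
move=> p12; have /andP[p1 p2] := p12; have [G [G0 mG iG hG]] := envelope p12.
have p0 : 0 < p by lra.
rewrite /in_Lp inE; apply/andP; split; rewrite inE /=; first exact: measurable_limit.
rewrite /finite_norm unlock; apply: poweR_lty; apply: le_lt_trans iG.
apply: ge0_le_integral => //; first by move=> t _; exact: poweR_ge0.
  apply: (measurableT_comp (measurable_poweR p)); apply: measurableT_comp => //.
  by apply/measurable_EFinP; exact: measurable_limit.
move=> t _ /=.
case E : (G t) => [r| |]; rewrite ?leey//; last by have := G0 t; rewrite E.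
have r0 : 0 <= r by rewrite -lee_fin -E.
have hr N : majorant N (torus_pt t) <= r `^ p^-1.
  have := hG t N; rewrite E lee_fin => h'.
  have -> : majorant N (torus_pt t) = (majorant N (torus_pt t) `^ p) `^ p^-1.
    by rewrite -powRrM mulfV ?gt_eqF// powRr1// majorant_ge0.
  by rewrite ge0_ler_powR ?nnegrE ?powR_ge0 ?invr_ge0// ltW.
have [_ hl] := limit_cvg hr.
have -> : r = (r `^ p^-1) `^ p by rewrite -powRrM mulVf ?gt_eqF// powRr1.
by rewrite lee_fin ge0_ler_powR ?nnegrE ?powR_ge0 ?(ltW p0).
Qed.

(** Dominated convergence under the envelope for [p = 1]: the integrals of the partial sums against
    [c] are eventually equal to [v]. *)
Lemma tint_limit (c : 'rV[R]_d -> R) (v : R) N0 : tame c ->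
  (forall N, (N0 <= N)%N -> tint (fun x => partial N x * c x) = v) ->
  tint (fun x => limit x * c x) = v.
Proof.
move=> tc hv; have [mc [C hC]] := tc.
have [|G [G0 mG iG hG]] := @envelope 1; first by lra.
have C0 : 0 <= C by apply: le_trans (hC 0); exact: normr_ge0.
have tf N : tame (fun x => partial N x * c x) by apply: tameM => //; exact: tame_partial.
have iGC : (cube R d).-integrable setT (fun t => C%:E * G t)%E.
  apply: integrableZl => //; apply/integrableP; split => //.
  by under eq_integral do rewrite gee0_abs//.
have iG' : (cube R d).-integrable setT G.
  by apply/integrableP; split => //; under eq_integral do rewrite gee0_abs//.
have := @dominated_convergence _ _ _ (cube R d) setT measurableT
  (fun N t => (partial N (torus_pt t) * c (torus_pt t))%:E)
  (fun t => (limit (torus_pt t) * c (torus_pt t))%:E) (fun t => C%:E * G t)%E.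
case.
- by move=> N; apply/measurable_EFinP; exact: (tf N).1.
- by apply/measurable_EFinP; apply: measurable_funM => //; exact: measurable_limit.
- have := integrable_ae measurableT iG'; apply: filterS => t /(_ I) /fineK E _.
  have hr N : majorant N (torus_pt t) <= fine (G t).
    by have := hG t N; rewrite powRr1 ?majorant_ge0// -E lee_fin.
  have [cl _] := limit_cvg hr.
  apply: cvg_EFin; first exact: nearW.
  by apply: cvgM cl _; exact: cvg_cst.
- exact: iGC.
- apply: aeW => t N _; rewrite abse_EFin normrM muleC EFinM; apply: lee_pmul; rewrite ?lee_fin//.
  apply: le_trans (hG t N); rewrite lee_fin powRr1 ?majorant_ge0//; exact: norm_partial.
move=> ilim _ cv.
have : (\int[cube R d]_t (limit (torus_pt t) * c (torus_pt t))%:E = v%:E)%E.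
  apply: (cvg_unique _ cv) => //.
  apply: (@cvg_trans _ (v%:E @[_ --> \oo])); last exact: cvg_cst.
  apply: near_eq_cvg; exists N0 => // N /= /hv <-.
  rewrite /tint /Rintegral fineK//; exact: integrable_fin_num (tame_integrable (tf N)).
by rewrite /tint /Rintegral => ->.
Qed.

End LpLimit.

(** * The limit coefficients as Fourier coefficients of functions *)

Section RealLimits.
Variables (R : realType) (d : nat) (m : 'rV[int]_d -> 'rV[R[i]]_d) (gamma : R).
Hypothesis hm : standing_multiplier m.
Notation atom := ('rV[int]_d * R[i])%type.
Variables (k0 : 'rV[int]_d) (C0 : R) (t w : nat -> seq atom).
Hypotheses (k00 : k0 != 0) (hs : scheme m gamma k0 C0 t w).
Implicit Types (k : 'rV[int]_d) (x : 'rV[R]_d) (o : option 'I_d) (n N : nat).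

Let increment n : seq atom := if n is n'.+1 then w n' else t 0%N.

Let h o n x : R := complex.Re (trig m o (increment n) x).

Definition solution o : 'rV[R]_d -> R := limit (h o).

Lemma ctame_trig o (s : seq atom) : ctame (trig m o s).
Proof.
rewrite /trig; apply: ctame_sum => a; apply: ctameM; [exact: ctame_cst|exact: ctame_echar].
Qed.

Lemma partial_trig o N x : partial (h o) N.+1 x = complex.Re (trig m o (t N) x).
Proof.
elim: N => [|N IH]; first by rewrite /partial big_ord1.
by rewrite /partial big_ord_recr /= -/(partial _ _ _) IH (schemeS hs) trig_cat ReD.
Qed.

Lemma zperiodic_solution o : zperiodic (solution o).
Proof.
move=> x l; rewrite /solution /limit; congr (fine (limn_esup _)).
apply/funext => N; congr (_%:E); apply: eq_bigr => n _; rewrite /h; congr (complex.Re _).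
by rewrite /trig; apply: eq_bigr => a _; rewrite zperiodic_echar.
Qed.

Lemma sum_half N : \sum_(n < N) (2^-1 : R) ^+ n <= 2.
Proof.
suff : \sum_(n < N) (2^-1 : R) ^+ n <= 2 - 2 * 2^-1 ^+ N by have : 0 <= (2^-1 : R) ^+ N by []; lra.
elim: N => [|N IH]; first by rewrite big_ord0 expr0; lra.
by rewrite big_ord_recr /= exprS; lra.
Qed.

(** One majorant serves the scalar and all velocity components. The index is shifted by one, the
    initial polynomial being the term of index 0. *)
Lemma majorants : exists W : nat -> 'rV[R]_d -> R, [/\ forall n, tame (W n),
  forall o n x, `|h o n x| <= W n x &
  forall p, 1 <= p < 2 -> exists B, forall N : nat,
    \sum_(n < N) 4 ^+ n.+1 * tint (fun x => W n x `^ p) <= B].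
Proof.
have [M M1 hM] := mult_bounded hm.
have /boolp.choice[V hV] := fun n => stage_envelope (scheme_stage hs n).
have hsym o k : k != 0 -> normc (symbol m o k) <= M.
  case: o => [i|] k1; first exact: hM.
  by change (normc (1 : R[i]) <= M); rewrite (normcR 1) normr1.
pose W n : 'rV[R]_d -> R := if n is n'.+1 then V n' else fun=> 2 * M.
have W0 : forall o n x, `|h o n x| <= W n x.
  move=> o [|n] x; apply: le_trans (ler_norm_Re _) _ => /=; last by have [_ +  _] := hV n; exact.
  rewrite (scheme0 hs) /trig !big_cons big_nil addr0 /= !mulr1.
  apply: le_trans (ler_normcD _ _) _; rewrite !ComplexField.Normc.normcM !normc_echar !mulr1.
  by have := hsym o k0 k00; have := hsym o (- k0); rewrite oppr_eq0 => /(_ k00); lra.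
exists W; split=> //; first by case=> [|n] /=; [exact: tame_cst|have [] := hV n].
move=> p p12; have /andP[p1 p2] := p12.
pose g n := 4 ^+ n.+1 * tint (fun x => W n x `^ p).
have g0 n : 0 <= g n.
  by rewrite mulr_ge0 ?exprn_ge0// /tint Rintegral_ge0// => y _; exact: powR_ge0.
(* Stage [n] controls exponents up to [2 - n.+2%:R^-1], so [p] is covered from here on; the earlier
   terms are only finitely many. *)
pose J := (Num.truncn (2 - p)^-1).+1.
apply: (@bounded_partial_sums _ g (fun n => 4 * 2^-1 ^+ n) (4 * 2) J) => //.
  by move=> N; rewrite -mulr_sumr ler_wpM2l// sum_half.
case=> [|n] // hn; have [_ _ hp] := hV n.
have pn : 1 <= p <= 2 - n.+2%:R^-1.
  rewrite p1 /= lerBrDl -lerBrDr.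
  rewrite -[leRHS]invrK lef_pV2 ?posrE ?invr_gt0 ?subr_gt0//.
  apply: le_trans (ltW (truncnS_gt _)) _; rewrite ler_nat; exact: leq_trans hn _.
rewrite /g; apply: le_trans (ler_wpM2l _ (hp _ pn)) _; first exact: exprn_ge0.
have E : 4 ^+ n.+1 * tolerance R n = 2^-1 ^+ n.+1.
  by rewrite /tolerance -exprMn; congr (_ ^+ _); field.
by rewrite exprS -mulrA E.
Qed.

Lemma solution_in_Lp o p : 1 <= p < 2 -> in_Lp p%:E (solution o).
Proof.
have [W [tW hW hB]] := majorants.
by apply: (@limit_in_Lp _ _ (h o) W) => // n; exact: (ctame_trig o (increment n)).1.
Qed.

(** The coefficients at [k] of the partial sums are constant from stage [settle R k] on, so the
    limit keeps this value. *)
Lemma rfourier_solution o k : rfourier (solution o) k = symbol m o k * theta_lim t k.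
Proof.
have [W [tW hW hB]] := majorants.
have th n : tame (h o n) by exact: (ctame_trig o (increment n)).1.
have E N : (settle R k <= N)%N -> fourier (trig m o (t N)) k = symbol m o k * theta_lim t k.
  move=> hN; rewrite /trig fourier_sum -(coef_t hs hN) /coef mulr_sumr.
  by apply: eq_bigr => a /eqP ->.
have real N x : trig m o (t N) x = (partial (h o) N.+1 x)%:C.
  by rewrite partial_trig -trig_real//; [exact: (multN hm)|exact: (sym_t hs)].
have [tr ti] := ctame_echar R (- k).
rewrite /rfourier /fourier cintegralE; apply: complex_eq => /=.
  under eq_fun do rewrite mul0r subr0.
  apply: (@tint_limit _ _ (h o) W th tW _ hB _ _ (settle R k).+1) => // -[//|N] hN.
  rewrite -(E N hN) /fourier cintegralE /=; congr tint; apply/funext => x.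
  by rewrite real /= mul0r subr0.
under eq_fun do rewrite mul0r addr0.
apply: (@tint_limit _ _ (h o) W th tW _ hB _ _ (settle R k).+1) => // -[//|N] hN.
rewrite -(E N hN) /fourier cintegralE /=; congr tint; apply/funext => x.
by rewrite real /= mul0r addr0.
Qed.

Lemma measurable_solution o : measurable_fun setT (solution o \o @torus_pt R d).
Proof. by apply: measurable_limit => n; exact: (ctame_trig o (increment n)).1. Qed.

Lemma solution_neq0 o k : symbol m o k * theta_lim t k != 0 -> ~ ae_zero (solution o).
Proof.
rewrite -rfourier_solution => /eqP h0 hz; apply: h0.
have tint0 (c : 'rV[R]_d -> R) : tame c -> tint (fun x => solution o x * c x) = 0.
  move=> [mc _]; rewrite /tint /Rintegral.
  rewrite (@ae_eq_integral _ _ _ _ setT (cst 0%E))//.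
  - by rewrite integral0.
  - apply/measurable_EFinP; apply: measurable_funM => //; exact: measurable_solution.
  - by apply: filterS hz => y hy _; rewrite hy mul0r.
have [tr ti] := ctame_echar R (- k).
rewrite /rfourier /fourier cintegralE; apply: complex_eq => /=.
  by under eq_fun do rewrite mul0r subr0; exact: tint0.
by under eq_fun do rewrite mul0r addr0; exact: tint0.
Qed.

End RealLimits.

Theorem theorem1p3 (R : realType) (d : nat) (hd : (2 <= d)%N)
    (phi : 'rV[R]_d -> R) (hphi : LP_cutoff phi)
    (m : 'rV[int]_d -> 'rV[R[i]]_d) (hm : standing_multiplier m)
    (gamma : R) (hgamma : 0 < gamma <= 2) :
  exists (theta : 'rV[R]_d -> R) (u : 'rV[R]_d -> 'rV[R]_d),
    let u_ := fun (i : 'I_d) (x : 'rV[R]_d) => u x 0 i in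
    let theta_hat := rfourier theta in
    let u_hat := fun i : 'I_d => rfourier (u_ i) in
    (zperiodic theta /\ zperiodic u) /\
    (forall eps : R, 0 < eps < 1 ->
      (in_besov phi (- eps) theta_hat /\ in_Lp (2 - eps)%:E theta) /\
      (forall i, in_besov phi (- eps) (u_hat i) /\ in_Lp (2 - eps)%:E (u_ i))) /\
    (~ ae_zero theta /\ ~ ae_zero u) /\
    (forall i, u_hat i = multiplier m theta_hat i) /\
    (forall s : R, d%:R / 2 + Num.max (gamma - 1) 0 < s ->
      forall i, paraproduct_wd phi (- s) theta_hat (u_hat i)) /\
    weak_paraproduct_solution phi m gamma theta_hat u_hat.
Proof.
have [M M1 hM] := mult_bounded hm.
have [k0 k00 [i0 mk0]] := exists_mult_neq0 hm.
have [C0 C00 [t [w hs]]] := scheme_exists gamma hm hd k00.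
pose theta := theta_lim t.
pose sigma := sobolev_exponent gamma.
have th : rfourier (solution m t w None) = theta.
  by apply/funext => k; rewrite (rfourier_solution hm k00 hs) mul1r.
have uh i : rfourier (solution m t w (Some i)) = multiplier m theta i.
  by apply/funext => k; rewrite (rfourier_solution hm k00 hs).
have [C2 hC2] := theta_pairsum hm k00 C00 hs M1 hM.
have [C1 hC1] : exists C, wsum_le 2^-1 theta C by apply: (theta_wsum hs); rewrite invr_gt0.
exists (solution m t w None), (fun x => \row_i solution m t w (Some i) x).
have -> : (fun (i : 'I_d) (x : 'rV[R]_d) => (\row_j solution m t w (Some j) x) 0 i) =
    fun i => solution m t w (Some i).
  by apply/funext => i; apply/funext => x; rewrite mxE.
rewrite /= th; have -> : (fun i => rfourier (solution m t w (Some i))) = [eta multiplier m theta].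
  by apply/funext => i; exact: uh.
split; [|split; [|split; [|split; [|split]]]].
- split; first exact: zperiodic_solution.
  by move=> x k; apply/rowP => i; rewrite !mxE zperiodic_solution.
- move=> eps /andP[eps0 eps1].
  have p12 : 1 <= 2 - eps < 2 by lra.
  have [C hC] := theta_wsum hs eps0.
  have hT : in_besov phi (- eps) theta := besov_of_wsum hphi eps0 hC.
  split; first by split=> //; exact: (solution_in_Lp hm k00 hs).
  move=> i; split; last exact: (solution_in_Lp hm k00 hs).
  by rewrite uh; exact: (besov_of_wsum hphi eps0 (wsum_multiplier hM i hC)).
(* The coefficient at [k0] remains 1 through all stages, and [i0] is a component in which the
   multiplier does not vanish at [k0]. *)
- split; first by apply: (@solution_neq0 _ _ _ _ hm _ _ _ _ k00 hs None k0);
    rewrite (theta_lim_base k00 hs) mul1r oner_neq0.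
  move=> hz; apply: (@solution_neq0 _ _ _ _ hm _ _ _ _ k00 hs (Some i0) k0).
    by rewrite (theta_lim_base k00 hs) mulr1.
  by apply: filterS hz => y /rowP/(_ i0); rewrite !mxE.
- exact: uh.
- move=> s hsd i; rewrite uh; apply: (@paraproduct_wdP _ _ _ hphi _ _ s C2) => S uS S0.
  apply: le_trans (hC2 i S uS S0); rewrite big_seq [leRHS]big_seq; apply: ler_sum => q qS.
  rewrite /pairw ler_wpM2r ?mulr_ge0 ?normc_ge0//; apply: powR_le_en; first exact: S0.
  rewrite lerN2; apply: le_trans (ltW hsd).
  (* With [2 <= d], the exponent [sigma], which equals [1 + max (gamma - 1, 0)], lies below every
     admissible [s]. *)
  have d2 : 1 <= d%:R / 2 :> R by rewrite ler_pdivlMr// mul1r (ler_nat R 2).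
  apply: le_trans (_ : 1 + Num.max (gamma - 1) 0 <= _); last by rewrite lerD2r.
  by rewrite addr_maxr addr0 addrC subrK.
- apply: (@weak_paraproduct_solutionP _ _ _ hphi m theta M gamma sigma C1 C2 (fun=> support_pairs t)) => //.
  + exact: (theta_lim0 k00 hs).
  + by rewrite ge_max; case/andP: hgamma => _ ->; rewrite ler1n.
  + by move=> i k; exact: undup_uniq.
  + move=> i k a k1; rewrite /multiplier => h; apply: (support_pairsP k00 hs k1).
    by apply: contraNneq h => h; rewrite mulrCA h mulr0.
  + exact: (theta_equation hm k00 hs).
Qed.
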